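(* Let $f\in L^2(\nu_\rho)$ have the expansion $f=\sum_{n\ge0}\sum_{\xi\in\Omega_f:\|\xi\|=n}C_{n,\xi}D(\xi,\cdot)$ and suppose that $$\sum_{\xi,\xi'\in\Omega_f:\ \|\xi\|=\|\xi'\|=n,\ n\ge 0}|C_{n,\xi}\,C_{n,\xi'}|\,a(\xi')<\infty .$$ Let $k\ge1$, let $f_{k-1}$ denote the orthogonal projection of $f$ on $\mathcal H_{k-1}$, and let $\phi\in\mathcal S(\mathbb R^d)$. Then the field $$\mathsf X_N(f-f_{k-1},\eta;\phi)=\sum_{x\in\mathbb Z^d}\left(\tau_xf(\eta)-\tau_xf_{k-1}(\eta)\right)\phi\left(\tfrac xN\right)$$ of the system of independent random walkers is such that for all $T>0$ there exists $C(T)$ such that for all $N$ big enough $$\frac1{N^d}\int_0^T\int_0^T\mathbb E_{\nu_\rho}\left[\mathsf X_N(f-f_{k-1},\eta(N^2t);\phi)\,\mathsf X_N(f-f_{k-1},\eta(N^2s);\phi)\right]ds\,dt\le C(T)\,N^{-\frac{2(k-1)d}{2+(k-1)d}}.$$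
   Context: Fix $d\ge1$; $\mathbb N=\{0,1,2,\dots\}$; $\mathcal S(\mathbb R^d)$ is the space of (real) Schwartz functions. Let $p(i,j)$, $i,j\in\mathbb Z^d$, be a Markov transition function with $p(i,j)=p(j,i)=p(0,j-i)$, $\sum_jp(i,j)=1$, of finite range ($p(i,j)=0$ for $|i-j|>R$, some $R>0$), and irreducible. Independent random walkers: the Markov process $\{\eta(t):t\ge0\}$ on $\Omega=\mathbb N^{\mathbb Z^d}$ with generator $\mathcal Lf(\eta)=\sum_{i,j}p(i,j)\eta_i(f(\eta^{ij})-f(\eta))$ on local functions, where $\eta^{ij}$ is $\eta$ with one particle moved from $i$ to $j$; thus each particle independently performs a rate-1 continuous-time random walk with jump kernel $p$. The process is started from configurations for which it is well defined (a set of full $\nu_\rho$-measure). For $\rho>0$, $\nu_\rho$ is the homogeneous product measure on $\Omega$ with Poisson($\rho$) marginals, which is reversible; $\mathbb E_{\nu_\rho}$ is expectation for the process with $\eta(0)\sim\nu_\rho$. Shifts: $(\tau_x\eta)_y=\eta_{y+x}$ and $\tau_xf(\eta)=f(\tau_x\eta)$. $\Omega_f$ is the set of configurations with finitely many particles, $\|\xi\|=\sum_x\xi_x$. The orthogonal self-duality function is $D(\xi,\eta)=\prod_xd(\xi_x,\eta_x)$, $\xi\in\Omega_f$, with the Charlier polynomials $d(k,n)=\sum_{j=0}^k\binom kj(-\rho)^{-j}\frac{n!}{(n-j)!}$ (with $\frac{n!}{(n-j)!}=0$ for $j>n$). They satisfy $\int D(\xi,\eta)D(\xi',\eta)\,d\nu_\rho(\eta)=\delta_{\xi,\xi'}a(\xi)$,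 $a(\xi)=\|D(\xi,\cdot)\|^2_{L^2(\nu_\rho)}$. $\mathcal H_n$ is the closed subspace of $L^2(\nu_\rho)$ generated by $\{D(\xi,\cdot):\|\xi\|\le n\}$; the union of the $\mathcal H_n$ is dense in $L^2(\nu_\rho)$, so every $f\in L^2(\nu_\rho)$ has the (orthogonal, $L^2$-convergent) expansion with $C_{n,\xi}=\langle f,D(\xi,\cdot)\rangle/a(\xi)$, and $f_n=\sum_{\|\xi\|\le n}\langle f,D(\xi,\cdot)\rangle D(\xi,\cdot)/a(\xi)$. The constant $C(T)$ may depend on the fixed data $f,k,\phi,\rho,d,p$, but not on $N$. *)

(* Defs.v *)
From HB Require Import structures.
From mathcomp Require Import all_boot all_order all_algebra.
From mathcomp Require Import finmap.
From mathcomp Require Import all_classical all_reals all_analysis.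

Set Implicit Arguments.
Unset Strict Implicit.
Unset Printing Implicit Defensive.

Import Order.TTheory GRing.Theory Num.Theory.
Import numFieldNormedType.Exports.

Local Open Scope classical_set_scope.
Local Open Scope ring_scope.

Notation Zd d := 'rV[int]_d.

(* The norm `|embZ R x| is the sup norm; it is used where any equivalent norm
   yields the same notion. *)
Definition embZ (R : realType) (d : nat) (x : Zd d) : 'rV[R]_d :=
  map_mx (fun z : int => z%:~R) x.

(** * Sums *)

(* Sum of an absolutely summable real family over an arbitrary index type;
   the value is only meaningful for such families. *)
Definition rsum (R : realType) (I : choiceType) (u : I -> R) : R :=
  fine (\esum_(i in [set: I]) (Num.max (u i) 0)%:E)
  - fine (\esum_(i in [set: I]) (Num.max (- u i) 0)%:E).

(** * Schwartz functions *)

(* [iter_partial [:: i1; ..; im] phi] is the partial derivative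
   d_{i1} .. d_{im} phi. *)
Definition iter_partial (R : realType) (d : nat) (s : seq 'I_d)
    (phi : 'rV[R]_d -> R) : 'rV[R]_d -> R :=
  foldr (fun i (g : 'rV[R]_d -> R) => fun x => 'D_(delta_mx 0 i) g x) phi s.

(* Differentiability (in the Frechet sense) of all the iterated partial
   derivatives is smoothness. *)
Definition schwartz (R : realType) (d : nat) (phi : 'rV[R]_d -> R) : Prop :=
  (forall (s : seq 'I_d) (x : 'rV[R]_d), differentiable (iter_partial s phi) x)
  /\ forall (s : seq 'I_d) (m : nat), exists C : R, forall x : 'rV[R]_d,
       (1 + `|x|) ^+ m * `|iter_partial s phi x| <= C.

(** * The jump kernel and its continuous-time random walk *)

(* Sums over Zd written with [\in] are finitely supported sums; they are only
   applied to [p] under the finite-range assumption of [jump_kernel]. *)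
Fixpoint pstep (R : realType) (d : nat) (p : Zd d -> Zd d -> R) (n : nat)
    (i j : Zd d) : R :=
  if n is m.+1 then \sum_(l \in [set: Zd d]) p i l * pstep p m l j
  else (i == j)%:R.

Record jump_kernel (R : realType) (d : nat) (p : Zd d -> Zd d -> R) : Prop :=
  JumpKernel {
    jump_ge0 : forall i j, 0 <= p i j;
    jump_range : exists2 r : R, 0 < r &
      forall i j, r < `|embZ R i - embZ R j| -> p i j = 0;
    jump_sum1 : forall i, \sum_(j \in [set: Zd d]) p i j = 1;
    jump_sym : forall i j, p i j = p j i;
    jump_transl : forall i j, p i j = p 0 (j - i);
    jump_irred : forall i j, exists n, 0 < pstep p n i j }.

(* Transition function of the walk that jumps at the times of a rate 1 Poisson
   process: p_t(i,j) = sum_n e^{-t} t^n / n! p^n(i,j). *)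
Definition ptrans (R : realType) (d : nat) (p : Zd d -> Zd d -> R) (t : R)
    (i j : Zd d) : R :=
  limn (series (fun n : nat =>
    expR (- t) * t ^+ n / n`!%:R * pstep p n i j)).

(* Probability that the walk that is at [z] at time [t] visits z1 at time t1,
   then z2 at time t2, ..., where s = [:: (t1, z1); (t2, z2); ...]. *)
Fixpoint path_prob (R : realType) (d : nat) (p : Zd d -> Zd d -> R) (t : R)
    (z : Zd d) (s : seq (R * Zd d)) : R :=
  if s is (t', z') :: s' then ptrans p (t' - t) z z' * path_prob p t' z' s'
  else 1.

(* Rate 1 continuous-time random walk with jump kernel [p] started at [i],
   i.e. the Markov process with transition function [ptrans p]. *)
Definition walk_from (R : realType) (d : nat) (p : Zd d -> Zd d -> R)
    (dW : measure_display) (W : measurableType dW) (P : probability W R)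
    (i : Zd d) (X : R -> W -> Zd d) : Prop :=
  (forall (t : R) (z : Zd d), 0 <= t -> measurable (X t @^-1` [set z]))
  /\ forall s : seq (R * Zd d), path <=%R 0 (map fst s) ->
       P [set w | forall tz, tz \in s -> X tz.1 w = tz.2]
       = (path_prob p 0 i s)%:E.

(** * Configurations *)

Definition cylinders (d : nat) : set (set (Zd d -> nat)) :=
  [set A | exists x n, A = [set eta | eta x = n]].

(* The configuration space, with its product sigma-algebra. *)
Notation config d := (g_sigma_algebraType (@cylinders d)).

Definition shift (d : nat) (x : Zd d) (eta : config d) : config d :=
  fun y => eta (y + x).

Definition poisson_product (R : realType) (d : nat) (rho : R)
    (nu : probability (config d) R) : Prop :=
  forall (A : {fset Zd d}) (n : Zd d -> nat),
    nu [set eta : config d | forall x, x \in A -> eta x = n x]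
    = (\prod_(x <- A) poisson_pmf rho (n x))%:E.

(** * Independent random walkers *)

Definition mutually_independent (R : realType) (dW : measure_display)
    (W : measurableType dW) (P : probability W R) (I : choiceType)
    (F : I -> set (set W)) : Prop :=
  forall (J : {fset I}) (A : I -> set W), (forall i, i \in J -> F i (A i)) ->
    P (\bigcap_(i in [set` J]) A i) = (\prod_(i <- J) P (A i))%E.

(* Particles are labelled by pairs (x, m): the m-th particle initially at x. *)
Notation label d := (Zd d * nat)%type.

(* The sigma-algebra generated by the initial configuration ([None]), resp. by
   the trajectory of the walk with a given label. *)
Definition walkers_sigma (R : realType) (d : nat)
    (dW : measure_display) (W : measurableType dW)
    (eta0 : W -> config d) (X : label d -> R -> W -> Zd d)
    (o : option (label d)) : set (set W) :=
  match o with
  | None => preimage_set_system setT eta0 measurable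
  | Some l =>
      <<s [set A | exists t z, 0 <= t /\ A = X l t @^-1` [set z]] >>
  end.

(* The system of independent random walkers with initial distribution [nu],
   i.e. the process whose generator moves a particle from i to j at rate
   p(i,j) eta_i:
   eta t w x is the number of particles at x at time t when the particles
   present in eta 0 w move along independent rate 1 walks. As there are
   infinitely many particles, the counting identity (which includes finiteness
   of the number of particles at each site) holds almost surely. *)
Definition independent_walkers (R : realType) (d : nat)
    (p : Zd d -> Zd d -> R) (nu : probability (config d) R)
    (dW : measure_display) (W : measurableType dW) (P : probability W R)
    (eta : R -> W -> config d) : Prop :=
  (forall t, 0 <= t -> measurable_fun setT (eta t))
  /\ (forall A, measurable A -> P (eta 0 @^-1` A) = nu A)
  /\ exists X : label d -> R -> W -> Zd d,
      [/\ forall l : label d, walk_from p P l.1 (X l),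
          mutually_independent P (walkers_sigma (eta 0) X)
        & forall t, 0 <= t -> {ae P, forall w, forall x : Zd d,
            ([set l : label d | (l.2 < eta 0%R w l.1)%N /\ X l t w = x]
              #= `I_(eta t w x))%card}].

(** * Orthogonal self-duality polynomials *)

Notation fconfig d := {fsfun Zd d -> nat with 0%N}.

Definition mass (d : nat) (xi : fconfig d) : nat :=
  (\sum_(x <- finsupp xi) xi x)%N.

Definition charlier (R : realType) (rho : R) (k n : nat) : R :=
  \sum_(j < k.+1) 'C(k, j)%:R * (- rho) ^- j * (n ^_ j)%:R.

(* The product over all sites reduces to the support of [xi], since
   charlier rho 0 n = 1. *)
Definition dualD (R : realType) (d : nat) (rho : R) (xi : fconfig d)
    (eta : config d) : R :=
  \prod_(x <- finsupp xi) charlier rho (xi x) (eta x).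

Section L2.
Context (R : realType) (d : nat) (rho : R) (nu : probability (config d) R).
Implicit Types f g h : config d -> R.

Definition inL2 f : Prop := f \in Lfun nu 2%:E.

Definition inner f g : R := \int[nu]_eta (f eta * g eta).

Definition sqnormD (xi : fconfig d) : R :=
  inner (dualD rho xi) (dualD rho xi).

(* Coefficient of D(xi, .) in the orthogonal expansion of f. *)
Definition coefD f (xi : fconfig d) : R :=
  inner f (dualD rho xi) / sqnormD xi.

(* H_n: the L2-closure of the span of the D(xi, .) with ||xi|| <= n. *)
Definition inH (n : nat) h : Prop :=
  inL2 h /\ forall e : R, 0 < e ->
    exists (s : seq (fconfig d)) (c : fconfig d -> R),
      (forall xi, xi \in s -> (mass xi <= n)%N) /\
      ('N[nu]_(2%:E)[EFin \o (fun eta => (h eta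
          - \sum_(xi <- s) c xi * dualD rho xi eta)%R)] < e%:E)%E.

(* g is (a version of) the orthogonal projection of f on H_n. *)
Definition is_projH (n : nat) f g : Prop :=
  inH n g /\ forall h, inH n h -> inner (f \- g) h = 0.

Definition coef_summable f : Prop :=
  (\esum_(q in [set q : fconfig d * fconfig d | mass q.1 = mass q.2])
     (`|coefD f q.1 * coefD f q.2| * sqnormD q.2)%:E < +oo)%E.

End L2.

Definition field_X (R : realType) (d : nat) (N : nat) (g : config d -> R)
    (eta : config d) (phi : 'rV[R]_d -> R) : R :=
  rsum (fun x : Zd d => g (shift x eta) * phi (N%:R^-1 *: embZ R x)).

(* Main.v *)
Require Import Defs.
From HB Require Import structures.
From mathcomp Require Import all_boot all_order all_algebra.
From mathcomp Require Import finmap.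
From mathcomp Require Import all_classical all_reals all_analysis.
From mathcomp Require Import measurable_realfun.
From mathcomp Require Import ring lra zify.
Import Order.TTheory GRing.Theory Num.Theory.
Import numFieldNormedType.Exports.
Local Open Scope classical_set_scope.
Local Open Scope ring_scope.
Set Implicit Arguments.
Unset Strict Implicit.
Unset Printing Implicit Defensive.

(** Let g = f - f_{k-1}, let X_N(t) be the field of g at the microscopic time
    N^2 t, and put m = (k-1) d. Everything follows from one estimate
    [field_covariance_le], for s <= t:
      E[X_N(s) X_N(t)] <= K N^d (sup_{i,j} p_r(i,j))^{k-1},  r = N^2 (t - s).
    The supremum is at most 1, and at most C r^{-d/2} by the heat kernel bound
    [ptrans_heat]. Split the square of times [0,T]^2 at |t - s| = w. The band
    near the diagonal has area at most 2 w T and the rest contributes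
    O((N^2 w)^{-m/2}); with w = N^{-2m/(2+m)} both are of order w
    [window_balance], which is the announced rate.

    The covariance estimate. The projection removes from f exactly the terms
    D(xi, .) with ||xi|| <= k-1, so only xi with at least k particles are left.
    A finite configuration is represented by a list of points, and duality
    [walkers_dualL] reads: for lists X, X' of the same length,
      E[D(X, eta_s) D(X', eta_t)] = a(X') sum_Y prod_i p_{t-s}(X_i, Y_i),
    where Y runs over the distinct rearrangements of X'; for lists of
    different lengths the expectation is zero. Fix X and sum this over all
    translates X' + x. Bounding k-1 of the transition probabilities by their
    supremum H leaves a sum over the remaining points, which is at most 1
    except that the same remainder may come from several translates and
    rearrangements; their number is bounded by a constant depending on k only,
    whatever the number of particles [orbit_sum_le]. One particle is spent on
    the sum over translates, hence the power k-1. The other sum over space is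
    sum_x |phi(x/N)| = O(N^d) [schwartz_sum], and the sum over pairs of
    coefficients is finite by assumption.

    Duality comes from generating functions. The Poisson law and the
    independence of the walks give E[prod (1-U_a)^{eta_s(a)} prod
    (1-V_b)^{eta_t(b)}] explicitly [walkers_pgf]. Up to normalisation the
    Charlier polynomials in m are the Taylor coefficients in u of
    e^{rho u} (1-u)^m, so duality is a comparison of power series coefficients
    under the expectation, one site at a time [extract_coefs].

    The heat kernel bound is elementary. By irreducibility the jumps contain d
    linearly independent vectors; their numbers of occurrences are independent
    Poisson variables that are determined by the position once the other jumps
    are known, and a Poisson variable of mean l has atoms of size
    O(l^{-1/2}) [exp_coeff_le_sqrt].

    All of this is done with finite sums. The polynomials D are complete
    [dual_complete], so g is an L2 limit of finite combinations
    [combo_approx]; its field is an L2 limit of finite fields of such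
    combinations [smeared_field_approx], and the covariance bound passes to
    the limit [Rint_mul_limit]. *)

(** * Charlier polynomials as coefficients of a generating function *)

(** Only values on [0, 1] are given, so the usual argument is made quantitative:
    if the coefficients before n vanish, the n-th is at most u M for every u in
    ]0, 1]. *)
Lemma powser_coef_eq0 (R : realType) (c : nat -> R) (M : R) :
  (forall K, \sum_(0 <= k < K) `|c k| <= M) ->
  (forall u : R, 0 <= u <= 1 -> series (fun k => u ^+ k * c k) @ \oo --> (0 : R)) ->
  forall k, c k = 0.
Proof.
move=> cM c0; elim/ltn_ind => n IH.
have M0 : 0 <= M by apply: le_trans (cM 0%N); rewrite big_nil.
have key (u : R) : 0 < u <= 1 -> `|c n| <= u * M.
  case/andP=> u0 u1; have u0' := ltW u0; rewrite -(ler_pM2l (exprn_gt0 n u0)) mulrA -exprSr.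
  have := c0 u; rewrite u1 u0' => /(_ isT) /cvg_norm; rewrite normr0 => cv.
  rewrite -subr_le0; apply: (cvgr_to_ge cv).
  exists n.+1 => // K /= nK.
  rewrite seriesEnat /= (big_cat_nat (n := n)) //=; last exact: ltnW.
  rewrite big_nat_cond big1 ?add0r; last first.
    by move=> i; rewrite andbT => /andP[_ /IH ->]; rewrite mulr0.
  rewrite big_ltn // lerBlDr.
  have -> : u ^+ n * `|c n| = `|u ^+ n * c n| by rewrite normrM ger0_norm // exprn_ge0.
  set S := \sum_(_ <= _ < _) _.
  have SM : `|S| <= u ^+ n.+1 * M.
    apply: (le_trans (ler_norm_sum _ _ _)).
    apply: (@le_trans _ _ (u ^+ n.+1 * \sum_(0 <= k < K) `|c k|)); last first.
      apply: ler_wpM2l; last exact: cM.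
      by rewrite exprn_ge0.
    rewrite big_distrr /= [leRHS](big_cat_nat (n := n.+1)) //=.
    apply: ler_wpDl.
      by apply: sumr_ge0 => i _; rewrite mulr_ge0 // exprn_ge0.
    rewrite !big_nat; apply: ler_sum => i /andP[ni _].
    rewrite normrM ler_wpM2r // ger0_norm ?exprn_ge0 //.
    by apply: ler_wiXn2l => //; exact: ltW.
  have := ler_normB (u ^+ n * c n + S) S; rewrite addrK => h.
  by apply: (le_trans h); rewrite lerD2l.
apply/eqP; rewrite -normr_le0; apply/ler_addgt0Pr => e e0; rewrite add0r.
have M1 : 0 < M + 1 by rewrite ltr_wpDl.
pose u := Num.min 1 (e / (M + 1)).
have u0 : 0 < u <= 1 by rewrite /u lt_min ltr01 divr_gt0 //= ge_min lexx.
apply: (le_trans (key _ u0)).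
apply: (@le_trans _ _ (e / (M + 1) * (M + 1))); last by rewrite divfK ?gt_eqF.
apply: ler_pM => //; [by case/andP: u0 => /ltW| by rewrite /u ge_min lexx orbT|by rewrite lerDl].
Qed.

Lemma powser_coef_inj (R : realType) (c c' : nat -> R) (M : R) (F : R -> R) :
  (forall K, \sum_(0 <= k < K) `|c k| <= M) ->
  (forall K, \sum_(0 <= k < K) `|c' k| <= M) ->
  (forall u : R, 0 <= u <= 1 -> series (fun k => u ^+ k * c k) @ \oo --> F u) ->
  (forall u : R, 0 <= u <= 1 -> series (fun k => u ^+ k * c' k) @ \oo --> F u) ->
  forall k, c k = c' k.
Proof.
move=> cM cM' cF cF' k; apply/eqP; rewrite -subr_eq0; apply/eqP.
apply: (@powser_coef_eq0 _ (fun k => c k - c' k) (M + M)) => [K|u u01].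
  apply: le_trans (lerD (cM K) (cM' K)); rewrite -big_split /=.
  by apply: ler_sum => i _; exact: ler_normB.
have -> : (fun k => u ^+ k * (c k - c' k)) =
  (fun k => u ^+ k * c k) - (fun k => u ^+ k * c' k).
  by apply/funext => i; rewrite mulrBr.
rewrite -[0 in X in _ --> X](subrr (F u)) seriesD seriesN.
by apply: cvgB; [exact: cF|exact: cF'].
Qed.

(** Normalised so that the generating function in k is e^{rho u} (1-u)^m. *)
Definition charlier_coef (R : realType) (rho : R) (k m : nat) : R :=
  rho ^+ k / k`!%:R * charlier rho k m.

(** The k-th coefficient of the product of the series of e^{rho u} and (1-u)^m. *)
Lemma charlier_coefE (R : realType) (rho : R) k m : rho != 0 ->
  charlier_coef rho k m =
  \sum_(j < k.+1) rho ^+ (k - j) / (k - j)`!%:R * ((-1) ^+ j * 'C(m, j)%:R).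
Proof.
move=> r0; rewrite /charlier_coef /charlier big_distrr /=.
apply: eq_bigr => -[j /=]; rewrite ltnS => jk _.
rewrite -bin_ffact natrM -{1}(subnK jk) exprD.
have -> : (k`!%:R : R) = 'C(k, j)%:R * (j`!%:R * (k - j)`!%:R).
  by rewrite -!natrM bin_fact.
have <- : (-1) ^+ j / rho ^+ j = (- rho) ^- j by rewrite (exprNn rho) invfM invr_sign.
have C0 : ('C(k, j)%:R : R) != 0 by rewrite pnatr_eq0 -lt0n bin_gt0.
have j0 : (j`!%:R : R) != 0 by rewrite pnatr_eq0 -lt0n fact_gt0.
have kj0 : ((k - j)`!%:R : R) != 0 by rewrite pnatr_eq0 -lt0n fact_gt0.
have rj0 : rho ^+ j != 0 by rewrite expf_neq0.
by field; apply/and4P.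
Qed.

(** Multiplication of the generating function by 1-u. *)
Lemma charlier_coefS (R : realType) (rho : R) k m : rho != 0 ->
  charlier_coef rho k.+1 m.+1 = charlier_coef rho k.+1 m - charlier_coef rho k m.
Proof.
move=> r0; rewrite !charlier_coefE // big_ord_recl [in X in _ = X - _]big_ord_recl /=.
rewrite !bin0 -addrA -sumrB; congr (_ + _); apply: eq_bigr => i _.
by rewrite /bump /= add1n subSS binS natrD exprS; ring.
Qed.

(** Induction on m by the recurrence above; m = 0 is the exponential series. *)
Lemma charlier_coef_series (R : realType) (rho : R) (m : nat) : 0 < rho ->
  (forall K, \sum_(0 <= k < K) `|charlier_coef rho k m| <= expR rho * 2 ^+ m) /\
  (forall u : R, series (fun k => u ^+ k * charlier_coef rho k m) @ \oo
     --> expR (rho * u) * (1 - u) ^+ m).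
Proof.
move=> r0; have rn0 : rho != 0 by rewrite gt_eqF.
have c0 k : charlier_coef rho k 0 = rho ^+ k / k`!%:R.
  rewrite charlier_coefE // big_ord_recl big1 /=; first by rewrite !subn0 bin0; ring.
  by move=> i _; rewrite bin0n /=; ring.
have cm0 m' : charlier_coef rho 0 m' = 1.
  by rewrite charlier_coefE // big_ord1 /= bin0 fact0 expr0; field.
elim: m => [|m [IHb IHc]].
  split=> [K|u].
    rewrite expr0 mulr1.
    have -> : \sum_(0 <= k < K) `|charlier_coef rho k 0| = series (exp_coeff rho) K.
      rewrite seriesEnat /=; apply: eq_bigr => i _.
      by rewrite c0 /exp_coeff ger0_norm // divr_ge0 // exprn_ge0 // ltW.
    apply: (limr_ge (is_cvg_series_exp_coeff rho)).
    exists K => // n /= Kn; apply: nondecreasing_series => // i _ _.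
    by rewrite exp_coeff_ge0 // ltW.
  rewrite expr0 mulr1.
  have -> : (fun k => u ^+ k * charlier_coef rho k 0) = exp_coeff (rho * u).
    by apply/funext => k; rewrite c0 /exp_coeff /= exprMn; ring.
  exact: is_cvg_series_exp_coeff.
split=> [[|K]|u].
- by rewrite big_nil mulr_ge0 ?expR_ge0 ?exprn_ge0.
- rewrite big_nat_recl // cm0.
  have -> : expR rho * 2 ^+ m.+1 = expR rho * 2 ^+ m + expR rho * 2 ^+ m.
    by rewrite exprS; ring.
  apply: le_trans (lerD (IHb K.+1) (IHb K)).
  rewrite [in leRHS]big_nat_recl // cm0 -addrA lerD2l -big_split /=.
  by apply: ler_sum => i _; rewrite charlier_coefS // ler_normB.
have -> : expR (rho * u) * (1 - u) ^+ m.+1 =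
  expR (rho * u) * (1 - u) ^+ m - u * (expR (rho * u) * (1 - u) ^+ m).
  by rewrite exprS; ring.
rewrite -(cvg_shiftS (series _)) /=.
have -> : (fun n => series (fun k => u ^+ k * charlier_coef rho k m.+1) n.+1) =
  (fun n => series (fun k => u ^+ k * charlier_coef rho k m) n.+1 -
     u * series (fun k => u ^+ k * charlier_coef rho k m) n).
  apply/funext => n; rewrite !seriesEnat /= !big_nat_recl // !cm0 -addrA; congr (_ + _).
  rewrite big_distrr /= -sumrB; apply: eq_bigr => i _.
  by rewrite charlier_coefS // exprS; ring.
by apply: cvgB; [rewrite (cvg_shiftS (series _))|apply: cvgMr].
Qed.

(** The other family used for coefficient extraction: u^m generates the indicators
    of the points of nat. *)
Lemma indicator_series (R : realType) (m : nat) :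
  (forall K, \sum_(0 <= k < K) `|(k == m)%:R : R| <= 1) /\
  (forall u : R, series (fun k => u ^+ k * (k == m)%:R) @ \oo --> u ^+ m).
Proof.
have E K (u : R) : \sum_(0 <= k < K) (u ^+ k * (k == m)%:R) = if (m < K)%N then u ^+ m else 0.
  case: ifPn => mK.
    rewrite (bigD1_seq m) ?iota_uniq ?mem_index_iota //= eqxx mulr1 big1 ?addr0 //.
    by move=> i /negbTE ->; rewrite mulr0.
  rewrite big_nat big1 // => i /andP[_ iK].
  by have /negbTE -> : i != m; rewrite ?mulr0 //; apply: contraNneq mK => <-.
split=> [K|u].
  rewrite (eq_bigr (fun k => 1 ^+ k * (k == m)%:R)); last first.
    by move=> i _; rewrite expr1n mul1r ger0_norm.
  by rewrite E; case: ifP; rewrite ?expr1n.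
apply: cvg_near_cst; exists m.+1 => // n /= mn.
by rewrite seriesEnat /= E mn.
Qed.

(** * The largest term of the exponential series *)

Lemma ler_sum_subset (R : numDomainType) (I : eqType) (s t : seq I) (f : I -> R) :
  uniq s -> {subset s <= t} -> (forall i, 0 <= f i) ->
  \sum_(i <- s) f i <= \sum_(i <- t) f i.
Proof.
move=> + + f0; elim: s t => [|x s IH] t /=.
  by rewrite big_nil sumr_ge0.
case/andP=> xs us st; have xt : x \in t by apply: st; rewrite mem_head.
rewrite big_cons (perm_big _ (perm_to_rem xt)) big_cons lerD2l.
apply: IH => // y ys; have : y \in t by apply: st; rewrite inE ys orbT.
rewrite (perm_mem (perm_to_rem xt)) inE => /predU1P[yx|//].
by rewrite yx (negbTE xs) in ys.
Qed.

Lemma sum_exp_coeff_le (R : realType) (x : R) K : 0 <= x ->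
  \sum_(0 <= k < K) (x ^+ k / k`!%:R) <= expR x.
Proof.
move=> x0; have := is_cvg_series_exp_coeff x => /(limr_ge); apply.
exists K => // n /= Kn.
have -> : \sum_(0 <= k < K) (x ^+ k / k`!%:R) = series (exp_coeff x) K by rewrite seriesEnat.
by apply: nondecreasing_series => // i _ _; exact: exp_coeff_ge0.
Qed.

(** The terms near the n-th one satisfy a_{n+j} >= (1 - j^2/x) a_n (or the same on
    the other side of n), so about sqrt(x/2) of them are at least a_n / 2, while all
    terms together add up to e^x. *)
Lemma exp_coeff_le_sqrt (R : realType) (x : R) n : 0 < x ->
  x ^+ n / n`!%:R <= 4 * expR x / Num.sqrt x.
Proof.
move=> x0; have x0' := ltW x0.
pose a k : R := x ^+ k / k`!%:R.
have a0 k : 0 <= a k by rewrite divr_ge0 // exprn_ge0.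
have aS k : a k = a k.+1 * (k.+1)%:R / x.
  rewrite /a factS natrM exprS.
  have ? : (k`!%:R : R) != 0 by rewrite pnatr_eq0 -lt0n fact_gt0.
  have ? : (k.+1%:R : R) != 0 by [].
  have ? : x != 0 by rewrite gt_eqF.
  by field; apply/and3P.
have aS' k : a k.+1 = a k * x / (k.+1)%:R.
  have ? : (k.+1%:R : R) != 0 by [].
  have ? : x != 0 by rewrite gt_eqF.
  by rewrite [in RHS]aS; field; apply/andP.
(* j <= J ensures j^2 <= x / 2, hence 1 - j^2/x >= 1/2. *)
pose J := Num.truncn (Num.sqrt (x / 2)).
have sq0 : 0 <= Num.sqrt (x / 2) by exact: sqrtr_ge0.
have /andP[J1 J2] := truncn_itv sq0; rewrite -/J in J1 J2.
have JJ : J%:R ^+ 2 <= x / 2.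
  rewrite -[leRHS]sqr_sqrtr ?divr_ge0 //.
  by rewrite ler_pXn2r ?nnegrE.
have main (g : nat -> nat) : {in gtn J.+1 &, injective g} ->
    (forall j, (j <= J)%N -> a n * (1 - j%:R ^+ 2 / x) <= a (g j)) ->
    a n <= 4 * expR x / Num.sqrt x.
  move=> gi ga.
  have h : (J.+1)%:R * (a n * 2^-1) <= expR x.
    pose s := [seq g j | j <- iota 0 J.+1].
    have us : uniq s.
      rewrite map_inj_in_uniq ?iota_uniq // => i j.
      by rewrite !mem_iota !add0n => /= Hi Hj; apply: gi.
    pose K := (\max_(i <- s) i).+1.
    apply: le_trans (sum_exp_coeff_le K x0').
    apply: (@le_trans _ _ (\sum_(k <- s) a k)); last first.
      apply: ler_sum_subset => // k ks.
      by rewrite mem_index_iota /= ltnS; apply: leq_bigmax_seq.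
    rewrite big_map.
    have -> : J.+1%:R * (a n * 2^-1) = \sum_(j <- iota 0 J.+1) (a n * 2^-1).
      by rewrite big_const_seq count_predT size_iota iter_addr addr0 mulr_natl.
    rewrite big_seq [leRHS]big_seq; apply: ler_sum => j; rewrite mem_iota add0n ltnS => /= jJ.
    apply: le_trans (ga _ jJ); apply: ler_wpM2l => //.
    have : j%:R ^+ 2 <= x / 2.
      by apply: le_trans JJ; rewrite ler_pXn2r ?nnegrE // ler_nat.
    by rewrite lerBrDl -lerBrDr ler_pdivrMr //; lra.
  have sx0 : 0 < Num.sqrt x by rewrite sqrtr_gt0.
  rewrite ler_pdivlMr //.
  have s2 : Num.sqrt x <= 2 * Num.sqrt (x / 2).
    rewrite -(@ler_pXn2r _ 2) ?nnegrE ?mulr_ge0 ?sqrtr_ge0 //.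
    by rewrite exprMn !sqr_sqrtr ?divr_ge0 //; lra.
  have s3 : Num.sqrt x <= 2 * J.+1%:R by apply: (le_trans s2); rewrite ler_pM2l // ltW.
  have := ler_wpM2l (a0 n) s3; lra.
(* Below x the terms increase, so the neighbours above n are used, and
   otherwise those below n. *)
have [nx|xn] := leP n%:R x.
- apply: (main (addn n)); first by move=> i j _ _ /addnI.
  elim=> [|j IH] jJ; first by rewrite expr0n /= mul0r subr0 mulr1 addn0.
  rewrite addnS aS'.
  have xj0 : 0 < (n + j).+1%:R :> R by [].
  have := IH (ltnW jJ); set A := a (n + j)%N => IHj.
  have A0 : 0 <= A by exact: a0.
  have e1 : A * x / (x + j%:R + 1) <= A * x / (n + j).+1%:R.
    apply: ler_wpM2l; first by rewrite mulr_ge0.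
    rewrite lef_pV2 ?posrE //; last by rewrite -addrA ltr_wpDr ?addr_ge0.
    by rewrite -natr1 natrD lerD2r lerD2r.
  apply: le_trans e1.
  have y0 : 0 < x + j%:R + 1 by rewrite -addrA ltr_wpDr ?addr_ge0.
  apply: (@le_trans _ _ (a n * (1 - j%:R ^+ 2 / x) * x / (x + j%:R + 1))); last first.
    by rewrite -![_ * x / _]mulrA; apply: ler_wpM2r => //; rewrite divr_ge0 // ltW.
  rewrite -[X in _ <= X / _]mulrA -[leRHS]mulrA; apply: ler_wpM2l; first exact: a0.
  rewrite ler_pdivlMr // [leRHS]mulrBl mul1r divfK ?gt_eqF //.
  rewrite -natr1; set y : R := j%:R.
  have jy : 0 <= y by rewrite ler0n.
  have -> : (1 - (y + 1) ^+ 2 / x) * (x + y + 1) = x + y + 1 - (y + 1) ^+ 2 - (y + 1) ^+ 3 / x.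
    by field; rewrite gt_eqF.
  have : 0 <= (y + 1) ^+ 3 / x by rewrite divr_ge0 // exprn_ge0 // addr_ge0.
  by nra.
- have Jn : (J <= n)%N.
    have : (J * J <= n)%N.
      by rewrite -(ler_nat R) natrM -expr2; apply: (le_trans JJ); lra.
    by case: (J) => // J'; apply: leq_trans; rewrite leq_pmulr.
  apply: (main (subn n)).
    move=> i j Hi Hj; have {}Hi : (i < J.+1)%N := Hi; have {}Hj : (j < J.+1)%N := Hj.
    by move=> ?; lia.
  elim=> [|j IH] jJ; first by rewrite expr0n /= mul0r subr0 mulr1 subn0.
  have nj : (n - j = (n - j.+1).+1)%N by lia.
  rewrite (aS (n - j.+1)%N) -nj; have := IH (ltnW jJ); set A := a (n - j)%N => IHj.
  set y : R := j%:R.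
  have jy : 0 <= y by rewrite ler0n.
  have nxj : x - y <= (n - j)%N%:R by rewrite natrB ?lerD2r 1?ltW //; lia.
  have A0 : 0 <= A by exact: a0.
  have [yx|yx] := leP (1 - j.+1%:R ^+ 2 / x) 0.
    apply: (@le_trans _ _ 0); first by rewrite mulr_ge0_le0.
    by apply: mulr_ge0; rewrite ?invr_ge0 // mulr_ge0.
  have yx1 : (y + 1) ^+ 2 < x.
    by move: yx; rewrite subr_gt0 ltr_pdivrMr // mul1r -natr1.
  apply: (@le_trans _ _ (A * (x - y) / x)); last first.
    by rewrite ler_wpM2r ?invr_ge0 // ler_wpM2l.
  rewrite ler_pdivlMr //.
  apply: (@le_trans _ _ (a n * (1 - j%:R ^+ 2 / x) * (x - y))); last first.
    by rewrite ler_wpM2r //; nra.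
  rewrite -[leLHS]mulrA -[leRHS]mulrA; apply: ler_wpM2l; first exact: a0.
  rewrite -natr1 -/y.
  have -> : (1 - (y + 1) ^+ 2 / x) * x = x - (y + 1) ^+ 2 by field; rewrite gt_eqF.
  have -> : (1 - y ^+ 2 / x) * (x - y) = x - y - y ^+ 2 + y ^+ 3 / x by field; rewrite gt_eqF.
  have : 0 <= y ^+ 3 / x by rewrite divr_ge0 // exprn_ge0.
  by nra.
Qed.

(** * Walks with a finite list of jumps *)

(** Total weight of the n-step paths from 0 to z whose steps are taken from the
    weighted list E. *)
Fixpoint kstep (R : realType) (V : zmodType) (E : seq (R * V)) (n : nat) (z : V) : R :=
  if n is m.+1 then \sum_(e <- E) e.1 * kstep E m (z - e.2) else (z == 0)%:R.

Section kstep.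
Context (R : realType) (V : zmodType).
Implicit Types (E : seq (R * V)) (z : V).

Lemma kstep_ge0 E n z : {in E, forall e, 0 <= e.1} -> 0 <= kstep E n z.
Proof.
move=> E0; elim: n z => [|n IH] z /=; first by case: eqP.
by rewrite big_seq sumr_ge0 // => e /E0 e0; rewrite mulr_ge0.
Qed.

Lemma kstep_perm E E' n z : perm_eq E E' -> kstep E n z = kstep E' n z.
Proof.
move=> EE'; elim: n z => [|n IH] z //=.
by rewrite (perm_big _ EE'); apply: eq_bigr => e _; rewrite IH.
Qed.

(** The walk has finite support after n steps, so finite sums over large enough
    sets see its whole mass. *)
Lemma kstep_support E n : exists F0 : seq V, forall F, uniq F -> {subset F0 <= F} ->
  \sum_(z <- F) kstep E n z = (\sum_(e <- E) e.1) ^+ n.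
Proof.
elim: n => [|n [F0 IH]] /=.
  exists [:: 0] => F uF /(_ 0 (mem_head _ _)) F0.
  by rewrite (bigD1_seq 0) //= eqxx big1 ?addr0 // => i /negbTE ->.
exists [seq z + e.2 | e <- E, z <- F0] => F uF sF.
rewrite exchange_big /= exprS big_distrl /=.
apply: eq_big_seq => e eE.
rewrite -big_distrr /=; congr (_ * _).
rewrite -(big_map (fun z => z - e.2) xpredT (kstep E n)); apply: IH.
  by rewrite map_inj_uniq // => x y /addIr.
move=> z zF0; apply/mapP; exists (z + e.2); last by rewrite addrK.
by apply: sF; apply/allpairsP; exists (e, z).
Qed.

Lemma kstep_sum_le E n F : {in E, forall e, 0 <= e.1} -> uniq F ->
  \sum_(z <- F) kstep E n z <= (\sum_(e <- E) e.1) ^+ n.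
Proof.
move=> E0 uF; have [F0 h] := kstep_support E n.
rewrite -(h (undup (F ++ F0))) ?undup_uniq //.
  apply: ler_sum_subset => // [z zF|z]; last exact: kstep_ge0.
  by rewrite mem_undup mem_cat zF.
by move=> z zF; rewrite mem_undup mem_cat zF orbT.
Qed.

(** Classifies the paths by the number m of uses of the first jump. *)
Lemma kstep_cons q e E n z : kstep ((q, e) :: E) n z =
  \sum_(m < n.+1) 'C(n, m)%:R * q ^+ m * kstep E (n - m) (z - e *+ m).
Proof.
elim: n z => [|n IH] z; first by rewrite big_ord1 /= bin0 mulr0n subr0; ring.
rewrite [LHS]/= big_cons IH.
rewrite [X in _ + X](eq_bigr (fun e' => \sum_(m < n.+1) 'C(n, m)%:R * q ^+ m *
   (e'.1 * kstep E (n - m) (z - e *+ m - e'.2)))); last first.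
  move=> e' _; rewrite IH big_distrr /=; apply: eq_bigr => m _.
  by rewrite addrAC; ring.
rewrite [X in _ + X]exchange_big /=.
rewrite [X in _ + X](eq_bigr (fun m : 'I_n.+1 => 'C(n, m)%:R * q ^+ m * kstep E (n.+1 - m) (z - e *+ m))); last first.
  by move=> m _; rewrite subSn ?leq_ord //= big_distrr.
rewrite big_distrr /=.
rewrite [X in _ + X](_ : _ = \sum_(m < n.+2) 'C(n, m)%:R * q ^+ m * kstep E (n.+1 - m) (z - e *+ m)); last first.
  by rewrite [RHS]big_ord_recr /= (bin_small (ltnSn n)) !mul0r addr0.
rewrite [X in _ + X]big_ord_recl [RHS]big_ord_recl /= !bin0 addrCA; congr (_ + _).
rewrite -big_split /=; apply: eq_bigr => m _.
rewrite /bump /= add1n subSS binS natrD exprS mulrS opprD addrA.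
by ring.
Qed.

Lemma sum_triangle (g : nat -> nat -> R) K :
  \sum_(n < K) \sum_(m < n.+1) g m (n - m)%N = \sum_(m < K) \sum_(l < K - m) g m l.
Proof.
elim: K => [|K IH]; first by rewrite !big_ord0.
rewrite [LHS]big_ord_recr IH /= [RHS](eq_bigr (fun m : 'I_K.+1 =>
   \sum_(l < K - m) g m l + g m (K - m)%N)); last first.
  by move=> m _; rewrite subSn ?leq_ord // big_ord_recr.
rewrite big_split /=; congr (_ + _).
by rewrite [RHS]big_ord_recr /= subnn big_ord0 addr0.
Qed.

(** Truncation of the exponential series, so that all sums stay finite. *)
Definition kexp E (t : R) (K : nat) z : R :=
  \sum_(n < K) t ^+ n / n`!%:R * kstep E n z.

Lemma kexp_ge0 E t K z : {in E, forall e, 0 <= e.1} -> 0 <= t -> 0 <= kexp E t K z.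
Proof.
move=> E0 t0; apply: sumr_ge0 => n _; apply: mulr_ge0; last exact: kstep_ge0.
by rewrite divr_ge0 // exprn_ge0.
Qed.

(** The truncation n < K is relaxed to m < K, n - m < K; the new terms are
    nonnegative. *)
Lemma kexp_cons q e E t K z : 0 <= q -> {in E, forall e, 0 <= e.1} -> 0 <= t ->
  kexp ((q, e) :: E) t K z <=
  \sum_(m < K) (t * q) ^+ m / m`!%:R * kexp E t K (z - e *+ m).
Proof.
move=> q0 E0 t0.
pose g m l := (t * q) ^+ m / m`!%:R * (t ^+ l / l`!%:R * kstep E l (z - e *+ m)).
have g0 m l : 0 <= g m l.
  by rewrite /g !mulr_ge0 ?invr_ge0 ?exprn_ge0 ?kstep_ge0 ?mulr_ge0.
rewrite /kexp (eq_bigr (fun n : 'I_K => \sum_(m < n.+1) g m (n - m)%N)); last first.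
  move=> n _; rewrite kstep_cons big_distrr /=; apply: eq_bigr => -[m /=]; rewrite ltnS => mn _.
  rewrite /g -{1}(subnK mn) exprD exprMn.
  have -> : (n`!%:R : R) = 'C(n, m)%:R * (m`!%:R * (n - m)`!%:R).
    by rewrite -!natrM bin_fact.
  have C0 : ('C(n, m)%:R : R) != 0 by rewrite pnatr_eq0 -lt0n bin_gt0.
  have m0 : (m`!%:R : R) != 0 by rewrite pnatr_eq0 -lt0n fact_gt0.
  have nm0 : ((n - m)`!%:R : R) != 0 by rewrite pnatr_eq0 -lt0n fact_gt0.
  by field; apply/and3P.
rewrite sum_triangle; apply: ler_sum => m _; rewrite big_distrr /=.
rewrite -(big_mkord xpredT (g m)) -(big_mkord xpredT (g m)).
by rewrite [leRHS](big_cat_nat (n := (K - m)%N)) ?leq_subr //= lerDl sumr_ge0.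
Qed.

Lemma kexp_sum_le E t K F : {in E, forall e, 0 <= e.1} -> 0 <= t -> uniq F ->
  \sum_(z <- F) kexp E t K z <= expR (t * \sum_(e <- E) e.1).
Proof.
move=> E0 t0 uF; rewrite exchange_big /=.
have s0 : 0 <= \sum_(e <- E) e.1 by rewrite big_seq sumr_ge0.
apply: le_trans (sum_exp_coeff_le K (mulr_ge0 t0 s0)).
rewrite big_mkord; apply: ler_sum => n _; rewrite -big_distrr /= exprMn [leRHS]mulrAC.
by apply: ler_wpM2l; rewrite ?kstep_sum_le // divr_ge0 // exprn_ge0.
Qed.

(** The points sum_i m_i e_i with all m_i < K, listed with repetitions. *)
Fixpoint lattice_pts (Es : seq (R * V)) (K : nat) : seq V :=
  if Es is e :: Es' then [seq e.2 *+ m + y | m <- iota 0 K, y <- lattice_pts Es' K]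
  else [:: 0].

(** Each jump of Es is peeled off by [kexp_cons], and the weight of the number of
    its uses is bounded by the largest term of the exponential series. *)
Lemma kexp_cat_le Es E t K z : {in Es, forall e, 0 < e.1} -> {in E, forall e, 0 <= e.1} ->
  0 < t -> kexp (Es ++ E) t K z <=
  \prod_(e <- Es) (4 * expR (t * e.1) / Num.sqrt (t * e.1)) *
    \sum_(y <- lattice_pts Es K) kexp E t K (z - y).
Proof.
move=> Es0 E0 t0; elim: Es Es0 z => [|[q e] Es IH] Es0 z /=.
  by rewrite big_nil big_seq1 subr0 mul1r.
have q0 : 0 < q by apply: (Es0 (q, e)); rewrite mem_head.
have Es0' : {in Es, forall e, 0 < e.1} by move=> x xE; apply: Es0; rewrite inE xE orbT.
have EE0 : {in Es ++ E, forall e, 0 <= e.1}.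
  by move=> x; rewrite mem_cat => /orP[/Es0'/ltW|/E0].
apply: (le_trans (kexp_cons e K z (ltW q0) EE0 (ltW t0))).
set P := \prod_(_ <- Es) _ in IH *.
have P0 : 0 <= P.
  by apply: prodr_ge0 => x _; rewrite !mulr_ge0 ?expR_ge0 ?invr_ge0 ?sqrtr_ge0.
rewrite big_cons -/P big_allpairs_dep /= -mulrA big_distrr big_distrr /=.
rewrite -[X in iota 0 X]subn0 -/(index_iota 0 K) big_mkord.
apply: ler_sum => m _.
apply: ler_pM; rewrite ?exp_coeff_le_sqrt ?mulr_gt0 //.
- by rewrite divr_ge0 // exprn_ge0 // mulr_ge0 // ltW.
- by apply: kexp_ge0 => //; exact: ltW.
- apply: (le_trans (IH Es0' _)); apply: ler_wpM2l => //.
  by apply: ler_sum => y _; rewrite opprD addrA.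
Qed.

(** Linear independence with natural coefficients: exactly what makes the lattice
    points distinct. *)
Definition nat_free (Es : seq (R * V)) := forall ms ms' : seq nat,
  size ms = size Es -> size ms' = size Es ->
  \sum_(x <- zip Es ms) x.1.2 *+ x.2 = \sum_(x <- zip Es ms') x.1.2 *+ x.2 -> ms = ms'.

Lemma lattice_ptsP Es K y : y \in lattice_pts Es K ->
  exists2 ms, size ms = size Es & y = \sum_(x <- zip Es ms) x.1.2 *+ x.2.
Proof.
elim: Es y => [|e Es IH] y /=; first by rewrite inE => /eqP ->; exists [::]; rewrite ?big_nil.
case/allpairsP => -[m y'] /= [_ /IH [ms sms ->] ->].
by exists (m :: ms) => /=; rewrite ?sms ?big_cons.
Qed.

Lemma lattice_pts_uniq Es K : nat_free Es -> uniq (lattice_pts Es K).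
Proof.
elim: Es => [|e Es IH] //= fE.
have fEs : nat_free Es.
  move=> ms ms' s s' h.
  suff : 0%N :: ms = 0%N :: ms' by case.
  by apply: fE; rewrite /= ?s ?s' // !big_cons h.
apply: allpairs_uniq; rewrite ?iota_uniq ?IH //.
move=> [m y] [m' y'] /allpairsP[[a b] /= [_ /lattice_ptsP[ms sms E1] [-> ->]]].
case/allpairsP=> [[a' b'] /= [_ /lattice_ptsP[ms' sms' E2] [-> ->]]].
rewrite E1 E2 /= => h.
have [-> -> //] : a :: ms = a' :: ms'.
by apply: fE; rewrite /= ?sms ?sms' // !big_cons.
Qed.

(** When the jumps of Es are free, the lattice points are distinct and the sum in
    [kexp_cat_le] is a sum of the remaining walk over distinct points, hence at
    most its total mass. *)
Lemma kexp_free_le Es E t K z : {in Es, forall e, 0 < e.1} -> {in E, forall e, 0 <= e.1} ->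
  nat_free Es -> 0 < t ->
  kexp (Es ++ E) t K z <= expR (t * \sum_(e <- Es ++ E) e.1) *
    \prod_(e <- Es) (4 / Num.sqrt (t * e.1)).
Proof.
move=> Es0 E0 fE t0; apply: (le_trans (kexp_cat_le K z Es0 E0 t0)).
have -> : \prod_(e <- Es) (4 * expR (t * e.1) / Num.sqrt (t * e.1)) =
  expR (t * \sum_(e <- Es) e.1) * \prod_(e <- Es) (4 / Num.sqrt (t * e.1)).
  rewrite big_distrr expR_sum -big_split /=.
  by apply: eq_bigr => e _; rewrite mulrCA mulrA.
rewrite big_cat /= mulrDr expRD [leRHS]mulrAC; apply: ler_wpM2l.
  rewrite mulr_ge0 ?expR_ge0 //; apply: prodr_ge0 => e _.
  by rewrite mulr_ge0 ?invr_ge0 ?sqrtr_ge0.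
rewrite -(big_map (fun y => z - y) xpredT (kexp E t K)); apply: kexp_sum_le => //.
  exact: ltW.
by rewrite map_inj_uniq ?lattice_pts_uniq // => a b /addrI/oppr_inj.
Qed.

End kstep.

(** * The transition function and its heat kernel bound *)

Definition box (d M : nat) : seq (Zd d) :=
  [seq \row_i ((f i)%:Z - M%:Z) | f : {ffun 'I_d -> 'I_(M.*2.+1)}].

Lemma box_uniq d M : uniq (box d M).
Proof.
rewrite map_inj_uniq ?enum_uniq // => f g /rowP fg; apply/ffunP => i.
by have := fg i; rewrite !mxE => /addIr [] /val_inj.
Qed.

Lemma mem_box d M (x : Zd d) : (forall i, `|x 0 i| <= M%:Z) -> x \in box d M.
Proof.
move=> xM; apply/mapP; pose f := [ffun i : 'I_d => inord (absz (x 0 i + M%:Z)) : 'I_(M.*2.+1)].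
exists f; first by rewrite mem_enum.
apply/rowP => i; rewrite !mxE !ffunE inordK; have := xM i.
  by move: (x 0 i) => y; lia.
by move: (x 0 i) => y; lia.
Qed.

Lemma norm_embZ_coord (R : realType) d (x : Zd d) i : `|x 0 i|%:~R <= `|embZ R x|.
Proof.
have -> : `|embZ R x| = mx_norm (embZ R x) by [].
rewrite mx_normrE.
have -> : `|x 0 i|%:~R = `|embZ R x 0 i| by rewrite mxE -intr_norm.
exact: (le_bigmax _ (fun ij => `|embZ R x ij.1 ij.2|) (0, i)).
Qed.

Lemma mem_box_norm (R : realType) d M (x : Zd d) : `|embZ R x| <= M%:R -> x \in box d M.
Proof.
move=> xM; apply: mem_box => i; rewrite -(ler_int R).
exact: (le_trans (norm_embZ_coord _ _ _)).
Qed.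

Lemma embZB (R : realType) d (x y : Zd d) : embZ R (x - y) = embZ R x - embZ R y.
Proof. by rewrite /embZ map_mxB. Qed.

Lemma cvg_sumr (R : realType) (I : Type) (r : seq I) (f : I -> nat -> R) (l : I -> R) :
  (forall i, f i n @[n --> \oo] --> l i) ->
  \sum_(i <- r) f i n @[n --> \oo] --> \sum_(i <- r) l i.
Proof.
move=> h; elim: r => [|i r IH].
  rewrite big_nil; under eq_cvg do rewrite big_nil; exact: cvg_cst.
by rewrite big_cons; under eq_cvg do rewrite big_cons; exact: cvgD.
Qed.

Section jumps.
Context (R : realType) (d : nat) (p : Zd d -> Zd d -> R) (hp : jump_kernel p).

(** Finite range and translation invariance reduce the kernel to a finite list of
    jumps; the sums over Zd become sums over that list. *)
Lemma jump_list : exists E : seq (R * Zd d),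
  [/\ {in E, forall e, 0 < e.1}, \sum_(e <- E) e.1 = 1
    & forall n i j, pstep p n i j = kstep E n (j - i)].
Proof.
case: hp => p0 [r r0 pr] p1 _ pt _.
pose M := (Num.truncn r).+1.
have rM : r <= M%:R by apply: ltW; have /andP[] := truncn_itv (ltW r0).
have supp i j : j - i \notin box d M -> p i j = 0.
  move=> jM; apply: pr; rewrite ltNge; apply: contra jM => ij.
  by apply: (@mem_box_norm R); apply: le_trans rM; rewrite embZB distrC.
pose E := [seq (p 0 e, e) | e <- box d M & p 0 e != 0].
have sumE i (F : Zd d -> R) : \sum_(l \in [set: Zd d]) p i l * F l =
    \sum_(e <- E) e.1 * F (i + e.2).
  rewrite big_map big_filter /=.
  rewrite (fsbigE [seq i + e | e <- box d M]) //.
  - rewrite (eq_bigl xpredT); last by move=> l; rewrite in_setT.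
    rewrite big_map [RHS]big_mkcond; apply: eq_bigr => e _.
    by rewrite pt addrAC subrr add0r; case: eqP => // ->; rewrite mul0r.
  - by rewrite map_inj_uniq ?box_uniq // => x y /addrI.
  - move=> l _ lE; rewrite supp ?mul0r //; apply: contra lE => lE.
    by apply/mapP; exists (l - i); rewrite // addrC subrK.
exists E; split.
- by move=> e /mapP[x]; rewrite mem_filter => /andP[px _] -> /=; rewrite lt0r px p0.
- have := sumE 0 (fun=> 1); rewrite (eq_fsbigr (p 0)); last by move=> l _; rewrite mulr1.
  by rewrite p1 => ->; apply: eq_bigr => e _; rewrite mulr1.
- elim=> [|n IH] i j /=; first by rewrite subr_eq0 eq_sym.
  rewrite (eq_fsbigr (fun l => p i l * kstep E n (j - l))); last by move=> l _; rewrite IH.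
  by rewrite sumE; apply: eq_bigr => e _; rewrite opprD addrA.
Qed.

(** By irreducibility every unit vector is a sum of jumps, so the matrix of the
    jumps has full rank and d of its rows form a basis. *)
Lemma jump_list_free (E : seq (R * Zd d)) : {in E, forall e, 0 < e.1} ->
  (forall n i j, pstep p n i j = kstep E n (j - i)) ->
  exists Es Er, [/\ perm_eq E (Es ++ Er), size Es = d & nat_free Es].
Proof.
move=> E0 hE.
pose m := size E.
(* The rows of M are the jumps; reachable points lie in their row space. *)
pose M := \matrix_(i < m) embZ R (nth (0, 0) E i).2.
have kM n z : kstep E n z != 0 -> (embZ R z <= M)%MS.
  elim: n z => [|n IH] z /=.
    by rewrite pnatr_eq0 eqb0 negbK => /eqP ->; rewrite /embZ map_mx0 sub0mx.
  move=> kz; have /hasP[e eE ke] : has (fun e => e.1 * kstep E n (z - e.2) != 0) E.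
    apply: contraR kz => /hasPn h; apply/eqP; rewrite big_seq big1 // => e /h.
    by rewrite negbK => /eqP.
  have {ke} /IH : kstep E n (z - e.2) != 0 by apply: contraNneq ke => ->; rewrite mulr0.
  rewrite embZB => h.
  have -> : embZ R z = (embZ R z - embZ R e.2) + embZ R e.2 by rewrite subrK.
  apply: addmx_sub => //.
  have iE : (index e E < m)%N by rewrite index_mem.
  have -> : embZ R e.2 = row (Ordinal iE) M by rewrite rowK nth_index.
  exact: row_sub.
have fM : row_full M.
  rewrite -sub1mx; apply/row_subP => i; rewrite row1.
  have [n pn] := jump_irred hp 0 (delta_mx 0 i : Zd d).
  have -> : delta_mx 0 i = embZ R (delta_mx 0 i : Zd d).
    by apply/rowP => j; rewrite !mxE !eqxx /=; case: eqP.
  by apply: (kM n); rewrite -[delta_mx _ _]subr0 -hE gt_eqF.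
pose f := fullrankfun fM.
have fi : injective f by exact: fullrankfun_inj.
pose e (i : 'I_m) : R * Zd d := nth (0, 0) E i.
pose Es := [seq e (f i) | i <- enum 'I_d].
pose Er := [seq e i | i <- enum 'I_m & i \notin codom f].
have sEs : size Es = d by rewrite size_map size_enum_ord.
exists Es, Er; split => //.
- have -> : E = [seq e i | i <- enum 'I_m].
    apply: (@eq_from_nth _ (0, 0)) => [|i im]; first by rewrite size_map size_enum_ord.
    by rewrite (nth_map (Ordinal im)) ?size_enum_ord // /e nth_enum_ord.
  have -> : Es = [seq e i | i <- codom f] by rewrite -map_comp.
  rewrite -map_cat; apply: perm_map; apply: uniq_perm.
  + exact: enum_uniq.
  + rewrite cat_uniq filter_uniq ?enum_uniq // andbT.
    rewrite map_inj_uniq ?enum_uniq //=; apply/hasPn => i.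
    by rewrite mem_filter => /andP[].
  + by move=> i; rewrite mem_cat mem_filter !mem_enum andbT orbN.
- move=> ms ms' s s'; rewrite sEs in s s'.
  have sE (ns : seq nat) : size ns = d ->
      embZ R (\sum_(x <- zip Es ns) x.1.2 *+ x.2) =
      (\row_(i < d) (nth 0%N ns i)%:R) *m rowsub f M.
    move=> sn; have -> : \sum_(x <- zip Es ns) x.1.2 *+ x.2 =
       \sum_(i < d) (e (f i)).2 *+ nth 0%N ns i.
      have sz : size (zip Es ns) = d by rewrite size_zip sEs sn minnn.
      rewrite (big_nth ((0, 0), 0%N)) big_mkord sz; apply: eq_bigr => i _.
      rewrite nth_zip ?sEs //= /Es (nth_map i) ?size_enum_ord //.
      by rewrite nth_ord_enum.
    rewrite mulmx_sum_row /embZ raddf_sum; apply: eq_bigr => i _.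
    by rewrite !mxE row_rowsub rowK raddfMn scaler_nat.
  have uf : rowsub f M \in unitmx by exact: fullrowsub_unit.
  move=> /(congr1 (@embZ R d)); rewrite !sE // => /(can_inj (mulmxK uf)) /rowP h.
  apply: (@eq_from_nth _ 0%N); rewrite ?s ?s' // => i id.
  by have := h (Ordinal id); rewrite !mxE /= => /eqP; rewrite eqr_nat => /eqP.
Qed.

(** The form in which the transition function is used from here on: the least
    upper bound of the truncated series, plus d free jumps. *)
Lemma ptrans_limit : exists E : seq (R * Zd d),
  [/\ {in E, forall e, 0 < e.1}, \sum_(e <- E) e.1 = 1,
     (exists Es Er, [/\ perm_eq E (Es ++ Er), size Es = d & nat_free Es])
    & forall (t : R) i j, 0 <= t ->
      (forall K, expR (- t) * kexp E t K (j - i) <= ptrans p t i j) /\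
      (forall B, (forall K, expR (- t) * kexp E t K (j - i) <= B) -> ptrans p t i j <= B)].
Proof.
have [E [E0 E1 hE]] := jump_list.
exists E; split=> //; first exact: jump_list_free.
move=> t i j t0.
have E0' : {in E, forall e, 0 <= e.1} by move=> e /E0/ltW.
pose u := fun n => expR (- t) * t ^+ n / n`!%:R * pstep p n i j.
have uE K : series u K = expR (- t) * kexp E t K (j - i).
  rewrite seriesEord /= big_distrr /=; apply: eq_bigr => n _.
  by rewrite /u hE !mulrA.
have ui : {homo series u : m n / (m <= n)%N >-> m <= n}.
  apply: nondecreasing_series => n _ _.
  by rewrite /u hE mulr_ge0 ?kstep_ge0 // !mulr_ge0 ?expR_ge0 ?exprn_ge0 ?invr_ge0.
have cu : cvgn (series u).
  apply: nondecreasing_is_cvgn => //; exists 1 => _ [K _ <-]; rewrite uE.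
  have := @kexp_sum_le _ _ E t K [:: j - i] E0' t0 isT.
  rewrite big_seq1 E1 mulr1 => h.
  by rewrite -(expRxMexpNx_1 t) mulrC ler_wpM2r ?expR_ge0.
split=> [K|B hB].
  by rewrite -uE; apply: nondecreasing_cvgn_le.
by apply: limr_le => //; apply: nearW => K; rewrite uE.
Qed.

Lemma ptrans_ge0 (t : R) i j : 0 <= t -> 0 <= ptrans p t i j.
Proof.
move=> t0; have [E [_ _ _ /(_ t i j t0)[h _]]] := ptrans_limit.
by apply: le_trans (h 0%N); rewrite /kexp big_ord0 mulr0.
Qed.

Lemma ptrans0 i j : ptrans p 0 i j = (i == j)%:R.
Proof.
have [E [_ _ _ /(_ 0 i j (lexx _))[h1 h2]]] := ptrans_limit.
have kE K : expR (- 0) * kexp E 0 K.+1 (j - i) = (i == j)%:R.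
  rewrite oppr0 expR0 mul1r /kexp big_ord_recl big1 => [|n _]; last by rewrite expr0n /= !mul0r.
  by rewrite /= expr0 fact0 divr1 mul1r addr0 subr_eq0 eq_sym.
apply/eqP; rewrite eq_le -{2}(kE 0%N) h1 andbT; apply: h2 => -[|K]; rewrite ?kE //.
by rewrite /kexp big_ord0 mulr0.
Qed.

(** Covers the sums over the end point and over the starting point at once. *)
Lemma ptrans_sum_le_gen (t : R) (I : eqType) (F : seq I) (g h : I -> Zd d) : 0 <= t ->
  uniq F -> {in F &, injective (fun x => h x - g x)} ->
  \sum_(x <- F) ptrans p t (g x) (h x) <= 1.
Proof.
move=> t0 uF gh; have [E [E0 E1 _ hE]] := ptrans_limit.
have E0' : {in E, forall e, 0 <= e.1} by move=> e /E0/ltW.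
have mono i j K K' : (K <= K')%N -> expR (- t) * kexp E t K (j - i) <= expR (- t) * kexp E t K' (j - i).
  move=> KK; apply: ler_wpM2l; first exact: expR_ge0.
  rewrite /kexp -!(big_mkord xpredT (fun n => t ^+ n / n`!%:R * kstep E n (j - i))).
  rewrite [leRHS](big_cat_nat (n := K)) //= lerDl; apply: sumr_ge0 => n _.
  by rewrite mulr_ge0 ?kstep_ge0 // divr_ge0 // exprn_ge0.
have cv i j : expR (- t) * kexp E t K (j - i) @[K --> \oo] --> ptrans p t i j.
  have [h1 h2] := hE t i j t0.
  have c : cvgn (fun K => expR (- t) * kexp E t K (j - i)).
    apply: nondecreasing_is_cvgn; first by move=> K K'; exact: mono.
    by exists (ptrans p t i j) => _ [K _ <-].
  suff -> : ptrans p t i j = limn (fun K => expR (- t) * kexp E t K (j - i)) by [].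
  apply/eqP; rewrite eq_le; apply/andP; split.
    by apply: h2 => K; apply: nondecreasing_cvgn_le => // m n; exact: mono.
  by apply: limr_le => //; apply: nearW => K.
have /cvgr_to_le := @cvg_sumr _ _ F _ _ (fun x => cv (g x) (h x)); apply.
apply: nearW => K; rewrite -big_distrr /=.
rewrite -(big_map (fun x => h x - g x) xpredT (kexp E t K)).
rewrite -(expRxMexpNx_1 t) mulrC; apply: ler_wpM2r; first exact: expR_ge0.
rewrite -[t in leRHS]mulr1 -E1; apply: kexp_sum_le => //.
by rewrite map_inj_in_uniq.
Qed.

Lemma ptrans_sum_le (t : R) i F : 0 <= t -> uniq F -> \sum_(z <- F) ptrans p t i z <= 1.
Proof.
by move=> t0 uF; apply: (ptrans_sum_le_gen (g := fun=> i) (h := id)) => // x y _ _ /addIr.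
Qed.

Lemma ptrans_sum_lel (t : R) j F : 0 <= t -> uniq F -> \sum_(z <- F) ptrans p t z j <= 1.
Proof.
move=> t0 uF; apply: (ptrans_sum_le_gen (g := id) (h := fun=> j)) => // x y _ _.
by move=> /addrI/oppr_inj.
Qed.

(** Needed to sum over all starting points: the mass that arrives at j comes up to
    e from finitely many of them. *)
Lemma ptrans_suml_tight (t : R) j (e : R) : 0 <= t -> 0 < e ->
  exists F0 : seq (Zd d), forall F, uniq F ->
  {subset F0 <= F} -> 1 - e <= \sum_(z <- F) ptrans p t z j.
Proof.
move=> t0 e0; have [E [E0 E1 _ hE]] := ptrans_limit.
have E0' : {in E, forall e, 0 <= e.1} by move=> x /E0/ltW.
have cv : expR (- t) * series (exp_coeff t) K @[K --> \oo] --> expR (- t) * expR t.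
  by apply: cvgMr; exact: is_cvg_series_exp_coeff.
rewrite -expRD addNr expR0 in cv.
have [|K _ /(_ K (leqnn _)) hK] := cvgr_ge _ cv (1 - e); first by rewrite ltrBlDr ltrDl.
have [F0 hF0] : exists F0 : seq (Zd d), forall F, uniq F -> {subset F0 <= F} ->
    \sum_(z <- F) kexp E t K (j - z) = series (exp_coeff t) K.
  have /choice[G hG] := fun n => kstep_support E n.
  exists (flatten [seq [seq j - z | z <- G n] | n <- iota 0 K]) => F uF sF.
  rewrite exchange_big seriesEord /=; apply: eq_bigr => n _.
  rewrite -big_distrr -(big_map (fun z => j - z) xpredT (kstep E n)) /=.
  rewrite hG ?E1 ?expr1n ?mulr1 //.
    by rewrite map_inj_uniq // => x y /addrI/oppr_inj.
  move=> z zG; apply/mapP; exists (j - z); last by rewrite opprB addrC subrK.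
  apply: sF; apply/flattenP; exists [seq j - z | z <- G n]; last exact: map_f.
  by apply/mapP; exists (n : nat); rewrite // mem_iota add0n /=.
exists F0 => F uF sF; apply: (le_trans hK).
rewrite -(hF0 F) // big_distrr /=; apply: ler_sum => z _.
by have [h _] := hE t z j t0; exact: h.
Qed.

(** The factor e^{-t} cancels the total mass of the exponential series, and each of
    the d free jumps contributes t^{-1/2}. *)
Lemma ptrans_heat : exists2 C : R, 0 <= C & forall (t : R) i j, 0 < t ->
  ptrans p t i j <= C * (Num.sqrt t)^-1 ^+ d.
Proof.
have [E [E0 E1 [Es [Er [pE sEs fE]]] hE]] := ptrans_limit.
exists (\prod_(e <- Es) (4 / Num.sqrt e.1)).
  by apply: prodr_ge0 => e _; rewrite divr_ge0 ?sqrtr_ge0.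
move=> t i j t0; have [_ ] := hE t i j (ltW t0); apply => K.
have -> : kexp E t K (j - i) = kexp (Es ++ Er) t K (j - i).
  by apply: eq_bigr => n _; rewrite (kstep_perm _ _ pE).
have Es0 : {in Es, forall e, 0 < e.1}.
  by move=> e eE; apply: E0; rewrite (perm_mem pE) mem_cat eE.
have Er0 : {in Er, forall e, 0 <= e.1}.
  by move=> e eE; apply/ltW/E0; rewrite (perm_mem pE) mem_cat eE orbT.
apply: (le_trans (ler_wpM2l (expR_ge0 _) (kexp_free_le K (j - i) Es0 Er0 fE t0))).
rewrite -(perm_big _ pE) /= E1 mulr1 mulrA -expRD addNr expR0 mul1r.
have -> : (Num.sqrt t)^-1 ^+ d = \prod_(e <- Es) (Num.sqrt t)^-1.
  by rewrite big_const_seq count_predT iter_mulr_1 sEs.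
rewrite -big_split /= le_eqVlt; apply/orP; left; apply/eqP; apply: eq_bigr => e _.
by rewrite sqrtrM ?ltW // invfM; ring.
Qed.

End jumps.

(** * Sums over the translates of a finite configuration *)

(** The positive cone of the lexicographic order, a total order on Zd that is
    invariant under translations. *)
Definition lexpos (d : nat) (z : Zd d) : bool :=
  [exists i, (0 < z 0 i) && [forall j : 'I_d, (j < i)%N ==> (z 0 j == 0)]].

Lemma lexposP d (z : Zd d) :
  reflect (exists i, 0 < z 0 i /\ forall j : 'I_d, (j < i)%N -> z 0 j = 0) (lexpos z).
Proof.
apply: (iffP existsP) => -[i].
  by case/andP=> zi /forallP h; exists i; split=> // j /(implyP (h j))/eqP.
by case=> zi h; exists i; rewrite zi; apply/forallP => j; apply/implyP => /h ->.
Qed.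

Lemma lexposD d (x y : Zd d) : lexpos x -> lexpos y -> lexpos (x + y).
Proof.
move=> /lexposP[i [xi hi]] /lexposP[j [yj hj]]; apply/lexposP.
case: (ltngtP i j) => [ij|ji|/val_inj ij].
- exists i; rewrite !mxE (hj _ ij) addr0; split=> // l li.
  by rewrite !mxE hi // hj // (ltn_trans li).
- exists j; rewrite !mxE (hi _ ji) add0r; split=> // l lj.
  by rewrite !mxE hj // hi // (ltn_trans lj).
- subst j; exists i; rewrite !mxE addr_gt0 //; split=> // l li.
  by rewrite !mxE hj // hi.
Qed.

Lemma lexpos0 d : lexpos (0 : Zd d) = false.
Proof. by apply/lexposP => -[i]; rewrite mxE ltxx => -[]. Qed.

Lemma lexpos_total d (z : Zd d) : z != 0 -> lexpos z || lexpos (- z).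
Proof.
move=> z0; have /existsP[i0 zi0] : [exists i, z 0 i != 0].
  apply: contraNT z0; rewrite negb_exists => /forallP h.
  by apply/eqP/rowP => i; have := h i; rewrite negbK mxE => /eqP.
have := @arg_minnP _ i0 (fun i => z 0 i != 0) (fun i => nat_of_ord i) zi0.
case=> i zi imin.
have hj (j : 'I_d) : (j < i)%N -> z 0 j = 0.
  by move=> ji; apply/eqP; apply: contraLR ji => /imin; rewrite -leqNgt.
have [zi0'|zi0'|zi0'] := ltgtP 0 (z 0 i).
- by apply/orP; left; apply/lexposP; exists i.
- by apply/orP; right; apply/lexposP; exists i; rewrite mxE oppr_gt0; split=> // j /hj;
    rewrite mxE => ->; rewrite oppr0.
- by rewrite -zi0' eqxx in zi.
Qed.

Definition lexlt d (x y : Zd d) := lexpos (y - x).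

Lemma lexlt_trans d (x y z : Zd d) : lexlt x y -> lexlt y z -> lexlt x z.
Proof.
by move=> xy yz; rewrite /lexlt -(subrK y z) -addrA; apply: lexposD.
Qed.

Lemma lexlt_add d (x y z : Zd d) : lexlt (x + z) (y + z) = lexlt x y.
Proof. by rewrite /lexlt opprD addrACA subrr addr0. Qed.

Lemma seq_minimal (T : eqType) (lt : rel T) (s : seq T) : transitive lt -> irreflexive lt ->
  (0 < size s)%N -> exists2 a, a \in s & {in s, forall z, ~~ lt z a}.
Proof.
move=> tr irr; elim: s => // x [_ _|y s /(_ isT)[a ays ha] _].
  by exists x; [exact: mem_head|move=> z; rewrite inE => /eqP ->; rewrite irr].
have [xa|xa] := boolP (lt x a).
  exists x; first exact: mem_head.
  move=> z; rewrite inE => /predU1P[->|zs]; first by rewrite irr.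
  by apply: contra (ha _ zs) => zx; exact: tr zx xa.
exists a; first by rewrite inE ays orbT.
by move=> z; rewrite inE => /predU1P[->//|]; exact: ha.
Qed.

Fixpoint words (T : Type) (B : seq T) (n : nat) : seq (seq T) :=
  if n is m.+1 then [seq b :: Y | b <- B, Y <- words B m] else [:: [::]].

Lemma size_words (T : Type) (B : seq T) n : size (words B n) = (size B ^ n)%N.
Proof. by elim: n => //= n IH; rewrite size_allpairs IH expnS. Qed.

Lemma mem_words (T : eqType) (B : seq T) n Y :
  (Y \in words B n) = (size Y == n) && all (mem B) Y.
Proof.
elim: n Y => [|n IH] [|y Y] //=.
  by apply/allpairsP => -[[b Z]] /= [].
rewrite eqSS andbCA; apply/allpairsP/andP.
  by case=> -[b Z] /= [bB ZB [-> ->]]; rewrite -IH.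
by case=> yB YB; exists (y, Y); rewrite IH.
Qed.

Lemma words_uniq (T : eqType) (B : seq T) n : uniq B -> uniq (words B n).
Proof.
move=> uB; elim: n => //= n IH; apply: allpairs_uniq => //.
by move=> [a Y] [b Z] _ _ /= [-> ->].
Qed.

Section orbit.
Context (d : nat).
Implicit Types (C X Y Z : seq (Zd d)).

(** Let a be the smallest point of Z. If X' + x consists of Z and k further points,
    then a - x is a point of X' with at most k points of X' below it. These points
    are distinct for distinct x, and the largest of them lies above all the
    others, so there are at most k+1. *)
Lemma shifts_count k (X' Z : seq (Zd d)) (G : seq (Zd d)) :
  (0 < size Z)%N -> uniq G ->
  {in G, forall x, exists2 A : seq (Zd d), size A = k & perm_eq (A ++ Z) [seq y + x | y <- X']} ->
  (size G <= k.+1)%N.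
Proof.
move=> Z0 uG hG.
have tr : transitive (@lexlt d) by move=> y x z; exact: lexlt_trans.
have irr : irreflexive (@lexlt d) by move=> x; rewrite /lexlt subrr lexpos0.
have [a aZ amin] := seq_minimal tr irr Z0.
have key x : x \in G -> a - x \in X' /\ (count (fun c => lexlt c (a - x)) X' <= k)%N.
  move=> /hG[A sA pA]; split.
    have : a \in [seq y + x | y <- X'] by rewrite -(perm_mem pA) mem_cat aZ orbT.
    by case/mapP => y yX ->; rewrite addrK.
  have -> : count (fun c => lexlt c (a - x)) X' = count (fun c => lexlt c a) [seq y + x | y <- X'].
    by rewrite count_map; apply: eq_count => y /=; rewrite -[a in RHS](subrK x) lexlt_add.
  rewrite -(permP pA) count_cat [X in (_ + X)%N](_ : _ = 0%N); last first.
    by apply/eqP; rewrite -leqn0 leqNgt -has_count; apply/hasPn.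
  by rewrite addn0 -sA count_size.
case: (posnP (size G)) => [-> //|G0].
(* The points a - x, of which the largest, b, has all the others below it. *)
pose Bs := [seq a - x | x <- G].
have uBs : uniq Bs by rewrite map_inj_uniq // => x y /addrI/oppr_inj.
have trr : transitive (fun x y => @lexlt d y x) by move=> y x z h1 h2; exact: lexlt_trans h2 h1.
have Bs0 : (0 < size Bs)%N by rewrite size_map.
have [b bBs bmax] := seq_minimal trr irr Bs0.
have -> : size G = (size (rem b Bs)).+1.
  by rewrite (size_rem bBs) prednK // size_map.
rewrite ltnS; case/mapP: (bBs) => x xG bE; have [_] := key _ xG; rewrite -bE.
apply: leq_trans; rewrite -size_filter; apply: uniq_leq_size; first exact: rem_uniq.
move=> c; rewrite mem_rem_uniq // inE => /andP[cb cBs].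
rewrite mem_filter; apply/andP; split; last first.
  by case/mapP: cBs => y yG ->; have [] := key _ yG.
have := bmax _ cBs; rewrite /lexlt.
have : b - c != 0 by rewrite subr_eq0 eq_sym.
by move/lexpos_total; rewrite opprB => /orP[->|->].
Qed.

(** A rearrangement with a given suffix Z is determined by its first k letters,
    which belong to the multiset of the k letters of C outside Z. *)
Lemma perms_suffix_count k (C Z : seq (Zd d)) : size C = (k + size Z)%N ->
  (count (fun Y => drop k Y == Z) (permutations C) <= k ^ k)%N.
Proof.
move=> sC; rewrite -size_filter; set L := [seq Y <- _ | _].
have LP Y : Y \in L -> [/\ Y = take k Y ++ Z, size (take k Y) = k & perm_eq Y C].
  rewrite mem_filter mem_permutations => /andP[/eqP dY pY]; split=> //.
    by rewrite -dY cat_take_drop.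
  by rewrite size_takel // (perm_size pY) sC leq_addr.
have uL : uniq L by rewrite filter_uniq // permutations_uniq.
(* The alphabet of the first k letters is read off from one rearrangement in L. *)
have [Y0 Y0L|L0] := pickP (fun i : 'I_(size L) => true); last first.
  by case EL: (size L) L0 => [//|n] /(_ (Ordinal (ltnSn n))).
have Y1L := mem_nth [::] (ltn_ord Y0); move: (nth [::] L Y0) Y1L => {Y0L}Y0 Y0L.
have [Y0E sY0 pY0] := LP _ Y0L.
rewrite -(size_map (take k)) -{2}sY0 -size_words; apply: uniq_leq_size.
  by rewrite map_inj_in_uniq // => Y Y' /LP[YE _ _] /LP[YE' _ _] h; rewrite YE YE' h.
move=> A /mapP[Y /LP[YE sY pY] ->]; rewrite mem_words sY eqxx /=.
apply/allP => y yY /=.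
have : perm_eq (take k Y ++ Z) (take k Y0 ++ Z).
  by rewrite -YE -Y0E; apply: perm_trans pY _; rewrite perm_sym.
by rewrite perm_cat2r => /perm_mem <-.
Qed.

Lemma ler_sum_fibers (R : numDomainType) (I J : eqType) (s : seq I) (h : I -> J)
    (g : J -> R) (c : nat) :
  (forall j, 0 <= g j) -> (forall j, (count (fun i => h i == j) s <= c)%N) ->
  \sum_(i <- s) g (h i) <= c%:R * \sum_(j <- undup (map h s)) g j.
Proof.
move=> g0 hc; rewrite -(big_map h xpredT g) -big_undup_iterop_count big_distrr /=.
apply: ler_sum => j _.
have -> : iterop (count_mem j (map h s)) +%R (g j) 0 = (count_mem j (map h s))%:R * g j.
  by rewrite Monoid.iteropE iter_addr addr0 mulr_natl.
by rewrite ler_wpM2r // ler_nat count_map; apply: hc.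
Qed.

Lemma sum_zip_le1 (R : numDomainType) (q : Zd d -> Zd d -> R) X (L : seq (seq (Zd d))) :
  (forall x y, 0 <= q x y) ->
  (forall x F, uniq F -> \sum_(y <- F) q x y <= 1) ->
  uniq L -> {in L, forall Z, size Z = size X} ->
  \sum_(Z <- L) \prod_(e <- zip X Z) q e.1 e.2 <= 1.
Proof.
move=> q0 q1; have p0 (s : seq (Zd d * Zd d)) : 0 <= \prod_(e <- s) q e.1 e.2.
  by apply: prodr_ge0 => e _.
elim: X L => [|x X IH] L uL sL.
  apply: (@le_trans _ _ (\sum_(Z <- [:: [::]]) \prod_(e <- zip [::] Z) q e.1 e.2)).
    apply: ler_sum_subset => // Z /sL /size0nil ->; exact: mem_head.
  by rewrite big_seq1 big_nil.
pose hs := undup (map (head 0) L); pose ts := undup (map behead L).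
apply: (@le_trans _ _ (\sum_(Z <- [seq y :: Z | y <- hs, Z <- ts])
   \prod_(e <- zip (x :: X) Z) q e.1 e.2)).
  apply: ler_sum_subset => // Z ZL; have := sL _ ZL; case: Z ZL => [//|y Z] ZL _.
  apply/allpairsP; exists (y, Z); rewrite !mem_undup; split=> //.
    by apply/mapP; exists (y :: Z).
  by apply/mapP; exists (y :: Z).
rewrite big_allpairs_dep /=.
apply: (@le_trans _ _ (\sum_(y <- hs) q x y * 1)); last first.
  under eq_bigr do rewrite mulr1.
  by apply: q1; exact: undup_uniq.
apply: ler_sum => y _; under eq_bigr do rewrite big_cons.
rewrite -big_distrr /=; apply: ler_wpM2l => //; apply: IH; first exact: undup_uniq.
by move=> Z; rewrite mem_undup => /mapP[Z' /sL + ->]; rewrite size_behead => ->.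
Qed.

(** The first k factors are bounded by H. The sum of the remaining product over
    distinct suffixes is at most 1, and a given suffix Z comes from at most k+1
    translates, with at most k^k rearrangements for each of them. *)
Lemma orbit_sum_le (R : numDomainType) (q : Zd d -> Zd d -> R) (H : R) k X X' (F : seq (Zd d)) :
  (forall x y, 0 <= q x y) -> (forall x y, q x y <= H) ->
  (forall x F, uniq F -> \sum_(y <- F) q x y <= 1) ->
  size X = size X' -> (k < size X)%N -> uniq F ->
  \sum_(x <- F) \sum_(Y <- permutations [seq y + x | y <- X'])
     \prod_(e <- zip X Y) q e.1 e.2 <= (k.+1 * k ^ k)%:R * H ^+ k.
Proof.
move=> q0 qH q1 sX kX uF.
have p0 (s : seq (Zd d * Zd d)) : 0 <= \prod_(e <- s) q e.1 e.2.
  by apply: prodr_ge0 => e _.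
have H0 : 0 <= H := le_trans (q0 0 0) (qH 0 0).
pose C x := [seq y + x | y <- X'].
pose L := [seq (x, Y) | x <- F, Y <- permutations (C x)].
have LP l : l \in L -> l.1 \in F /\ perm_eq l.2 (C l.1).
  by case/allpairsPdep => x [Y [xF]]; rewrite mem_permutations => YC ->.
have Ls l : l \in L -> size l.2 = size X.
  by move=> /LP[_ /perm_size ->]; rewrite size_map.
have -> : \sum_(x <- F) \sum_(Y <- permutations (C x)) \prod_(e <- zip X Y) q e.1 e.2 =
    \sum_(l <- L) \prod_(e <- zip X l.2) q e.1 e.2.
  by rewrite big_allpairs_dep.
pose g Z := \prod_(e <- zip (drop k X) Z) q e.1 e.2.
apply: (@le_trans _ _ (\sum_(l <- L) H ^+ k * g (drop k l.2))).
  rewrite big_seq [leRHS]big_seq; apply: ler_sum => l lL.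
  rewrite -{1}(cat_take_drop k X) -{1}(cat_take_drop k l.2).
  rewrite zip_cat; last by rewrite !size_take (Ls _ lL).
  rewrite big_cat /=; apply: ler_wpM2r; first exact: p0.
  have -> : H ^+ k = \prod_(e <- zip (take k X) (take k l.2)) H.
    rewrite big_const_seq count_predT iter_mulr_1 size_zip !size_takel ?minnn //.
      by rewrite (Ls _ lL) ltnW.
    exact: ltnW.
  by apply: ler_prod => e _; rewrite q0 qH.
rewrite -big_distrr /= mulrC; apply: ler_wpM2r; first by rewrite exprn_ge0.
apply: (@le_trans _ _ ((k.+1 * k ^ k)%:R * \sum_(Z <- undup [seq drop k l.2 | l <- L]) g Z)).
  apply: ler_sum_fibers => [Z|Z]; first exact: p0.
  have [->//|Z0] := posnP (count (fun l => drop k l.2 == Z) L).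
  have sZ : size Z = (size X - k)%N.
    move: Z0; rewrite -has_count => /hasP[l lL /eqP <-].
    by rewrite size_drop (Ls _ lL).
  have sC x : size (C x) = (k + size Z)%N by rewrite size_map -sX sZ subnKC // ltnW.
  pose G := [seq x <- F | has (fun Y => drop k Y == Z) (permutations (C x))].
  rewrite count_flatten sumnE !big_map.
  apply: (@leq_trans (\sum_(x <- G) k ^ k)); last first.
    rewrite big_const_seq count_predT iter_addn_0 mulnC.
    rewrite leq_mul2r; apply/orP; right; apply: (@shifts_count k X' Z).
    + by rewrite sZ subn_gt0.
    + exact: filter_uniq.
    + move=> x; rewrite mem_filter => /andP[/hasP[Y]]; rewrite mem_permutations => YC /eqP dY _.
      exists (take k Y); last by rewrite -dY cat_take_drop.
      by rewrite size_takel // (perm_size YC) sC leq_addr.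
  rewrite big_filter [leqRHS]big_mkcond; apply: leq_sum => x _.
  rewrite count_map has_count.
  case: posnP => [h|_]; first by rewrite leqn0; apply/eqP.
  by apply: perms_suffix_count.
rewrite -[leRHS]mulr1; apply: ler_wpM2l => //.
apply: sum_zip_le1 => //; first exact: undup_uniq.
move=> Z; rewrite mem_undup => /mapP[l lL ->].
by rewrite !size_drop (Ls _ lL).
Qed.
End orbit.

(** * Integrals of real functions on a probability space *)

Notation integ P f := (P.-integrable setT (EFin \o f)).

Section real_integrals.
Context (R : realType) (dT : measure_display) (T : measurableType dT) (P : probability T R).
Implicit Types f g h : T -> R.

Lemma integ_measurable f : integ P f -> measurable_fun setT f.
Proof. by move=> /measurable_int/measurable_EFinP. Qed.

Lemma integ_le f g : measurable_fun setT f -> (forall x, `|f x| <= g x) ->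
  integ P g -> integ P f.
Proof.
move=> mf fg; apply: le_integrable => //; first exact/measurable_EFinP.
by move=> x _ /=; rewrite lee_fin (le_trans (fg x)) // ler_norm.
Qed.

Lemma integ_cst c : integ P (fun=> c).
Proof. exact: finite_measure_integrable_cst. Qed.

Lemma integ_norm f : integ P f -> integ P (fun x => `|f x|).
Proof.
move=> If; have mf := integ_measurable If.
by move/integrable_abse : If.
Qed.

Lemma integZ c f : integ P f -> integ P (fun x => c * f x).
Proof. by move=> h; have := integrableZl measurableT c h. Qed.

Lemma integD f g : integ P f -> integ P g -> integ P (fun x => f x + g x).
Proof. by move=> hf hg; have := integrableD measurableT hf hg. Qed.

Lemma integ_sum I (s : seq I) (f : I -> T -> R) : (forall i, integ P (f i)) ->
  integ P (fun x => \sum_(i <- s) f i x).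
Proof.
move=> h; elim: s => [|i s IH].
  by under eq_fun do rewrite big_nil; exact: integ_cst.
by under eq_fun do rewrite big_cons; exact: integD.
Qed.

Lemma Rint_sum I (s : seq I) (f : I -> T -> R) : (forall i, integ P (f i)) ->
  \int[P]_x (\sum_(i <- s) f i x) = \sum_(i <- s) \int[P]_x f i x.
Proof.
move=> h; elim: s => [|i s IH].
  by under eq_Rintegral do rewrite big_nil; rewrite big_nil Rintegral_cst // mul0r.
under eq_Rintegral do rewrite big_cons; rewrite big_cons -IH RintegralD //.
exact: integ_sum.
Qed.

Lemma Rint_cst c : \int[P]_x c = c.
Proof.
rewrite Rintegral_cst // [X in fine X](_ : _ = 1%E) ?mulr1 //.
exact: probability_setT.
Qed.

Lemma Rint_dominated (f_ : nat -> T -> R) f g :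
  (forall n, measurable_fun setT (f_ n)) -> measurable_fun setT f ->
  {ae P, forall x, f_ ^~ x @ \oo --> f x} -> integ P g ->
  (forall n x, `|f_ n x| <= g x) ->
  integ P f /\ \int[P]_x f_ n x @[n --> \oo] --> \int[P]_x f x.
Proof.
move=> mf_ mf cf ig fg.
have h1 : {ae P, forall x, setT x -> (fun n => (f_ n x)%:E) @ \oo --> (EFin \o f) x}.
  by apply: filterS cf => x cx _; apply: cvg_EFin; [exact: nearW|exact: cx].
have h2 : {ae P, forall x n, setT x -> (`|(f_ n x)%:E| <= (EFin \o g) x)%E}.
  by apply: aeW => x n _; rewrite lee_fin.
have mf_' n : measurable_fun setT (EFin \o f_ n) by exact/measurable_EFinP.
have mf' : measurable_fun setT (EFin \o f) by exact/measurable_EFinP.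
have [If _ cv] := dominated_convergence measurableT mf_' mf' h1 ig h2.
split=> //; apply: fine_cvg; rewrite fineK; first exact: cv.
exact: integrable_fin_num If.
Qed.

Lemma Rint_series (a : nat -> T -> R) f g :
  (forall n, measurable_fun setT (a n)) -> integ P g ->
  (forall K x, \sum_(0 <= k < K) `|a k x| <= g x) ->
  (forall x, series (a ^~ x) @ \oo --> f x) ->
  [/\ integ P f, forall k, integ P (a k),
     forall K, \sum_(0 <= k < K) `|\int[P]_x a k x| <= \int[P]_x g x
   & series (fun k => \int[P]_x a k x) @ \oo --> \int[P]_x f x].
Proof.
move=> ma ig ag af.
have Ia k : integ P (a k).
  apply: integ_le ig => // x; apply: le_trans (ag k.+1 x).
  by rewrite big_nat_recr //= lerDr sumr_ge0.
have mS K : measurable_fun setT (fun x => series (a ^~ x) K).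
  by rewrite /series /=; exact: measurable_sum.
have mf : measurable_fun setT f.
  by apply: measurable_fun_cvg mS _ => x _; exact: af.
have [If cv] : integ P f /\ \int[P]_x series (a ^~ x) K @[K --> \oo] --> \int[P]_x f x.
  apply: Rint_dominated ig _ => //; first exact: aeW.
  move=> n x; rewrite seriesEnat /=; apply: le_trans (ag n x).
  exact: ler_norm_sum.
split=> //.
  move=> K; apply: (@le_trans _ _ (\sum_(0 <= k < K) \int[P]_x `|a k x|)).
    by apply: ler_sum => k _; exact: le_normr_Rintegral.
  rewrite -Rint_sum; last by move=> i; exact: integ_norm.
  apply: le_Rintegral => //; apply: integ_sum => i; exact: integ_norm.
suff -> : series (fun k => \int[P]_x a k x) = (fun K => \int[P]_x series (a ^~ x) K) by [].
by apply/funext => K; rewrite !seriesEnat /= -Rint_sum.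
Qed.

End real_integrals.

(** * Comparison of power series coefficients under an integral *)

(** psi u m is the sum of the power series with coefficients psic k m, whose
    absolute sums are dominated by G m uniformly in u; the domination is what allows
    integration term by term. *)
Definition expansion (R : realType) (psi : R -> nat -> R) (psic : nat -> nat -> R)
    (G : nat -> R) : Prop :=
  (forall K m, \sum_(0 <= k < K) `|psic k m| <= G m) /\
  (forall u : R, 0 <= u <= 1 -> forall m,
     series (fun k => u ^+ k * psic k m) @ \oo --> psi u m).

Lemma charlier_expansion (R : realType) (rho : R) : 0 < rho ->
  expansion (fun u m => expR (rho * u) * (1 - u) ^+ m) (charlier_coef rho)
    (fun m => expR rho * 2 ^+ m).
Proof.
move=> r0; split=> [K m|u _ m]; have [h1 h2] := charlier_coef_series m r0.
  exact: h1.
exact: h2.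
Qed.

Lemma indicator_expansion (R : realType) :
  expansion (fun u m => u ^+ m : R) (fun k m => (k == m)%:R) (fun=> 1).
Proof. by split=> [K m|u _ m]; have [h1 h2] := indicator_series R m. Qed.

Lemma measurable_nat (R : realType) (F : nat -> R) : measurable_fun setT F.
Proof. by []. Qed.

Section extraction.
Context (R : realType) (dT : measure_display) (T : measurableType dT) (P : probability T R).
Context (psi : R -> nat -> R) (psic : nat -> nat -> R) (G : nat -> R).
Hypothesis hpsi : expansion psi psic G.

Lemma expansion_G_ge0 m : 0 <= G m.
Proof. by case: hpsi => /(_ 0%N m); rewrite big_nil. Qed.

Lemma psic_le k m : `|psic k m| <= G m.
Proof.
case: hpsi => /(_ k.+1 m) h _; apply: le_trans h.
by rewrite big_nat_recr //= lerDr sumr_ge0.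
Qed.

Lemma psi_le (u : R) m : 0 <= u <= 1 -> `|psi u m| <= G m.
Proof.
move=> u01; case: hpsi => h1 /(_ u u01 m) /cvg_norm; move/cvgr_to_le; apply.
apply: nearW => K; apply: le_trans (h1 K m).
rewrite /series /=; apply: (le_trans (ler_norm_sum _ _ _)).
apply: ler_sum => k _; rewrite normrM -[leRHS]mul1r ler_wpM2r //.
case/andP: u01 => u0 u1.
by rewrite ger0_norm ?exprn_ge0 // exprn_ile1.
Qed.

(** Term by term integration of the expansion at one random site. *)
Lemma expansion_integral (h : T -> R) (o : T -> nat) :
  measurable_fun setT h -> measurable_fun setT o ->
  integ P (fun x => `|h x| * G (o x)) ->
  [/\ forall u : R, 0 <= u <= 1 -> integ P (fun x => h x * psi u (o x)),
      forall k, integ P (fun x => h x * psic k (o x)),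
      forall K, \sum_(0 <= k < K) `|\int[P]_x (h x * psic k (o x))| <=
        \int[P]_x (`|h x| * G (o x))
    & forall u : R, 0 <= u <= 1 ->
      series (fun k => u ^+ k * \int[P]_x (h x * psic k (o x))) @ \oo
        --> \int[P]_x (h x * psi u (o x))].
Proof.
move=> mh mo ig; case: (hpsi) => h1 h2.
have mo' (F : nat -> R) : measurable_fun setT (fun x => F (o x)).
  by apply: measurableT_comp.
have key (u : R) : 0 <= u <= 1 ->
   [/\ integ P (fun x => h x * psi u (o x)),
      forall k, integ P (fun x => u ^+ k * (h x * psic k (o x))),
      forall K, \sum_(0 <= k < K) `|\int[P]_x (u ^+ k * (h x * psic k (o x)))| <=
        \int[P]_x (`|h x| * G (o x))
    & series (fun k => \int[P]_x (u ^+ k * (h x * psic k (o x)))) @ \oo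
        --> \int[P]_x (h x * psi u (o x))].
  move=> u01; apply: Rint_series => //.
  - by move=> k; apply: measurable_funM => //; apply: measurable_funM.
  - move=> K x; apply: (@le_trans _ _ (`|h x| * \sum_(0 <= k < K) `|psic k (o x)|)).
      rewrite big_distrr /=; apply: ler_sum => k _; rewrite !normrM mulrCA.
      apply: ler_wpM2l => //; rewrite -[leRHS]mul1r; apply: ler_wpM2r => //.
      case/andP: u01 => u0 u1.
      by rewrite ger0_norm ?exprn_ge0 // exprn_ile1.
    by apply: ler_wpM2l.
  - move=> x.
    have -> : series (fun k => u ^+ k * (h x * psic k (o x))) =
        fun K => h x * series (fun k => u ^+ k * psic k (o x)) K.
      apply/funext => K; rewrite /series /= big_distrr /=.
      by apply: eq_bigr => k _; rewrite mulrCA.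
    by apply: cvgMr; exact: h2.
have one01 : (0 <= (1 : R)) && ((1 : R) <= 1) by rewrite ler01 lexx.
have [_ k1 k2 _] := key 1 one01.
have Ik k : integ P (fun x => h x * psic k (o x)).
  by have := k1 k; under eq_fun do rewrite expr1n mul1r.
split=> // [u u01|K|u u01]; first by have [] := key u u01.
- have := k2 K; congr (_ <= _); apply: eq_bigr => k _.
  by under eq_Rintegral do rewrite expr1n mul1r.
- have [_ _ _] := key u u01.
  suff -> : (fun k => \int[P]_x (u ^+ k * (h x * psic k (o x)))) =
      (fun k => u ^+ k * \int[P]_x (h x * psic k (o x))) by [].
  by apply/funext => k; rewrite RintegralZl.
Qed.

(** If the expectation of h prod_b psi(V_b, o_b) is a finite sum of products of
    power series in the V_b, then the expectation of h prod_b psic(k_b, o_b) is the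
    corresponding sum of products of coefficients. Sites are treated one at a time:
    the other variables are fixed and two power series in V_b are compared. *)
Lemma extract_coefs (S : eqType) (o : S -> T -> nat) (B : seq S) (h : T -> R)
    (I : Type) (r : seq I) (c : I -> R) (cf : I -> S -> nat -> R) (phi : I -> S -> R -> R) :
  (forall b, measurable_fun setT (o b)) -> measurable_fun setT h -> uniq B ->
  integ P (fun x => `|h x| * \prod_(b <- B) G (o b x)) ->
  (forall i b, exists M : R, forall K, \sum_(0 <= k < K) `|cf i b k| <= M) ->
  (forall i b (u : R), 0 <= u <= 1 -> series (fun k => u ^+ k * cf i b k) @ \oo --> phi i b u) ->
  (forall V : S -> R, (forall b, 0 <= V b <= 1) ->
     \int[P]_x (h x * \prod_(b <- B) psi (V b) (o b x)) =
     \sum_(i <- r) c i * \prod_(b <- B) phi i b (V b)) ->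
  forall k : S -> nat,
     \int[P]_x (h x * \prod_(b <- B) psic (k b) (o b x)) =
     \sum_(i <- r) c i * \prod_(b <- B) cf i b (k b).
Proof.
move=> mo + + + cfM cfphi.
have mo' b (F : nat -> R) : measurable_fun setT (fun x => F (o b x)).
  by apply: measurableT_comp.
elim: B h c => [|b B IH] h c mh /=.
  move=> _ _ H k.
  have z01 : (0 <= (0 : R)) && ((0 : R) <= 1) by rewrite ler01 lexx.
  have := H (fun=> 0) (fun=> z01).
  under eq_Rintegral do rewrite big_nil.
  under [X in _ = X -> _]eq_bigr do rewrite big_nil.
  under [X in _ -> X = _]eq_Rintegral do rewrite big_nil.
  by under [X in _ -> _ = X]eq_bigr do rewrite big_nil.
case/andP => bB uB Ih H k.
have G0 (s : seq S) x : 0 <= \prod_(b <- s) G (o b x).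
  by apply: prodr_ge0 => j _; exact: expansion_G_ge0.
under eq_Rintegral do rewrite big_cons mulrA.
under [in RHS]eq_bigr do rewrite big_cons mulrA.
apply: IH => //.
- by apply: measurable_funM => //; exact: mo'.
- apply: integ_le Ih.
    apply: measurable_funM; first by apply: measurableT_comp => //; apply: measurable_funM => //; exact: mo'.
    by apply: measurable_prod => i _; exact: (mo' i).
  move=> x; rewrite ger0_norm ?mulr_ge0 // big_cons normrM -mulrA.
  by apply: ler_wpM2l => //; apply: ler_wpM2r => //; exact: psic_le.
move=> V V01.
(* Both sides are power series in the variable of the site b; c' are the
   coefficients of the right-hand side. *)
pose h' x := h x * \prod_(b <- B) psi (V b) (o b x).
have mh' : measurable_fun setT h'.
  by apply: measurable_funM => //; apply: measurable_prod => i _; exact: (mo' i).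
have Ih' : integ P (fun x => `|h' x| * G (o b x)).
  apply: integ_le Ih.
    by apply: measurable_funM; [apply: measurableT_comp|exact: mo'].
  move=> x; rewrite ger0_norm ?mulr_ge0 ?expansion_G_ge0 // big_cons normrM -mulrA.
  apply: ler_wpM2l => //; rewrite mulrC; apply: ler_wpM2l; first exact: expansion_G_ge0.
  rewrite normr_prod; apply: ler_prod => i _; rewrite normr_ge0 /=; exact: psi_le.
have [_ _ hb hs] := expansion_integral mh' (mo b) Ih'.
pose c' j := \sum_(i <- r) c i * (\prod_(b <- B) phi i b (V b)) * cf i b j.
have [M' hM'] : exists M' : R, forall K, \sum_(0 <= j < K) `|c' j| <= M'.
  have /choice[M cM] := fun i => cfM i b.
  exists (\sum_(i <- r) `|c i * (\prod_(b <- B) phi i b (V b))| * M i) => K.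
  apply: (@le_trans _ _ (\sum_(0 <= j < K) \sum_(i <- r)
      `|c i * (\prod_(b <- B) phi i b (V b))| * `|cf i b j|)).
    apply: ler_sum => j _; apply: (le_trans (ler_norm_sum _ _ _)).
    by apply: ler_sum => i _; rewrite normrM.
  rewrite exchange_big /=; apply: ler_sum => i _.
  by rewrite -big_distrr /= ler_wpM2l.
have := @powser_coef_inj R (fun k => \int[P]_x (h' x * psic k (o b x))) c'
  (Num.max (\int[P]_x (`|h' x| * G (o b x))) M') (fun u => \int[P]_x (h' x * psi u (o b x))).
move=> /(_ _ _ hs _ (k b)) inj.
transitivity (\int[P]_x (h' x * psic (k b) (o b x))).
  by apply: eq_Rintegral => x _; rewrite /h' mulrAC.
rewrite inj.
- by apply: eq_bigr => i _; rewrite mulrAC.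
- by move=> K; rewrite le_max hb.
- by move=> K; rewrite le_max hM' orbT.
move=> u u01.
(* V with its value at b replaced by u. *)
pose Vu b' := if b' == b then u else V b'.
have Vu01 b' : 0 <= Vu b' <= 1 by rewrite /Vu; case: eqP.
have VuB (F : S -> R -> R) : \prod_(b' <- B) F b' (Vu b') = \prod_(b' <- B) F b' (V b').
  rewrite big_seq [RHS]big_seq; apply: eq_bigr => b' b'B; rewrite /Vu.
  by case: eqP => // bb; rewrite -bb b'B in bB.
have -> : \int[P]_x (h' x * psi u (o b x)) =
    \sum_(i <- r) c i * (\prod_(b <- B) phi i b (V b)) * phi i b u.
  have := H Vu Vu01; under eq_Rintegral do rewrite big_cons.
  under [in RHS]eq_bigr do rewrite big_cons.
  move=> E; transitivity (\int[P]_x (h x * (psi (Vu b) (o b x) * \prod_(b' <- B) psi (Vu b') (o b' x)))).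
    apply: eq_Rintegral => x _; rewrite (VuB (fun b' v => psi v (o b' x))) /h'.
    by rewrite /Vu eqxx mulrAC mulrA.
  rewrite E; apply: eq_bigr => i _; rewrite (VuB (phi i)) /Vu eqxx.
  by rewrite mulrAC mulrA.
have -> : series (fun k0 => u ^+ k0 * c' k0) = fun K => \sum_(i <- r)
   (c i * (\prod_(b <- B) phi i b (V b))) * series (fun k => u ^+ k * cf i b k) K.
  apply/funext => K; rewrite /series /=.
  under eq_bigr do rewrite /c' big_distrr /=.
  rewrite exchange_big /=; apply: eq_bigr => i _.
  by rewrite big_distrr /=; apply: eq_bigr => j _; rewrite mulrCA.
by apply: cvg_sumr => i; apply: cvgMr; exact: cfphi.
Qed.

Lemma expansion_orth (o : T -> nat) (h : T -> R) :
  measurable_fun setT o -> measurable_fun setT h ->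
  integ P (fun x => `|h x| * G (o x)) ->
  (forall k, \int[P]_x (h x * psic k (o x)) = 0) ->
  forall u : R, 0 <= u <= 1 -> \int[P]_x (h x * psi u (o x)) = 0.
Proof.
move=> mo mh Ih h0 u u01; have [_ _ _ /(_ u u01)] := expansion_integral mh mo Ih.
have -> : (fun k => u ^+ k * \int[P]_x (h x * psic k (o x))) = fun=> 0.
  by apply/funext => k; rewrite h0 mulr0.
move=> cv; apply/esym; apply: cvg_unique cv => //.
by apply: cvg_near_cst; apply: nearW => K; rewrite /series /= big1.
Qed.
End extraction.

(** * The configuration space and the Poisson measure *)

Section config_space.
Context (d : nat).
Local Notation config := (config d).

Lemma measurable_cyl1 (x : Zd d) n : measurable [set eta : config | eta x = n].
Proof. by apply: sub_sigma_algebra; exists x, n. Qed.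

Lemma measurable_coord (x : Zd d) : measurable_fun setT (fun eta : config => eta x).
Proof.
move=> _ Y _; rewrite setTI.
have -> : (fun eta : config => eta x) @^-1` Y = \bigcup_(n in Y) [set eta : config | eta x = n].
  by apply/seteqP; split=> [eta Yx|eta [n Yn /= ->]] //; exists (eta x).
by apply: bigcup_measurable => n _; exact: measurable_cyl1.
Qed.

(** Cylinders with finitely many prescribed sites: unlike the generators of the
    sigma-algebra they are closed under intersections, up to the empty set. *)
Definition cyl (F : {fset Zd d}) (n : Zd d -> nat) : set config :=
  [set eta | forall x, x \in F -> eta x = n x].

Lemma measurable_cyl F n : measurable (cyl F n).
Proof.
have -> : cyl F n = \bigcap_(x in [set` F]) [set eta : config | eta x = n x].
  by apply/seteqP; split=> eta h x /h.
apply: fin_bigcap_measurable => // x _; exact: measurable_cyl1.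
Qed.

Definition cylsets : set (set config) :=
  [set A | A = set0 \/ exists F n, A = cyl F n].

Lemma cylsets_setI : setI_closed cylsets.
Proof.
move=> A B [->|[F [n ->]]]; first by left; rewrite set0I.
move=> [->|[F' [n' ->]]]; first by left; rewrite setI0.
have [h|h] := pselect (forall x, x \in F -> x \in F' -> n x = n' x); last first.
  left; apply/seteqP; split=> // eta [h1 h2]; apply: h => x xF xF'.
  by rewrite -(h1 _ xF) -(h2 _ xF').
right; exists (F `|` F')%fset, (fun x => if x \in F then n x else n' x).
apply/seteqP; split=> eta.
  move=> [h1 h2] x; rewrite in_fsetU; case: ifPn => [xF _|xF /= xF']; first exact: h1.
  exact: h2.
move=> h1; split=> x xF; have := h1 x; rewrite in_fsetU xF ?orbT => /(_ isT) ->//.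
by case: ifP => // xF'; exact: h.
Qed.

Lemma measurable_configE : @measurable _ config = <<s cylsets >>.
Proof.
apply/seteqP; split.
  apply: smallest_sub; first exact: smallest_sigma_algebra.
  move=> _ [x [n ->]]; apply: sub_sigma_algebra; right; exists [fset x]%fset, (fun=> n).
  apply/seteqP; split=> eta /=; first by move=> h y; rewrite inE => /eqP ->.
  by apply; rewrite inE.
apply: smallest_sub; first exact: sigma_algebra_measurable.
by move=> _ [->|[F [n ->]]] //; exact: measurable_cyl.
Qed.

(** The induction principle by which measures and signed integrals on the
    configuration space are compared on cylinders only. *)
Lemma config_dynkin (Q : set (set config)) :
  Q setT -> (forall F n, Q (cyl F n)) -> Q set0 ->
  (forall S, measurable S -> Q S -> Q (~` S)) ->
  (forall F : (set config)^nat, (forall n, measurable (F n)) ->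
    trivIset [set: nat] F -> (forall n, Q (F n)) -> Q (\bigcup_k F k)) ->
  forall S, measurable S -> Q S.
Proof.
move=> QT Qc Q0 QC QU S; rewrite measurable_configE; apply: dynkin_induction => //.
- exact: measurable_configE.
- exact: cylsets_setI.
- by move=> _ [->|[F [n ->]]].
Qed.

End config_space.

Section poisson_field.
Context (R : realType) (d : nat) (rho : R) (nu : probability (config d) R).
Hypotheses (rho0 : 0 < rho) (hnu : poisson_product rho nu).

Lemma poisson_pmfE n : poisson_pmf rho n = expR (- rho) * (rho ^+ n / n`!%:R).
Proof. by rewrite /poisson_pmf rho0 mulrC. Qed.

(** Sites of A are weighted, sites of C are prescribed. Expanding w^n as the sum
    over k of w^k times the indicator of n = k moves a site from A to C, and with A
    empty the formula is the definition of the Poisson product. *)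
Lemma nu_pgf_cyl (A C : seq (Zd d)) (w : Zd d -> R) (n : Zd d -> nat) :
  (forall x, 0 <= w x) -> uniq (A ++ C) ->
  (\int[nu]_eta (\prod_(a <- A) w a ^+ eta a * \prod_(x <- C) (eta x == n x)%:R)%:E)%E =
  (\prod_(a <- A) expR (rho * (w a - 1)) * \prod_(x <- C) poisson_pmf rho (n x))%:E.
Proof.
move=> w0; elim: A C n => [|a A IH] C n /= uC.
  rewrite big_nil mul1r.
  transitivity (nu (cyl [fset x in C]%fset n)).
    rewrite -[cyl _ _]setIT -integral_indic //; last exact: measurable_cyl.
    apply: eq_integral => eta _; rewrite big_nil mul1r indicE; congr (_%:E).
    case: (boolP (all (fun x => eta x == n x) C)) => [/allP h|/allPn[x xC hx]].
      rewrite mem_set; last by move=> x; rewrite inE /= => /h/eqP.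
      by rewrite big_seq big1 // => x /h ->.
    rewrite memNset; last by move=> /(_ x); rewrite inE /= => /(_ xC)/eqP; apply/negP.
    by apply/eqP; rewrite prodf_seq_eq0; apply/hasP; exists x; rewrite // pnatr_eq0 eqb0.
  rewrite [LHS]hnu; congr (_%:E); apply: perm_big; apply: uniq_perm => //.
  by move=> x; rewrite inE.
have mG k : measurable_fun setT (fun eta : config d =>
    (\prod_(b <- A) w b ^+ eta b * \prod_(x <- a :: C) (eta x == (if x == a then k else n x))%:R)%:E).
  apply/measurable_EFinP; apply: measurable_funM.
    apply: measurable_prod => b _.
    by apply: (measurableT_comp (measurable_nat (fun m => w b ^+ m))); exact: measurable_coord.
  apply: measurable_prod => x _.
  apply: (measurableT_comp (measurable_nat (fun m => (m == (if x == a then k else n x))%:R))).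
  exact: measurable_coord.
have mF k : measurable_fun setT (fun eta : config d =>
    (w a ^+ k * (\prod_(b <- A) w b ^+ eta b * \prod_(x <- a :: C) (eta x == (if x == a then k else n x))%:R))%:E).
  apply/measurable_EFinP; apply: measurable_funM => //.
  by have /measurable_EFinP := mG k.
have aC : a \notin C by move: uC; rewrite mem_cat negb_or => /andP[/andP[]].
have nE k : \prod_(x <- a :: C) poisson_pmf rho (if x == a then k else n x) =
    poisson_pmf rho k * \prod_(x <- C) poisson_pmf rho (n x).
  rewrite big_cons eqxx; congr (_ * _); rewrite big_seq [RHS]big_seq.
  by apply: eq_bigr => x xC; case: (x =P a) => // xa; rewrite -xa xC in aC.
have p0 (s : seq (Zd d)) (F : Zd d -> R) : (forall x, 0 <= F x) -> 0 <= \prod_(x <- s) F x.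
  by move=> F0; apply: prodr_ge0.
transitivity (\int[nu]_eta (\sum_(k <oo) (w a ^+ k * (\prod_(b <- A) w b ^+ eta b *
    \prod_(x <- a :: C) (eta x == (if x == a then k else n x))%:R))%:E))%E.
  apply: eq_integral => eta _.
  have E k : w a ^+ k * (\prod_(b <- A) w b ^+ eta b *
    \prod_(x <- a :: C) (eta x == (if x == a then k else n x))%:R) =
    if k == eta a then \prod_(b <- (a :: A)) w b ^+ eta b * \prod_(x <- C) (eta x == n x)%:R else 0.
    rewrite !big_cons eqxx eq_sym; case: eqP => [->|_]; last by rewrite mul0r !mulr0.
    rewrite mul1r mulrA; congr (_ * _); rewrite big_seq [RHS]big_seq.
    by apply: eq_bigr => x xC; case: (x =P a) => // xa; rewrite -xa xC in aC.
  rewrite (eq_eseriesr (fun k _ => congr1 EFin (E k))).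
  rewrite (nneseriesD1 (n := eta a)) //=; last first.
    by move=> k _; case: ifP => // _; rewrite lee_fin mulr_ge0 ?p0 // => x; rewrite exprn_ge0.
  rewrite eqxx [X in (_ + X)%E](_ : _ = 0%E) ?adde0 //.
  by rewrite eseries0 // => k _ /=; case: (k == eta a).
rewrite integral_nneseries //; last first.
  by move=> k eta _; rewrite lee_fin !mulr_ge0 ?exprn_ge0 ?p0 // => x; rewrite exprn_ge0.
rewrite (eq_eseriesr (g := fun k => ((\prod_(b <- A) expR (rho * (w b - 1)) *
    \prod_(x <- C) poisson_pmf rho (n x)) * expR (- rho) * (((rho * w a) ^+ k) / k`!%:R))%:E)); last first.
  move=> k _; under eq_integral do rewrite EFinM.
  rewrite ge0_integralZl_EFin ?exprn_ge0 //; last first.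
    by move=> eta _; rewrite lee_fin mulr_ge0 ?p0 // => x; rewrite exprn_ge0.
  rewrite IH; last first.
    by rewrite -cat1s uniq_catCA.
  rewrite -EFinM nE poisson_pmfE exprMn; congr (_%:E); ring.
rewrite big_cons.
set c := \prod_(b <- A) _ * _.
have c0 : 0 <= c.
  apply: mulr_ge0; first by apply: p0 => x; exact: expR_ge0.
  by apply: p0 => x; exact: poisson_pmf_ge0.
have -> : expR (rho * (w a - 1)) * \prod_(b <- A) expR (rho * (w b - 1)) *
    \prod_(x <- C) poisson_pmf rho (n x) = c * expR (- rho) * expR (rho * w a).
  by rewrite mulrBr mulr1 expRD /c; ring.
apply/cvg_lim => //; apply: cvg_EFin; first by apply: nearW => K; rewrite sumEFin.
have -> : fine \o eseries (fun k => (c * expR (- rho) * ((rho * w a) ^+ k / k`!%:R))%:E) =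
    fun K => c * expR (- rho) * series (exp_coeff (rho * w a)) K.
  by apply/funext => K /=; rewrite /eseries /= sumEFin /= /series /= big_distrr.
by apply: cvgMr; exact: is_cvg_series_exp_coeff.
Qed.

End poisson_field.

(** * Image laws, countable partitions, independence *)

Section transport.
Context (R : realType) (d : nat) (nu : probability (config d) R)
  (dT : measure_display) (T : measurableType dT) (P : probability T R) (o : T -> config d).
Hypotheses (mo : measurable_fun setT o)
  (law : forall A, measurable A -> P (o @^-1` A) = nu A).

Lemma integral_law_ge0 (f : config d -> \bar R) : measurable_fun setT f ->
  (forall x, 0 <= f x)%E -> (\int[P]_x f (o x) = \int[nu]_y f y)%E.
Proof.
move=> mf f0.
have := ge0_integral_pushforward mo P measurableT mf (fun y _ => f0 y).
rewrite preimage_setT => <-; apply: eq_measure_integral => A mA _.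
exact: (law mA).
Qed.

Lemma integral_law (f : config d -> \bar R) : measurable_fun setT f ->
  (\int[P]_x f (o x) = \int[nu]_y f y)%E.
Proof.
move=> mf; rewrite integralE [RHS]integralE.
have -> := esym (@integral_law_ge0 f^\+%E (measurable_funepos mf) (fun x => funepos_ge0 f x)).
have -> := esym (@integral_law_ge0 f^\-%E (measurable_funeneg mf) (fun x => funeneg_ge0 f x)).
by rewrite (funepos_comp f o) (funeneg_comp f o).
Qed.

Lemma integ_law (f : config d -> R) : integ nu f -> integ P (fun x => f (o x)).
Proof.
move=> If; have mf := integ_measurable If.
apply/integrableP; split; first by apply/measurable_EFinP; exact: measurableT_comp mf mo.
have /integrableP[_] := If; apply: le_lt_trans.
have := integral_law_ge0 (f := fun y => `|(f y)%:E|%E) => -> //.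
by apply: measurableT_comp => //; exact/measurable_EFinP.
Qed.

Lemma Rint_law (f : config d -> R) : measurable_fun setT f ->
  \int[P]_x f (o x) = \int[nu]_y f y.
Proof.
move=> mf; congr fine; rewrite -[RHS]integral_law //; exact/measurable_EFinP.
Qed.
End transport.

Section nu_pgf.
Context (R : realType) (d : nat) (rho : R) (nu : probability (config d) R).
Hypotheses (rho0 : 0 < rho) (hnu : poisson_product rho nu).

Lemma nu_pgf (A : seq (Zd d)) (w : Zd d -> R) : (forall x, 0 <= w x) -> uniq A ->
  integ nu (fun eta => \prod_(a <- A) w a ^+ eta a) /\
  \int[nu]_eta (\prod_(a <- A) w a ^+ eta a) = \prod_(a <- A) expR (rho * (w a - 1)).
Proof.
move=> w0 uA; have := @nu_pgf_cyl _ _ _ _ rho0 hnu A [::] w (fun=> 0%N) w0.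
rewrite cats0 => /(_ uA).
rewrite [in RHS]big_nil mulr1.
under eq_integral do rewrite big_nil mulr1.
move=> E; split; last by rewrite /Rintegral E.
apply/integrableP; split.
  apply/measurable_EFinP; apply: measurable_prod => b _.
  by apply: (measurableT_comp (measurable_nat (fun m => w b ^+ m))); exact: measurable_coord.
under eq_integral => x _.
  rewrite /= ger0_norm; last by apply: prodr_ge0 => b _; rewrite exprn_ge0.
  over.
by rewrite E ltry.
Qed.

End nu_pgf.

(** Integrals that involve a random finite index set are computed on each event
    where a countably valued function o fixes that set. *)
Lemma integral_partition (R : realType) (dT : measure_display) (T : measurableType dT)
    (P : probability T R) (I : countType) (o : T -> I) (f g : T -> R) :
  (forall x, 0 <= f x) -> (forall x, 0 <= g x) ->
  (forall i, measurable_fun setT (fun x => f x * (o x == i)%:R)) ->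
  (forall i, measurable_fun setT (fun x => g x * (o x == i)%:R)) ->
  (forall i, \int[P]_x (f x * (o x == i)%:R)%:E = \int[P]_x (g x * (o x == i)%:R)%:E)%E ->
  measurable_fun setT f /\ (\int[P]_x (f x)%:E = \int[P]_x (g x)%:E)%E.
Proof.
pose pc (f : T -> R) k x := if pickle_inv k is Some i then f x * (o x == i)%:R else 0.
have pcE (h : T -> R) x : (forall x, 0 <= h x) -> (h x)%:E = (\sum_(k <oo) (pc h k x)%:E)%E.
  move=> h0; rewrite (nneseriesD1 (n := @choice.pickle I (o x))) //=; last first.
    by move=> k _; rewrite /pc; case: pickle_inv => // i; rewrite lee_fin mulr_ge0.
  rewrite /pc pickleK_inv eqxx mulr1 [X in (_ + X)%E](_ : _ = 0%E) ?adde0 //.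
  rewrite eseries0 // => k _ /=.
  have := @pickle_invK I k; case: (pickle_inv k) => //= i <-.
  by case: (o x =P i) => [->|_ _]; rewrite ?eqxx ?mulr0.
move=> f0 g0 mf mg fg.
have mpc (h : T -> R) : (forall i, measurable_fun setT (fun x => h x * (o x == i)%:R)) ->
    forall k, measurable_fun setT (fun x => (pc h k x)%:E).
  move=> mh k; apply/measurable_EFinP; rewrite /pc; case: pickle_inv => [i|] //.
have pc0 (h : T -> R) : (forall x, 0 <= h x) -> forall k x, (0 <= (pc h k x)%:E)%E.
  by move=> h0 k x; rewrite /pc lee_fin; case: pickle_inv => // i; rewrite mulr_ge0.
split.
  apply/measurable_EFinP.
  have -> : EFin \o f = fun x => (\sum_(k <oo) (pc f k x)%:E)%E.
    by apply/funext => x /=; exact: pcE.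
  exact: (@ge0_emeasurable_sum _ _ _ setT (fun k x => (pc f k x)%:E) xpredT
    (fun k x _ _ => pc0 _ f0 k x) (fun k _ => mpc _ mf k)).
under eq_integral => x _ do rewrite (pcE f) //.
under [RHS]eq_integral => x _ do rewrite (pcE g) //.
rewrite (integral_nneseries P measurableT (mpc _ mf)); last by move=> k x _; exact: pc0.
rewrite (integral_nneseries P measurableT (mpc _ mg)); last by move=> k x _; exact: pc0.
apply: eq_eseriesr => k _; rewrite /pc; case: pickle_inv => [i|] //.
Qed.

Section independence.
Context (R : realType) (d : nat) (dW : measure_display) (W : measurableType dW)
  (P : probability W R) (I : choiceType) (F : I -> set (set W)).
Hypotheses (indep : mutually_independent P F) (mF : forall i A, F i A -> measurable A).

Let Pr (A : set W) : R := fine (P A).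

Lemma Rint_indic A : measurable A -> \int[P]_x (\1_A x) = Pr A.
Proof. by move=> mA; rewrite /Rintegral /= integral_indic // setIT. Qed.

Lemma integ_indic A : measurable A -> integ P (\1_A : W -> R).
Proof.
move=> mA; apply: (integ_le (g := fun=> 1)); first exact: measurable_indic.
  by move=> x; rewrite ger0_norm indicE // lern1 leq_b1.
exact: integ_cst.
Qed.

Lemma measurable_sum_seq (K : eqType) (s : seq K) (f : K -> W -> R) :
  (forall i, i \in s -> measurable_fun setT (f i)) ->
  measurable_fun setT (fun x => \sum_(i <- s) f i x).
Proof.
elim: s => [_|i s IH h].
  by under eq_fun do rewrite big_nil; exact: measurable_cst.
under eq_fun do rewrite big_cons; apply: measurable_funD.
  by apply: h; rewrite mem_head.
by apply: IH => j js; apply: h; rewrite inE js orbT.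
Qed.

Lemma Rint_sum_seq (K : eqType) (s : seq K) (f : K -> W -> R) :
  (forall i, i \in s -> integ P (f i)) ->
  integ P (fun x => \sum_(i <- s) f i x) /\
  \int[P]_x (\sum_(i <- s) f i x) = \sum_(i <- s) \int[P]_x f i x.
Proof.
elim: s => [_|i s IH h].
  split; first by under eq_fun do rewrite big_nil; exact: integ_cst.
  by under eq_Rintegral do rewrite big_nil; rewrite big_nil Rint_cst.
have hi : integ P (f i) by apply: h; rewrite mem_head.
have [I1 E1] : integ P (fun x => \sum_(i <- s) f i x) /\
  \int[P]_x (\sum_(i <- s) f i x) = \sum_(i <- s) \int[P]_x f i x.
  by apply: IH => j js; apply: h; rewrite inE js orbT.
split; first by under eq_fun do rewrite big_cons; exact: integD.
by under eq_Rintegral do rewrite big_cons; rewrite big_cons -E1 RintegralD.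
Qed.

Lemma indep_bigcap (J : {fset I}) (A : I -> set W) : (forall j, j \in J -> F j (A j)) ->
  Pr (\bigcap_(j in [set` J]) A j) = \prod_(j <- J) Pr (A j).
Proof.
move=> FA; have mA j : j \in J -> measurable (A j) by move=> /FA; exact: mF.
rewrite /Pr indep // big_seq [in RHS]big_seq.
suff -> : (\prod_(j <- J | j \in J) P (A j))%E = (\prod_(j <- J | j \in J) fine (P (A j)))%:E by [].
elim/big_rec2: _ => // j x y /mA mAj ->.
by rewrite EFinM fineK //; exact: fin_num_measure.
Qed.

(** Independence for products of linear combinations of indicators. The factor of
    each index l of L is expanded, and its event joins the family A over J. *)
Lemma indep_prod (J : {fset I}) (A : I -> set W) (Q : seq (R * (I -> set W))) (L : seq I) :
  (forall j, j \in J -> F j (A j)) -> uniq L -> (forall l, l \in L -> l \notin J) ->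
  (forall l q, l \in L -> q \in Q -> F l (q.2 l)) ->
  \int[P]_w (\1_(\bigcap_(j in [set` J]) A j) w * \prod_(l <- L) \sum_(q <- Q) q.1 * \1_(q.2 l) w) =
  \prod_(j <- J) Pr (A j) * \prod_(l <- L) \sum_(q <- Q) q.1 * Pr (q.2 l).
Proof.
have mcap (J' : {fset I}) (A' : I -> set W) : (forall j, j \in J' -> F j (A' j)) ->
    measurable (\bigcap_(j in [set` J']) A' j).
  by move=> FA; apply: fin_bigcap_measurable => // j jJ; apply: mF; exact: FA.
elim: L J A => [|l L IH] J A FA /= uL LJ LQ.
  rewrite big_nil mulr1; under eq_Rintegral do rewrite big_nil mulr1.
  by rewrite Rint_indic ?indep_bigcap //; exact: mcap.
case/andP: uL => lL uL.
pose A' (q : R * (I -> set W)) j := if j == l then q.2 l else A j.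
have lJ : l \notin J by apply: LJ; rewrite mem_head.
have AA' q j : j \in J -> A' q j = A j.
  by rewrite /A'; case: eqP => // ->; rewrite (negbTE lJ).
have FA' q : q \in Q -> forall j, j \in (l |` J)%fset -> F j (A' q j).
  move=> qQ j; rewrite in_fset1U /A'; case: eqP => [->|_ /= jJ]; last exact: FA.
  by move=> _; apply: LQ; rewrite ?mem_head.
have E q w : \1_(\bigcap_(j in [set` J]) A j) w * \1_(q.2 l) w =
    \1_(\bigcap_(j in [set` (l |` J)%fset]) A' q j) w :> R.
  rewrite -[LHS]/((\1_(\bigcap_(j in [set` J]) A j) \* \1_(q.2 l)) w) -indicI.
  congr (\1_ _ w); apply/seteqP; split=> [v [h1 h2] j /=|v h].
    rewrite in_fset1U; case/orP => [/eqP ->|jJ]; first by rewrite /A' eqxx.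
    by rewrite AA' //; exact: h1.
  split=> [j jJ|].
    by rewrite -(AA' q j jJ); apply: (h j); rewrite /= in_fset1U jJ orbT.
  by have := h l; rewrite /= in_fset1U eqxx /A' eqxx; apply.
transitivity (\int[P]_w (\sum_(q <- Q) q.1 * (\1_(\bigcap_(j in [set` (l |` J)%fset]) A' q j) w
   * \prod_(l <- L) \sum_(q <- Q) q.1 * \1_(q.2 l) w))).
  apply: eq_Rintegral => w _; rewrite big_cons mulrA big_distrr big_distrl /=.
  apply: eq_bigr => q _; rewrite -E.
  by ring.
have I0 q : q \in Q -> integ P (fun w => \1_(\bigcap_(j in [set` (l |` J)%fset]) A' q j) w
   * \prod_(l <- L) \sum_(q <- Q) q.1 * \1_(q.2 l) w).
  move=> qQ; apply: (integ_le (g := fun=> \prod_(l <- L) \sum_(q <- Q) `|q.1|)).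
  - apply: measurable_funM; first exact/measurable_indic/mcap/FA'.
    apply: measurable_prod => i iL; apply: measurable_sum_seq => q' q'Q.
    apply: measurable_funM => //; apply: measurable_indic; apply: mF.
    by apply: LQ; rewrite // inE iL orbT.
  - move=> w; rewrite normrM -[leRHS]mul1r; apply: ler_pM => //.
      by rewrite ger0_norm indicE // lern1 leq_b1.
    rewrite normr_prod; apply: ler_prod => i _; rewrite normr_ge0 /=.
    apply: (le_trans (ler_norm_sum _ _ _)); apply: ler_sum => q' _.
    rewrite normrM -[leRHS]mulr1; apply: ler_wpM2l => //.
    by rewrite ger0_norm indicE // lern1 leq_b1.
  - exact: integ_cst.
have [_ ->] : integ P (fun w => \sum_(q <- Q) q.1 * (\1_(\bigcap_(j in [set` (l |` J)%fset]) A' q j) w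
   * \prod_(l <- L) \sum_(q <- Q) q.1 * \1_(q.2 l) w)) /\ _ :=
  @Rint_sum_seq _ Q _ (fun q qQ => integZ q.1 (I0 q qQ)).
rewrite big_cons mulrA [X in _ = X * _]big_distrr [RHS]big_distrl /=.
rewrite big_seq [RHS]big_seq; apply: eq_bigr => q qQ.
rewrite RintegralZl //; last exact: I0.
rewrite IH //; last 3 first.
- exact: FA'.
- move=> l' l'L; rewrite in_fset1U negb_or; apply/andP; split.
    by apply: contraNneq lL => <-.
  by apply: LJ; rewrite inE l'L orbT.
- by move=> l' q' l'L; apply: LQ; rewrite inE l'L orbT.
have -> : \prod_(j <- (l |` J)%fset) Pr (A' q j) = Pr (q.2 l) * \prod_(j <- J) Pr (A j).
  rewrite big_fsetU1 //= /A' eqxx; congr (_ * _); rewrite big_seq [RHS]big_seq.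
  by apply: eq_bigr => j jJ; case: eqP => // jl; rewrite -jl jJ in lJ.
by ring.
Qed.
End independence.

(** * Joint generating function of the walkers at two times *)

(** Increasing finite sets that exhaust the countable type, so that sums over it
    become limits of sequences. *)
Definition enum_upto (T : countType) (n : nat) : seq T := pmap (@choice.pickle_inv T) (iota 0 n).

Lemma enum_upto_uniq (T : countType) n : uniq (enum_upto T n).
Proof. by apply: (pmap_uniq (@choice.pickle_invK T)); exact: iota_uniq. Qed.

Lemma enum_upto_sub (T : countType) (G : seq T) :
  exists N, forall n, (N <= n)%N -> {subset G <= enum_upto T n}.
Proof.
exists (\max_(x <- G) (@choice.pickle T x).+1) => n Nn x xG.
rewrite mem_pmap; apply/mapP; exists (@choice.pickle T x); last by rewrite choice.pickleK_inv.
rewrite mem_iota add0n /=; apply: leq_trans Nn.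
exact: (@leq_bigmax_seq _ G xpredT (fun x => (@choice.pickle T x).+1)).
Qed.

Section walkers.
Context (R : realType) (d : nat) (p : Zd d -> Zd d -> R) (hp : jump_kernel p)
  (rho : R) (rho0 : 0 < rho) (nu : probability (config d) R) (hnu : poisson_product rho nu)
  (dW : measure_display) (W : measurableType dW) (P : probability W R)
  (eta : R -> W -> config d)
  (meta : forall t, 0 <= t -> measurable_fun setT (eta t))
  (law0 : forall A, measurable A -> P (eta 0 @^-1` A) = nu A)
  (X : (Zd d * nat)%type -> R -> W -> Zd d)
  (hX : forall l, walk_from p P l.1 (X l))
  (indep : mutually_independent P (walkers_sigma (eta 0) X)).

Let Pr (A : set W) : R := fine (P A).

Lemma measurable_walk l t z : 0 <= t -> measurable (X l t @^-1` [set z]).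
Proof. by move=> t0; have [h _] := hX l; exact: h. Qed.

Lemma walkers_sigma_measurable o A : walkers_sigma (eta 0) X o A -> measurable A.
Proof.
case: o => [l|] /=; last by move=> [B mB <-]; exact: meta.
move: A; apply: smallest_sub; first exact: sigma_algebra_measurable.
by move=> _ [t [z [t0 ->]]]; exact: measurable_walk.
Qed.

Lemma Pr_walk1 l t z : 0 <= t -> Pr (X l t @^-1` [set z]) = ptrans p t l.1 z.
Proof.
move=> t0; have [_ /(_ [:: (t, z)])] := hX l; rewrite /= t0 => /(_ isT).
rewrite subr0 mulr1 => E; transitivity (fine (ptrans p t l.1 z)%:E) => //; rewrite -E.
congr (fine (P _)); apply/seteqP; split=> w /=.
  by move=> <- tz; rewrite inE => /eqP ->.
by move=> /(_ (t, z)); apply; rewrite inE.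
Qed.

Lemma Pr_walk2 l s t a b : 0 <= s -> s <= t ->
  Pr (X l s @^-1` [set a] `&` X l t @^-1` [set b]) = ptrans p s l.1 a * ptrans p (t - s) a b.
Proof.
move=> s0 st; have [_ /(_ [:: (s, a); (t, b)])] := hX l; rewrite /= s0 st => /(_ isT).
rewrite subr0 mulr1 => E.
transitivity (fine (ptrans p s l.1 a * ptrans p (t - s) a b)%:E) => //; rewrite -E.
congr (fine (P _)); apply/seteqP; split=> w /=.
  by move=> [<- <-] tz; rewrite !inE => /orP[/eqP ->|/eqP ->].
move=> h; split; first by apply: (h (s, a)); rewrite !inE eqxx.
by apply: (h (t, b)); rewrite !inE eqxx orbT.
Qed.

(** A walk is at one place only, so the product has at most one nontrivial factor. *)
Lemma prod_site (T : eqType) (A : seq T) (U : T -> R) x : uniq A ->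
  1 - \sum_(a <- A) U a * (x == a)%:R = \prod_(a <- A) (1 - U a) ^+ (x == a).
Proof.
elim: A => [|a A IH] /= => [_|/andP[aA uA]]; first by rewrite !big_nil subr0.
rewrite !big_cons -IH //; case: eqP => [xa|_]; last by rewrite mulr0 add0r mul1r.
rewrite [\sum_(_ <- A) _]big_seq big1; first by rewrite /=; ring.
by move=> b bA; case: eqP => [xb|]; rewrite ?mulr0 //; rewrite -xa xb bA in aA.
Qed.

Context (s t : R) (s0 : 0 <= s) (st : s <= t) (A B : seq (Zd d)) (uA : uniq A) (uB : uniq B)
  (U V : Zd d -> R) (U01 : forall a, 0 <= U a <= 1) (V01 : forall b, 0 <= V b <= 1).

Let t0 : 0 <= t. Proof. exact: le_trans st. Qed.

(** The index is an option because None stands for the initial configuration in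
    [walkers_sigma]. *)
Let ev (r : R) (a : Zd d) (o : option (Zd d * nat)) : set W :=
  if o is Some l then X l r @^-1` [set a] else setT.

(** The factor of one particle,
    (1 - sum_a U_a 1[at a at time s]) (1 - sum_b V_b 1[at b at time t]), as a linear
    combination of indicators of events of its walk. *)
Let Q : seq (R * (option (Zd d * nat) -> set W)) :=
  (1, fun=> setT) :: [seq (- U a, ev s a) | a <- A] ++ [seq (- V b, ev t b) | b <- B]
   ++ [seq (U a * V b, fun o => ev s a o `&` ev t b o) | a <- A, b <- B].

Let theta l w : R := \sum_(q <- Q) q.1 * \1_(q.2 (Some l)) w.

(** Expectation of theta for a particle that starts at z. *)
Let wz (z : Zd d) : R := 1 - \sum_(a <- A) U a * ptrans p s z a - \sum_(b <- B) V b * ptrans p t z b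
  + \sum_(a <- A) \sum_(b <- B) U a * V b * (ptrans p s z a * ptrans p (t - s) a b).

Lemma Q_sum (F : set W -> R) l : \sum_(q <- Q) q.1 * F (q.2 (Some l)) =
  F setT - \sum_(a <- A) U a * F (X l s @^-1` [set a]) - \sum_(b <- B) V b * F (X l t @^-1` [set b])
  + \sum_(a <- A) \sum_(b <- B) U a * V b * F (X l s @^-1` [set a] `&` X l t @^-1` [set b]).
Proof.
rewrite big_cons !big_cat !big_map big_allpairs_dep /= mul1r.
have E (C : seq (Zd d)) (G H : Zd d -> R) : \sum_(i <- C) - G i * H i = - \sum_(i <- C) G i * H i.
  by rewrite -sumrN; apply: eq_bigr => i _; rewrite mulNr.
by rewrite !E !addrA.
Qed.

Lemma wzE l : \sum_(q <- Q) q.1 * Pr (q.2 (Some l)) = wz l.1.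
Proof.
rewrite Q_sum /wz; congr (_ - _ - _ + _).
- by rewrite /Pr probability_setT.
- by apply: eq_bigr => a _; rewrite Pr_walk1.
- by apply: eq_bigr => a _; rewrite Pr_walk1.
- by apply: eq_bigr => a _; apply: eq_bigr => b _; rewrite Pr_walk2.
Qed.

Lemma thetaE l w : theta l w =
  \prod_(a <- A) (1 - U a) ^+ (X l s w == a) * \prod_(b <- B) (1 - V b) ^+ (X l t w == b).
Proof.
rewrite -!prod_site // /theta (Q_sum (fun E => \1_E w)) indicT.
have ind r a : \1_(X l r @^-1` [set a]) w = (X l r w == a)%:R :> R.
  by rewrite indicE; congr (_%:R); congr nat_of_bool; apply/idP/eqP; rewrite inE.
have -> : \sum_(a <- A) \sum_(b <- B) U a * V b * \1_(X l s @^-1` [set a] `&` X l t @^-1` [set b]) w =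
   (\sum_(a <- A) U a * (X l s w == a)%:R) * (\sum_(b <- B) V b * (X l t w == b)%:R).
  rewrite big_distrl; apply: eq_bigr => a _; rewrite big_distrr; apply: eq_bigr => b _ /=.
  by rewrite indicI /= !ind; ring.
have -> : \sum_(a <- A) U a * \1_(X l s @^-1` [set a]) w = \sum_(a <- A) U a * (X l s w == a)%:R.
  by apply: eq_bigr => a _; rewrite ind.
have -> : \sum_(b <- B) V b * \1_(X l t @^-1` [set b]) w = \sum_(b <- B) V b * (X l t w == b)%:R.
  by apply: eq_bigr => b _; rewrite ind.
by rewrite /=; ring.
Qed.

Lemma theta01 l w : 0 <= theta l w <= 1.
Proof.
rewrite thetaE.
have h (C : seq (Zd d)) (G : Zd d -> R) x : (forall a, 0 <= G a <= 1) ->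
    0 <= \prod_(a <- C) (1 - G a) ^+ (x == a) <= 1.
  move=> G01; have g a : 0 <= (1 - G a) ^+ (x == a) <= 1.
    by have /andP[g0 g1] := G01 a; case: eqP => _ /=; rewrite ?ler01 ?lexx //; lra.
  apply/andP; split; first by apply: prodr_ge0 => a _; have /andP[] := g a.
  by apply: prodr_ile1 => a _; exact: g.
have /andP[a0 a1] := h A U (X l s w) U01; have /andP[b0 b1] := h B V (X l t w) V01.
by rewrite mulr_ge0 // -[leRHS]mulr1 ler_pM.
Qed.

Lemma sigma_Q l q : q \in Q -> walkers_sigma (eta 0) X (Some l) (q.2 (Some l)).
Proof.
pose G : set (set W) := [set A | exists t z, 0 <= t /\ A = X l t @^-1` [set z]].
have gen r z : 0 <= r -> @measurable _ (g_sigma_algebraType G) (X l r @^-1` [set z]).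
  by move=> r0; apply: sub_sigma_algebra; exists r, z.
rewrite inE !mem_cat => /orP[/eqP ->|/or3P[/mapP[a _ ->]|/mapP[b _ ->]|/allpairsP[[a b] /= [_ _ ->]]]] /=.
- exact: (@measurableT _ (g_sigma_algebraType G)).
- exact: gen.
- exact: gen.
- exact: (@measurableI _ (g_sigma_algebraType G) _ _ (gen _ _ s0) (gen _ _ t0)).
Qed.

Lemma measurable_theta l : measurable_fun setT (theta l).
Proof.
apply: measurable_sum_seq => q qQ; apply: measurable_funM => //.
by apply: measurable_indic; exact: walkers_sigma_measurable (sigma_Q qQ).
Qed.

Let labels (F : seq (Zd d)) (n : Zd d -> nat) : seq (Zd d * nat) :=
  [seq (z, m) | z <- F, m <- iota 0 (n z)].

Lemma labels_uniq F n : uniq F -> uniq (labels F n).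
Proof.
move=> uF; apply: allpairs_uniq_dep => // [x _|[a x] [b y] _ _ /= [-> ->] //].
exact: iota_uniq.
Qed.

Lemma config_list_measurable (F : seq (Zd d)) (c : seq nat) :
  measurable [set e : config d | [seq e z | z <- F] = c].
Proof.
elim: F c => [|z F IH] [|k c] /=.
- by rewrite (_ : [set _ | _] = setT) //; apply/seteqP.
- by rewrite (_ : [set _ | _] = set0) //; apply/seteqP; split=> // x.
- by rewrite (_ : [set _ | _] = set0) //; apply/seteqP; split=> // x.
- rewrite (_ : [set _ | _] = [set e : config d | e z = k] `&` [set e | [seq e z | z <- F] = c]).
    by apply: measurableI => //; exact: measurable_cyl1.
  by apply/seteqP; split=> e /= [-> ->].
Qed.

Lemma wz_ge0 z : 0 <= wz z.
Proof.
rewrite -(wzE (z, 0%N)).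
have mE q : q \in Q -> measurable (q.2 (Some (z, 0%N))).
  by move=> qQ; exact: walkers_sigma_measurable (sigma_Q qQ).
have [_ E] := Rint_sum_seq (P := P) (s := Q) (f := fun q w => q.1 * \1_(q.2 (Some (z, 0%N))) w)
  (fun q qQ => integZ q.1 (integ_indic P (mE q qQ))).
rewrite big_seq; rewrite big_seq in E.
rewrite (eq_bigr (fun q => \int[P]_w (q.1 * \1_(q.2 (Some (z, 0%N))) w))); last first.
  move=> q qQ; rewrite RintegralZl //; last exact: (integ_indic P (mE _ qQ)).
  by rewrite Rint_indic //; exact: mE.
rewrite -E; apply: Rintegral_ge0 => w _.
by have /andP[] := theta01 (z, 0%N) w.
Qed.

(** Given the initial configuration on F, the theta of its particles are
    independent with mean wz, so the expectation is a Poisson generating function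
    evaluated at wz. *)
Lemma fiber_integral (F : seq (Zd d)) : uniq F ->
  measurable_fun setT (fun w => \prod_(l <- labels F (eta 0 w)) theta l w) /\
  \int[P]_w (\prod_(l <- labels F (eta 0 w)) theta l w) = \prod_(z <- F) expR (rho * (wz z - 1)).
Proof.
move=> uF.
pose g w : R := \prod_(z <- F) wz z ^+ eta 0 w z.
pose o w := [seq eta 0 w z | z <- F].
have nuF := nu_pgf rho0 hnu wz_ge0 uF.
have mg0 : measurable_fun setT (fun e : config d => \prod_(z <- F) wz z ^+ e z) by exact: integ_measurable nuF.1.
have <- : \int[P]_w g w = \prod_(z <- F) expR (rho * (wz z - 1)).
  by rewrite -nuF.2 -(Rint_law (meta (lexx 0)) law0 mg0).
have mg : measurable_fun setT g by exact: measurableT_comp mg0 (meta (lexx 0)).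
pose n (c : seq nat) z := nth 0%N c (index z F).
pose C c := [set w | o w = c].
have CE c : C c = eta 0 @^-1` [set e : config d | [seq e z | z <- F] = c] by [].
have mC c : measurable (C c).
  by rewrite CE -[X in measurable X]setTI; exact: (meta (lexx 0) measurableT (config_list_measurable F c)).
have oC w c : (o w == c)%:R = \1_(C c) w :> R.
  by rewrite indicE; congr (nat_of_bool _)%:R; apply/eqP/idP; rewrite inE.
have nE w z : z \in F -> eta 0 w z = n (o w) z.
  by move=> zF; rewrite /n (nth_map 0) ?index_mem // nth_index.
have fE w c : (\prod_(l <- labels F (eta 0 w)) theta l w) * (o w == c)%:R =
    \1_(C c) w * \prod_(l <- labels F (n c)) theta l w.
  rewrite oC mulrC indicE; case: (boolP (w \in C c)); rewrite ?mul0r // inE => <-.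
  congr (_ * _); congr (\prod_(l <- _) _); rewrite /labels.
  by congr flatten; apply/eq_in_map => z zF; rewrite nE.
have gE w c : g w * (o w == c)%:R = \prod_(z <- F) wz z ^+ n c z * \1_(C c) w.
  rewrite oC indicE; case: (boolP (w \in C c)); rewrite ?mulr0 // inE => <-.
  congr (_ * _); rewrite /g big_seq [RHS]big_seq; apply: eq_bigr => z zF.
  by rewrite nE.
have mf c : measurable_fun setT (fun w => \1_(C c) w * \prod_(l <- labels F (n c)) theta l w).
  apply: measurable_funM; first exact: measurable_indic.
  by apply: measurable_prod => l _; exact: measurable_theta.
have := @integral_partition _ _ _ P _ o (fun w => \prod_(l <- labels F (eta 0 w)) theta l w) g.
case=> [w|w|c|c|c|mff E].
- by apply: prodr_ge0 => l _; have /andP[] := theta01 l w.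
- by apply: prodr_ge0 => z _; rewrite exprn_ge0 // wz_ge0.
- by have -> : (fun w => (\prod_(l <- labels F (eta 0 w)) theta l w) * (o w == c)%:R) =
      (fun w => \1_(C c) w * \prod_(l <- labels F (n c)) theta l w) by apply/funext => w; exact: fE.
- have -> : (fun w => g w * (o w == c)%:R) = fun w => \prod_(z <- F) wz z ^+ n c z * \1_(C c) w.
    by apply/funext => w; exact: gE.
  by apply: measurable_funM => //; exact: measurable_indic.
- under eq_integral do rewrite fE; under [RHS]eq_integral do rewrite gE.
  have If : integ P (fun w => \1_(C c) w * \prod_(l <- labels F (n c)) theta l w).
    apply: (integ_le (g := fun=> 1)) => // [w|]; last exact: integ_cst.
    rewrite ger0_norm; last first.
      by rewrite mulr_ge0 ?indicE // prodr_ge0 // => l _; have /andP[] := theta01 l w.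
    rewrite -[leRHS]mulr1; apply: ler_pM; rewrite ?indicE ?lern1 ?leq_b1 //.
      by rewrite prodr_ge0 // => l _; have /andP[] := theta01 l w.
    by apply: prodr_ile1 => l _; exact: theta01.
  have Ig : integ P (fun w => \prod_(z <- F) wz z ^+ n c z * \1_(C c) w).
    by apply: integZ; exact: integ_indic.
  rewrite -[LHS]fineK; last exact: integrable_fin_num If.
  rewrite -[RHS]fineK; last exact: integrable_fin_num Ig.
  suff RE : \int[P]_w (\1_(C c) w * \prod_(l <- labels F (n c)) theta l w) =
     \int[P]_w (\prod_(z <- F) wz z ^+ n c z * \1_(C c) w) by congr (_%:E).
  rewrite RintegralZl //; last exact: integ_indic.
  rewrite Rint_indic //.
  have := @indep_prod _ _ _ P _ (walkers_sigma (eta 0) X) indep walkers_sigma_measurable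
    [fset None]%fset (fun=> C c) Q (map Some (labels F (n c))).
  rewrite big_seq_fset1 big_map /=.
  have -> : \bigcap_(j in [set` [fset (None : option (Zd d * nat))]%fset]) C c = C c.
    apply/seteqP; split=> w /= h; first by apply: (h None); rewrite /= inE.
    by move=> j _.
  under eq_Rintegral do rewrite big_map.
  move=> -> //.
  + rewrite mulrC; congr (_ * _).
    under eq_bigr do rewrite wzE; rewrite big_allpairs_dep /=; apply: eq_bigr => z _.
    by rewrite big_const_seq count_predT size_iota iter_mulr_1.
  + move=> j; rewrite inE => /eqP -> /=.
    by exists [set e : config d | [seq e z | z <- F] = c]; [exact: config_list_measurable|rewrite setTI].
  + by rewrite map_inj_uniq ?labels_uniq // => x y [].
  + by move=> l /mapP[l' _ ->]; rewrite inE.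
  + by move=> l q /mapP[l' _ ->]; exact: sigma_Q.
- by split=> //; rewrite /Rintegral E.
Qed.

Context (hcount : forall t, 0 <= t -> {ae P, forall w, forall x : Zd d,
  ([set l : (Zd d * nat)%type | (l.2 < eta 0%R w l.1)%N /\ X l t w = x] #= `I_(eta t w x))%card}).

Lemma count_labels r w a (F : seq (Zd d)) :
  ([set l : (Zd d * nat)%type | (l.2 < eta 0%R w l.1)%N /\ X l r w = a] #= `I_(eta r w a))%card ->
  uniq F ->
  {subset [seq l.1 | l <- fset_set [set l : (Zd d * nat)%type | (l.2 < eta 0%R w l.1)%N /\ X l r w = a]] <= F} ->
  (\sum_(l <- labels F (eta 0 w)) (X l r w == a))%N = eta r w a.
Proof.
move=> cardS uF sF.
have fS : finite_set [set l : (Zd d * nat)%type | (l.2 < eta 0%R w l.1)%N /\ X l r w = a].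
  by apply/finite_setP; exists (eta r w a).
rewrite -(card_fset_set cardS).
rewrite -[LHS]big_mkcond /= sum1_count -size_filter.
rewrite (perm_size (s2 := enum_fset (fset_set [set l : (Zd d * nat)%type | (l.2 < eta 0%R w l.1)%N /\ X l r w = a]))) //.
apply: uniq_perm; rewrite ?fset_uniq ?filter_uniq ?labels_uniq // => l.
rewrite mem_filter in_fset_set //; apply/andP/idP.
  move=> [/eqP Xl /allpairsPdep[z [m [zF mz lE]]]]; rewrite inE /=; split=> //.
  by rewrite lE /=; rewrite mem_iota add0n in mz.
move=> lS; have := lS; rewrite inE => /= -[l2 Xl]; split; first exact/eqP.
apply/allpairsPdep; exists l.1, l.2; split; last by case: (l).
  by apply: sF; apply: map_f; rewrite in_fset_set.
by rewrite mem_iota add0n.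
Qed.

(** Almost surely the particles that sit in A at time s or in B at time t are
    finitely many; once F contains their starting points, the product of all theta
    counts them. *)
Lemma theta_labels w :
  (forall x : Zd d, ([set l : (Zd d * nat)%type | (l.2 < eta 0%R w l.1)%N /\ X l s w = x] #= `I_(eta s w x))%card) ->
  (forall x : Zd d, ([set l : (Zd d * nat)%type | (l.2 < eta 0%R w l.1)%N /\ X l t w = x] #= `I_(eta t w x))%card) ->
  exists G : seq (Zd d), forall F, uniq F -> {subset G <= F} ->
  \prod_(l <- labels F (eta 0 w)) theta l w =
  \prod_(a <- A) (1 - U a) ^+ eta s w a * \prod_(b <- B) (1 - V b) ^+ eta t w b.
Proof.
move=> cs ct.
pose S r a := [set l : (Zd d * nat)%type | (l.2 < eta 0%R w l.1)%N /\ X l r w = a].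
pose gs r a := [seq l.1 | l <- enum_fset (fset_set (S r a))].
exists (flatten [seq gs s a | a <- A] ++ flatten [seq gs t b | b <- B]) => F uF sF.
under eq_bigr do rewrite thetaE.
rewrite big_split /= exchange_big [X in _ * X]exchange_big /=; congr (_ * _).
- rewrite big_seq [RHS]big_seq; apply: eq_bigr => a aA.
  rewrite prodrXr (count_labels (cs a)) // => z zS; apply: sF.
  by rewrite mem_cat; apply/orP; left; apply/flattenP; exists (gs s a) => //; exact: map_f.
- rewrite big_seq [RHS]big_seq; apply: eq_bigr => b bB.
  rewrite prodrXr (count_labels (ct b)) // => z zS; apply: sF.
  by rewrite mem_cat; apply/orP; right; apply/flattenP; exists (gs t b) => //; exact: map_f.
Qed.

Lemma ptrans_enum_cvg r a : 0 <= r ->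
  \sum_(z <- enum_upto (Zd d) n) ptrans p r z a @[n --> \oo] --> (1 : R).
Proof.
move=> r0; apply/cvgrPdist_le => e e0.
have [F0 hF0] := ptrans_suml_tight hp a r0 e0.
have [N hN] := enum_upto_sub F0.
exists N => // n /= Nn.
have := hF0 _ (enum_upto_uniq _ n) (hN n Nn).
have := ptrans_sum_lel hp a r0 (enum_upto_uniq (Zd d) n).
by move=> h1 h2; rewrite ger0_norm; lra.
Qed.

(** The transition probabilities into a point add up to 1 over the starting points,
    and the product terms leave a transition of duration t - s. *)
Lemma sum_wz_cvg : \sum_(z <- enum_upto (Zd d) n) (1 - wz z) @[n --> \oo] -->
  \sum_(a <- A) U a + \sum_(b <- B) V b -
    \sum_(a <- A) \sum_(b <- B) U a * V b * ptrans p (t - s) a b.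
Proof.
have -> : (fun n => \sum_(z <- enum_upto (Zd d) n) (1 - wz z)) = (fun n =>
    \sum_(a <- A) U a * (\sum_(z <- enum_upto (Zd d) n) ptrans p s z a)
    + \sum_(b <- B) V b * (\sum_(z <- enum_upto (Zd d) n) ptrans p t z b)
    - \sum_(a <- A) \sum_(b <- B) U a * V b * ptrans p (t - s) a b *
        (\sum_(z <- enum_upto (Zd d) n) ptrans p s z a)).
  apply/funext => n; rewrite /wz.
  have -> : \sum_(z <- enum_upto (Zd d) n) (1 - wz z) =
     \sum_(z <- enum_upto (Zd d) n) ((\sum_(a <- A) U a * ptrans p s z a +
       \sum_(b <- B) V b * ptrans p t z b)
       - \sum_(a <- A) \sum_(b <- B) U a * V b * (ptrans p s z a * ptrans p (t - s) a b)).
    by apply: eq_bigr => z _; rewrite /wz; ring.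
  rewrite sumrB big_split /=; congr (_ + _ - _).
  - by rewrite exchange_big; apply: eq_bigr => a _; rewrite big_distrr.
  - by rewrite exchange_big; apply: eq_bigr => a _; rewrite big_distrr.
  - rewrite exchange_big; apply: eq_bigr => a _; rewrite exchange_big.
    by apply: eq_bigr => b _; rewrite big_distrr; apply: eq_bigr => z _ /=; ring.
apply: cvgB; first apply: cvgD.
- apply: cvg_sumr => a; rewrite -[X in _ --> X]mulr1; apply: cvgMr; exact: ptrans_enum_cvg.
- apply: cvg_sumr => a; rewrite -[X in _ --> X]mulr1; apply: cvgMr; exact: ptrans_enum_cvg.
- apply: cvg_sumr => a; apply: cvg_sumr => b; rewrite -[X in _ --> X]mulr1; apply: cvgMr.
  exact: ptrans_enum_cvg.
Qed.

(** The particles starting in F give exp(- rho sum_{z in F} (1 - wz z)); F increases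
    to Zd and the products are bounded by 1. *)
Lemma walkers_pgf :
  \int[P]_w (\prod_(a <- A) (1 - U a) ^+ eta s w a * \prod_(b <- B) (1 - V b) ^+ eta t w b) =
  expR (- (rho * (\sum_(a <- A) U a + \sum_(b <- B) V b -
    \sum_(a <- A) \sum_(b <- B) U a * V b * ptrans p (t - s) a b))).
Proof.
pose f_ n w : R := \prod_(l <- labels (enum_upto (Zd d) n) (eta 0 w)) theta l w.
have mcoord r x (F : nat -> R) : 0 <= r -> measurable_fun setT (fun w => F (eta r w x)).
  move=> r0; apply: (measurableT_comp (measurable_nat F)).
  exact: (measurableT_comp (measurable_coord x) (meta r0)).
have [|||||_ cv] := @Rint_dominated _ _ _ P f_ (fun w => \prod_(a <- A) (1 - U a) ^+ eta s w a * \prod_(b <- B) (1 - V b) ^+ eta t w b) (fun=> 1).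
- by move=> n; have [] := fiber_integral (enum_upto_uniq (Zd d) n).
- apply: measurable_funM; apply: measurable_prod => a _.
    exact: (mcoord s a (fun k => (1 - U a) ^+ k)).
  exact: (mcoord t a (fun k => (1 - V a) ^+ k)).
- near=> w; have cs : forall x : Zd d, ([set l : (Zd d * nat)%type | (l.2 < eta 0%R w l.1)%N /\ X l s w = x] #= `I_(eta s w x))%card.
    by near: w; exact: hcount.
  have ct : forall x : Zd d, ([set l : (Zd d * nat)%type | (l.2 < eta 0%R w l.1)%N /\ X l t w = x] #= `I_(eta t w x))%card.
    by near: w; exact: hcount.
  have [G hG] := theta_labels cs ct; have [N hN] := enum_upto_sub G.
  apply: cvg_near_cst; exists N => // n /= Nn.
  by apply: hG; [exact: enum_upto_uniq|exact: hN].
- exact: integ_cst.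
- move=> n w; rewrite ger0_norm; last by apply: prodr_ge0 => l _; have /andP[] := theta01 l w.
  by apply: prodr_ile1 => l _; exact: theta01.
apply: cvg_unique cv _ => //.
have -> : (fun n => \int[P]_x f_ n x) = (fun n => expR (- (rho * \sum_(z <- enum_upto (Zd d) n) (1 - wz z)))).
  apply/funext => n; have [_ ->] := fiber_integral (enum_upto_uniq (Zd d) n).
  rewrite -expR_sum; congr expR; rewrite big_distrr -sumrN /=.
  by apply: eq_bigr => z _; ring.
apply: continuous_cvg; first exact: continuous_expR.
by apply: cvgN; apply: cvgMr; exact: sum_wz_cvg.
Unshelve. all: by end_near. Qed.

End walkers.

(** * Duality of the Charlier polynomials *)

Definition sqint (R : realType) (dT : measure_display) (T : measurableType dT)
   (P : probability T R) (f : T -> R) : Prop :=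
  measurable_fun setT f /\ integ P (fun x => f x ^+ 2).

Section sqint.
Context (R : realType) (dT : measure_display) (T : measurableType dT) (P : probability T R).
Implicit Types f g : T -> R.

(** Puts membership in L2 in the form of the real integrals used throughout. *)
Lemma sqint_Lfun f : f \in Lfun P 2%:E <-> sqint P f.
Proof.
split=> [h|[mf If]].
  split; first by move/sub_Lfun_mfun: h; rewrite inE.
  exact: Lfun2_integrable_sqr.
rewrite inE; apply/andP; split; first by rewrite inE.
rewrite inE /= /finite_norm unlock /Lnorm /= poweR_lty //.
have /integrableP[_] := If; apply: le_lt_trans.
apply: ge0_le_integral => //.
- apply/measurable_EFinP.
  apply: (@measurableT_comp _ _ _ _ _ _ (fun x : R => x `^ 2)) => //.
  exact: measurableT_comp.
- by apply: measurableT_comp => //; exact: measurable_int If.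
- by move=> x _ /=; rewrite lee_fin normrX powR_mulrn.
Qed.

Lemma sqint_mul f g : sqint P f -> sqint P g -> integ P (fun x => f x * g x).
Proof.
move=> [mf If] [mg Ig]; apply: (integ_le (g := fun x => f x ^+ 2 + g x ^+ 2)).
- exact: measurable_funM.
- move=> x; rewrite normrM -(real_normK (num_real (f x))) -(real_normK (num_real (g x))).
  by have := normr_ge0 (f x); have := normr_ge0 (g x); nra.
- exact: integD.
Qed.

Lemma sqintD f g : sqint P f -> sqint P g -> sqint P (fun x => f x + g x).
Proof.
move=> [mf If] [mg Ig]; split; first exact: measurable_funD.
apply: (integ_le (g := fun x => 2 * f x ^+ 2 + 2 * g x ^+ 2)).
- by apply: measurable_funX; exact: measurable_funD.
- by move=> x; rewrite ger0_norm ?sqr_ge0 //; have := sqr_ge0 (f x - g x); rewrite !expr2; lra.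
- by apply: integD; exact: integZ.
Qed.

Lemma sqintZ c f : sqint P f -> sqint P (fun x => c * f x).
Proof.
move=> [mf If]; split; first exact: measurable_funM.
by under eq_fun do rewrite exprMn; exact: integZ.
Qed.

Lemma sqint_cst c : sqint P (fun=> c).
Proof. by split; [exact: measurable_cst|exact: integ_cst]. Qed.

Lemma sqint_sum I (s : seq I) (f : I -> T -> R) : (forall i, sqint P (f i)) ->
  sqint P (fun x => \sum_(i <- s) f i x).
Proof.
move=> h; elim: s => [|i s IH].
  by under eq_fun do rewrite big_nil; exact: sqint_cst.
by under eq_fun do rewrite big_cons; exact: sqintD.
Qed.

Lemma sqint_le f g : measurable_fun setT f -> (forall x, `|f x| <= g x) -> sqint P g -> sqint P f.
Proof.
move=> mf fg [mg Ig]; split=> //; apply: integ_le Ig; first exact: measurable_funX.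
move=> x; rewrite normrX; apply: lerXn2r; rewrite ?nnegrE //.
by apply: le_trans (fg x).
Qed.

Lemma sqint_integ f : sqint P f -> integ P f.
Proof.
move=> hf; have := sqint_mul hf (sqint_cst 1).
by under eq_fun do rewrite mulr1.
Qed.

End sqint.

Section law_unique.
Context (R : realType) (d : nat) (rho : R) (nu : probability (config d) R)
  (hnu : poisson_product rho nu)
  (dT : measure_display) (T : measurableType dT) (P : probability T R) (o : T -> config d)
  (mo : measurable_fun setT o).

Lemma law_unique :
  (forall (F : {fset Zd d}) n, P (o @^-1` cyl F n) = (\prod_(x <- F) poisson_pmf rho (n x))%:E) ->
  forall A, measurable A -> P (o @^-1` A) = nu A.
Proof.
move=> h.
have mo' A : measurable A -> measurable (o @^-1` A).
  by move=> mA; rewrite -[X in measurable X]setTI; exact: mo.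
apply: config_dynkin.
- by rewrite preimage_setT !probability_setT.
- by move=> F n; rewrite h hnu.
- by rewrite preimage_set0 !measure0.
- move=> S mS e; rewrite preimage_setC !probability_setC //; last exact: mo'.
  by rewrite e.
- move=> F mF tF e; rewrite preimage_bigcup.
  have -> : nu (\bigcup_k F k) = (\sum_(i <oo) nu (F i))%E.
    by apply: measure_semi_bigcup => //; exact: bigcup_measurable.
  have -> : P (\bigcup_k (o @^-1` F k)) = (\sum_(i <oo) P (o @^-1` F i))%E.
    apply: measure_semi_bigcup => [i||].
    + exact: mo'.
    + move/trivIsetP : tF => tF; apply/trivIsetP => i j _ _ ij.
      by rewrite -preimage_setI tF ?preimage_set0.
    + by apply: bigcup_measurable => k _; exact: mo'.
  by apply: eq_eseriesr => i _; exact: e.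
Qed.
End law_unique.

(** D(xi, .) for the multiset xi of the points of X. Lists make the coupling of the
    points of two configurations a zip. *)
Definition dualL (R : realType) (d : nat) (rho : R) (X : seq (Zd d)) (e : config d) : R :=
  \prod_(x <- undup X) charlier rho (count_mem x X) (e x).

(** The squared norm of D. *)
Definition kappa (R : realType) (d : nat) (rho : R) (X : seq (Zd d)) : R :=
  \prod_(x <- undup X) ((count_mem x X)`!%:R / rho ^+ count_mem x X).

Lemma charlier0 (R : realType) (rho : R) m : charlier rho 0 m = 1.
Proof. by rewrite /charlier big_ord1 bin0 expr0 invr1 ffactn0 !mulr1. Qed.

Lemma prod_undup_count (R : comRingType) (T : eqType) (X : seq T) (F : T -> R) :
  \prod_(x <- X) F x = \prod_(x <- undup X) F x ^+ count_mem x X.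
Proof.
rewrite -[LHS]big_undup_iterop_count; apply: eq_bigr => x _.
by rewrite Monoid.iteropE iter_mulr_1.
Qed.

Lemma dualL_sup (R : realType) (d : nat) (rho : R) (X B : seq (Zd d)) (e : config d) :
  uniq B -> {subset X <= B} ->
  dualL rho X e = \prod_(b <- B) charlier rho (count_mem b X) (e b).
Proof.
move=> uB XB.
rewrite [RHS](bigID (mem X)) /= [X in _ = _ * X]big1 ?mulr1; last first.
  by move=> b /count_memPn ->; rewrite charlier0.
rewrite -big_filter; apply: perm_big; apply: uniq_perm; rewrite ?undup_uniq ?filter_uniq //.
move=> x; rewrite mem_undup mem_filter /=.
by case: (boolP (x \in X)) => // /XB ->.
Qed.

Lemma prod_words (R : comRingType) (T : Type) (X B : seq T) (q : T -> T -> R) (V : T -> R) :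
  \prod_(x <- X) \sum_(b <- B) V b * q x b =
  \sum_(Y <- words B (size X)) (\prod_(e <- zip X Y) q e.1 e.2) * \prod_(y <- Y) V y.
Proof.
elim: X => [|x X IH] /=; first by rewrite big_seq1 !big_nil mulr1.
rewrite big_cons IH big_allpairs_dep big_distrl /=; apply: eq_bigr => b _.
rewrite big_distrr /=; apply: eq_bigr => Y _.
by rewrite !big_cons /=; ring.
Qed.

Section duality.
Context (R : realType) (d : nat) (rho : R) (rho0 : 0 < rho) (nu : probability (config d) R)
  (hnu : poisson_product rho nu)
  (dW : measure_display) (W : measurableType dW) (P : probability W R).

Context (e1 e2 : W -> config d) (m1 : measurable_fun setT e1) (m2 : measurable_fun setT e2)
  (q : Zd d -> Zd d -> R)
  (law1 : forall A, measurable A -> P (e1 @^-1` A) = nu A)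
  (law2 : forall A, measurable A -> P (e2 @^-1` A) = nu A)
  (pgf : forall (A B : seq (Zd d)) (U V : Zd d -> R), uniq A -> uniq B ->
    (forall a, 0 <= U a <= 1) -> (forall b, 0 <= V b <= 1) ->
    \int[P]_w (\prod_(a <- A) (1 - U a) ^+ e1 w a * \prod_(b <- B) (1 - V b) ^+ e2 w b) =
    expR (- (rho * (\sum_(a <- A) U a + \sum_(b <- B) V b -
      \sum_(a <- A) \sum_(b <- B) U a * V b * q a b)))).

Let rn0 : rho != 0. Proof. by rewrite gt_eqF. Qed.

Lemma measurable_site (e : W -> config d) x (F : nat -> R) : measurable_fun setT e ->
  measurable_fun setT (fun w => F (e w x)).
Proof.
move=> me; apply: (measurableT_comp (measurable_nat F)).
exact: (measurableT_comp (measurable_coord x) me).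
Qed.

Lemma sqint_exp_nu (A : seq (Zd d)) (c : R) : 0 <= c -> uniq A ->
  sqint nu (fun e => \prod_(a <- A) c ^+ e a).
Proof.
move=> c0 uA; split.
  apply: measurable_prod => a _; apply: (measurableT_comp (measurable_nat (fun m => c ^+ m))).
  exact: measurable_coord.
have [I _] := @nu_pgf _ _ _ _ rho0 hnu A (fun=> c ^+ 2) (fun=> sqr_ge0 c) uA.
rewrite (_ : (fun x => _) = (fun e : config d => \prod_(a <- A) (c ^+ 2) ^+ e a)) //.
apply/funext => e; rewrite -prodrXl; apply: eq_bigr => a _.
by rewrite -!exprM mulnC.
Qed.

Lemma charlier_le k m : `|charlier rho k m| <= k`!%:R / rho ^+ k * (expR rho * 2 ^+ m).
Proof.
have kk : (k`!%:R : R) != 0 by rewrite pnatr_eq0 -lt0n fact_gt0.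
have rk : rho ^+ k != 0 by rewrite expf_neq0.
have -> : charlier rho k m = k`!%:R / rho ^+ k * charlier_coef rho k m.
  by rewrite /charlier_coef; field; apply/andP.
have r0' : 0 <= k`!%:R / rho ^+ k by rewrite divr_ge0 // exprn_ge0 // ltW.
by rewrite normrM ger0_norm //; apply: ler_wpM2l => //; apply: (psic_le (charlier_expansion rho0)).
Qed.

Lemma sqint_charlier_majorant (A : seq (Zd d)) : uniq A ->
  sqint nu (fun e => \prod_(a <- A) (expR rho * 2 ^+ e a)).
Proof.
move=> uA; rewrite (_ : (fun e => _) = (fun e : config d => (\prod_(a <- A) expR rho) *
    (\prod_(a <- A) 2 ^+ e a))); last by apply/funext => e; rewrite big_split.
by apply: sqintZ; exact: sqint_exp_nu.
Qed.

Lemma measurable_dualL X : measurable_fun setT (dualL rho X : config d -> R).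
Proof.
apply: measurable_prod => x _.
exact: (measurableT_comp (measurable_nat (charlier rho (count_mem x X))) (measurable_coord x)).
Qed.

Lemma sqint_dualL X : sqint nu (dualL rho X).
Proof.
apply: (sqint_le (g := fun e : config d => kappa rho X * \prod_(a <- undup X) (expR rho * 2 ^+ e a))).
- exact: measurable_dualL.
- move=> e; rewrite normr_prod /kappa -big_split /=; apply: ler_prod => x _.
  by rewrite normr_ge0 charlier_le.
- by apply: sqintZ; apply: sqint_charlier_majorant; exact: undup_uniq.
Qed.

Lemma sqint_law (e : W -> config d) f : measurable_fun setT e ->
  (forall A, measurable A -> P (e @^-1` A) = nu A) -> sqint nu f -> sqint P (fun w => f (e w)).
Proof.
move=> me le [mf If]; split; first exact: measurableT_comp mf me.
exact: (integ_law me le If).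
Qed.

Lemma exp_scale (B : seq (Zd d)) (V : Zd d -> R) (F : Zd d -> R) :
  \prod_(b <- B) (expR (rho * V b) * F b) = expR (rho * \sum_(b <- B) V b) * \prod_(b <- B) F b.
Proof. by rewrite big_split /= big_distrr expR_sum. Qed.

(** Coefficients are extracted in the variables of e1 only; the generating function
    in the variables of e2 is left in place and, after multiplication by
    e^{rho sum V}, becomes the stated product. *)
Lemma duality_half (X B : seq (Zd d)) (V : Zd d -> R) : uniq B -> (forall b, 0 <= V b <= 1) ->
  \int[P]_w ((\prod_(b <- B) (expR (rho * V b) * (1 - V b) ^+ e2 w b)) * dualL rho X (e1 w)) =
  \prod_(x <- X) \sum_(b <- B) V b * q x b.
Proof.
move=> uB V01.
pose beta a := rho * \sum_(b <- B) V b * q a b.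
(* The generating function of e2 plays the part of the weight h in
   [extract_coefs]. *)
pose h w := \prod_(b <- B) (expR (rho * V b) * (1 - V b) ^+ e2 w b).
have mh : measurable_fun setT h.
  apply: measurable_prod => b _; apply: measurable_funM => //.
  exact: (measurable_site b (fun m => (1 - V b) ^+ m) m2).
have hb w : 0 <= h w <= \prod_(b <- B) expR (rho * V b).
  have g b : 0 <= (1 - V b) ^+ e2 w b <= 1.
    have /andP[v0 v1] := V01 b.
    by rewrite exprn_ge0 ?subr_ge0 // exprn_ile1 ?subr_ge0 // gerBl.
  apply/andP; split.
    by apply: prodr_ge0 => b _; rewrite mulr_ge0 ?expR_ge0 //; have /andP[] := g b.
  apply: ler_prod => b _; have /andP[g0 g1] := g b.
  by rewrite mulr_ge0 ?expR_ge0 //= -[leRHS]mulr1 ler_wpM2l ?expR_ge0.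
have uX := undup_uniq X.
have Ih : integ P (fun w => `|h w| * \prod_(a <- undup X) (expR rho * 2 ^+ e1 w a)).
  apply: sqint_mul; last exact: (sqint_law m1 law1 (sqint_charlier_majorant uX)).
  apply: (sqint_le (g := fun=> \prod_(b <- B) expR (rho * V b))); last exact: sqint_cst.
    exact: measurableT_comp.
  by move=> w; have /andP[h0 h1] := hb w; rewrite normr_id ger0_norm.
have := @extract_coefs R _ W P _ _ _ (charlier_expansion rho0) _ (fun a w => e1 w a) (undup X) h
  unit [:: tt] (fun=> 1) (fun _ a k => beta a ^+ k / k`!%:R) (fun _ a u => expR (beta a * u)).
move=> /(_ _ mh uX Ih _ _ _ (fun x => count_mem x X)).
rewrite big_seq1 mul1r => E.
have kE : \int[P]_w (h w * dualL rho X (e1 w)) = kappa rho X *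
    \int[P]_w (h w * \prod_(b <- undup X) charlier_coef rho (count_mem b X) (e1 w b)).
  rewrite -RintegralZl //; last first.
    apply: integ_le Ih.
      apply: measurable_funM => //; apply: measurable_prod => b _.
      exact: (measurable_site b (charlier_coef rho (count_mem b X)) m1).
    move=> w; rewrite normrM; apply: ler_wpM2l => //; rewrite normr_prod.
    by apply: ler_prod => b _; rewrite normr_ge0 (psic_le (charlier_expansion rho0)).
  apply: eq_Rintegral => w _; rewrite mulrCA; congr (_ * _).
  rewrite /dualL /kappa -big_split /=; apply: eq_bigr => b _.
  have kk : ((count_mem b X)`!%:R : R) != 0 by rewrite pnatr_eq0 -lt0n fact_gt0.
  have rk : rho ^+ (count_mem b X) != 0 by rewrite expf_neq0.
  by rewrite /charlier_coef; field; apply/andP.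
rewrite -[LHS]/(\int[P]_w (h w * dualL rho X (e1 w))) kE {}E.
- rewrite /kappa -big_split /= [RHS]prod_undup_count; apply: eq_bigr => b _.
  have kk : ((count_mem b X)`!%:R : R) != 0 by rewrite pnatr_eq0 -lt0n fact_gt0.
  have rk : rho ^+ (count_mem b X) != 0 by rewrite expf_neq0.
  by rewrite /beta exprMn; field; apply/andP.
- by move=> b; exact: (measurableT_comp (measurable_coord b) m1).
- move=> _ b; exists (expR `|beta b|) => K.
  apply: le_trans (sum_exp_coeff_le K (normr_ge0 _)); apply: ler_sum => k _.
  by rewrite normrM normrX normfV normr_nat.
- move=> _ b u _.
  rewrite (_ : (fun k => _) = exp_coeff (beta b * u)); first exact: is_cvg_series_exp_coeff.
  by apply/funext => k; rewrite /exp_coeff /= [in RHS](exprMn k (beta b)) mulrCA mulrA.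
- move=> U U01; rewrite big_seq1 mul1r.
  have U01' : forall a, 0 <= U a <= 1 by [].
  transitivity (\int[P]_w (expR (rho * \sum_(a <- undup X) U a) * expR (rho * \sum_(b <- B) V b) *
     (\prod_(a <- undup X) (1 - U a) ^+ e1 w a * \prod_(b <- B) (1 - V b) ^+ e2 w b))).
    by apply: eq_Rintegral => w _; rewrite /h !exp_scale; ring.
  rewrite RintegralZl //; last first.
    apply: (integ_le (g := fun=> 1)); last exact: integ_cst.
      apply: measurable_funM; apply: measurable_prod => b _.
        exact: (measurable_site b (fun m => (1 - U b) ^+ m) m1).
      exact: (measurable_site b (fun m => (1 - V b) ^+ m) m2).
    have g (Z : Zd d -> R) (C : seq (Zd d)) (e : config d) : (forall b, 0 <= Z b <= 1) ->
        0 <= \prod_(b <- C) (1 - Z b) ^+ e b <= 1.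
      move=> Z01; have gb b : 0 <= (1 - Z b) ^+ e b <= 1.
        have /andP[v0 v1] := Z01 b.
        by rewrite exprn_ge0 ?subr_ge0 // exprn_ile1 ?subr_ge0 // gerBl.
      rewrite prodr_ge0 => [|b _]; last by have /andP[] := gb b.
      by rewrite prodr_ile1 // => b _; exact: gb.
    move=> w; have /andP[a0 a1] := g U (undup X) (e1 w) U01'.
    have /andP[b0 b1] := g V B (e2 w) V01.
    by rewrite ger0_norm ?mulr_ge0 // -[leRHS]mulr1 ler_pM.
  rewrite pgf // -!expRD -expR_sum; congr expR.
  have -> : \sum_(a <- undup X) beta a * U a = rho * \sum_(a <- undup X) \sum_(b <- B) U a * V b * q a b.
    rewrite big_distrr; apply: eq_bigr => a _; rewrite /beta big_distrr big_distrl big_distrr /=.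
    by apply: eq_bigr => b _; ring.
  by ring.
Qed.

Lemma kappa_gt0 (X : seq (Zd d)) : 0 < kappa rho X.
Proof.
apply: prodr_gt0 => x _; rewrite divr_gt0 ?exprn_gt0 // ltr0n; exact: fact_gt0.
Qed.

(** The coefficients in the variables V of the product given by [duality_half]
    count the words over the points of X' that are rearrangements of X'. *)
Lemma duality (X X' : seq (Zd d)) :
  \int[P]_w (dualL rho X (e1 w) * dualL rho X' (e2 w)) =
  kappa rho X' * if size X == size X' then
    \sum_(Y <- permutations X') \prod_(e <- zip X Y) q e.1 e.2 else 0.
Proof.
pose B := undup X'; have uB : uniq B := undup_uniq X'.
pose h w := dualL rho X (e1 w).
have mh : measurable_fun setT h by exact: measurableT_comp (measurable_dualL X) m1.
have sh : sqint P h by exact: (sqint_law m1 law1 (sqint_dualL X)).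
have sG : sqint P (fun w => \prod_(a <- B) (expR rho * 2 ^+ e2 w a)).
  exact: (sqint_law m2 law2 (sqint_charlier_majorant uB)).
have Ih : integ P (fun w => `|h w| * \prod_(a <- B) (expR rho * 2 ^+ e2 w a)).
  apply: sqint_mul => //; case: sh => _ If; split; first exact: measurableT_comp.
  rewrite (_ : (fun x => _) = (fun x => h x ^+ 2)) //.
  by apply/funext => x; rewrite real_normK ?num_real.
pose cY Y := \prod_(e <- zip X Y) q e.1 e.2.
have := @extract_coefs R _ W P _ _ _ (charlier_expansion rho0) _ (fun a w => e2 w a) B h
  _ (words B (size X)) cY (fun Y a k => (k == count_mem a Y)%:R) (fun Y a u => u ^+ count_mem a Y).
move=> /(_ _ mh uB Ih _ _ _ (fun x => count_mem x X')) E.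
have kE : \int[P]_w (h w * dualL rho X' (e2 w)) = kappa rho X' *
    \int[P]_w (h w * \prod_(b <- B) charlier_coef rho (count_mem b X') (e2 w b)).
  rewrite -RintegralZl //; last first.
    apply: integ_le Ih.
      apply: measurable_funM => //; apply: measurable_prod => b _.
      exact: (measurable_site b (charlier_coef rho (count_mem b X')) m2).
    move=> w; rewrite normrM; apply: ler_wpM2l => //; rewrite normr_prod.
    by apply: ler_prod => b _; rewrite normr_ge0 (psic_le (charlier_expansion rho0)).
  apply: eq_Rintegral => w _; rewrite mulrCA; congr (_ * _).
  rewrite /dualL /kappa -big_split /=; apply: eq_bigr => b _.
  have kk : ((count_mem b X')`!%:R : R) != 0 by rewrite pnatr_eq0 -lt0n fact_gt0.
  have rk : rho ^+ (count_mem b X') != 0 by rewrite expf_neq0.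
  by rewrite /charlier_coef; field; apply/andP.
rewrite -[LHS]/(\int[P]_w (h w * dualL rho X' (e2 w))) kE {}E; first congr (_ * _).
(* A word over B has the same letter counts as X' iff it rearranges X'. *)
- have ind Y : Y \in words B (size X) ->
      \prod_(b <- B) (count_mem b X' == count_mem b Y)%:R = (perm_eq Y X')%:R :> R.
    rewrite mem_words => /andP[_ /allP YB].
    case: (boolP (perm_eq Y X')) => [/permP pY|npY].
      by rewrite big1 // => b _; rewrite pY eqxx.
    apply/eqP; rewrite prodf_seq_eq0; apply: contraR npY => /hasPn h0.
    apply/allP => b; rewrite mem_cat => bYX /=.
    have bB : b \in B by case/orP: bYX => [/YB//|]; rewrite /B mem_undup.
    by have := h0 _ bB; rewrite /= pnatr_eq0 eqb0 negbK eq_sym.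
  transitivity (\sum_(Y <- words B (size X) | perm_eq Y X') cY Y).
    rewrite [RHS]big_mkcond /= big_seq [RHS]big_seq; apply: eq_bigr => Y YW.
    by rewrite ind //; case: ifP => _; rewrite ?mulr1 ?mulr0.
  rewrite -big_filter; case: eqP => sX.
    apply: perm_big; apply: uniq_perm; rewrite ?permutations_uniq ?filter_uniq ?words_uniq //.
    move=> Y; rewrite mem_filter mem_permutations mem_words sX.
    case: (boolP (perm_eq Y X')) => //= pY.
    rewrite (perm_size pY) eqxx /=; apply/allP => y yY /=.
    by rewrite /B mem_undup -(perm_mem pY).
  rewrite big_seq big1 // => Y; rewrite mem_filter mem_words => /andP[/perm_size pY /andP[/eqP sY _]].
  by case: sX; rewrite -sY pY.
- by move=> b; exact: (measurableT_comp (measurable_coord b) m2).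
- move=> Y b; exists 1 => K.
  by have [h1 _] := indicator_series R (count_mem b Y); exact: h1.
- by move=> Y b u _; have [_ h2] := indicator_series R (count_mem b Y); exact: h2.
- move=> V V01; under eq_Rintegral do rewrite mulrC.
  rewrite (duality_half X uB V01) prod_words; apply: eq_big_seq => Y.
  rewrite mem_words => /andP[_ /allP YB]; congr (_ * _).
  rewrite prod_undup_count.
  rewrite [RHS](bigID (mem Y)) /= [X in _ = _ * X]big1 ?mulr1; last first.
    by move=> b /count_memPn ->.
  rewrite -[RHS]big_filter; apply: perm_big; apply: uniq_perm; rewrite ?undup_uniq ?filter_uniq //.
  move=> x; rewrite mem_undup mem_filter /=.
  by case: (boolP (x \in Y)) => // /YB.
Qed.
End duality.

(** * Square integrable series *)

Lemma cauchy_schwarz_weights (R : realFieldType) (I : Type) (l : seq I) (r w s : I -> R) :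
  (forall i, 0 <= w i) -> (forall i, 0 <= s i) -> (forall i, r i ^+ 2 <= w i * s i) ->
  (\sum_(i <- l) `|r i|) ^+ 2 <= (\sum_(i <- l) w i) * (\sum_(i <- l) s i).
Proof.
move=> w0 s0 rws.
have S0 (f : I -> R) (l' : seq I) : (forall i, 0 <= f i) -> 0 <= \sum_(i <- l') f i.
  by move=> f0; apply: sumr_ge0.
elim: l => [|i l IH]; first by rewrite !big_nil expr0n mulr0.
rewrite !big_cons; have := IH; have := rws i.
have := S0 _ l w0; have := S0 _ l s0; have := S0 _ l (fun i => normr_ge0 (r i)).
have := w0 i; have := s0 i; have := normr_ge0 (r i).
rewrite -(real_normK (num_real (r i))).
move: (\sum_(i <- l) `|r i|) (\sum_(i <- l) w i) (\sum_(i <- l) s i) `|r i| (w i) (s i).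
move=> A Ws Ss a wi si a0 si0 wi0 A0 Ss0 Ws0 h1 h2.
have cross : 2 * (a * A) <= wi * Ss + Ws * si.
  rewrite -(@ler_pXn2r _ 2) ?nnegrE //; try by rewrite ?mulr_ge0 // addr_ge0 // mulr_ge0.
  apply: (@le_trans _ _ (4 * ((wi * si) * (Ws * Ss)))).
    have -> : (2 * (a * A)) ^+ 2 = 4 * (a ^+ 2 * A ^+ 2) by ring.
    apply: ler_wpM2l => //; apply: ler_pM => //; exact: sqr_ge0.
  have := sqr_ge0 (wi * Ss - Ws * si); rewrite -subr_ge0 => h; rewrite -subr_ge0.
  by apply: le_trans h _; rewrite le_eqVlt; apply/orP; left; apply/eqP; ring.
have -> : (a + A) ^+ 2 = a ^+ 2 + A ^+ 2 + 2 * (a * A) by ring.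
by nra.
Qed.

Section L2series.
Context (R : realType) (dT : measure_display) (T : measurableType dT) (P : probability T R).
Context (r s : nat -> T -> R) (w : nat -> R) (Wt K : R)
  (mr : forall j, measurable_fun setT (r j)) (Is : forall j, integ P (s j))
  (s0 : forall j x, 0 <= s j x) (w0 : forall j, 0 <= w j)
  (rws : forall j x, r j x ^+ 2 <= w j * s j x)
  (wW : forall n, \sum_(0 <= j < n) w j <= Wt)
  (sK : forall n, \sum_(0 <= j < n) \int[P]_x s j x <= K).

Let S x : \bar R := (\sum_(j <oo) (s j x)%:E)%E.

Lemma L2series_finite : P.-integrable setT S.
Proof.
have ms j : measurable_fun setT (EFin \o s j) by exact: measurable_int (Is j).
apply/integrableP; split.
  exact: (@ge0_emeasurable_sum _ _ _ setT (fun k x => (s k x)%:E) xpredT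
    (fun k x _ _ => s0 k x) (fun k _ => ms k)).
apply: (@le_lt_trans _ _ K%:E); last exact: ltry.
have S0 x : (0 <= S x)%E by apply: nneseries_ge0 => n _ _; rewrite lee_fin.
under eq_integral => x _ do rewrite gee0_abs //.
rewrite (integral_nneseries P measurableT ms); last by move=> n x _ /=; rewrite lee_fin.
apply: lime_le; first by apply: is_cvg_nneseries => n _ _; apply: integral_ge0 => x _; rewrite lee_fin.
apply: nearW => n; have := sK n; rewrite -lee_fin; apply: le_trans.
rewrite -sumEFin; apply: lee_sum => j _.
by rewrite /Rintegral fineK; [exact: lexx|exact: integrable_fin_num (Is j)].
Qed.

(** By Cauchy-Schwarz the tails of the series are bounded by a tail of the weights w
    times the integrable function sum_j s_j, both pointwise and in L2. *)
Lemma L2series_cvg : exists h : T -> R, [/\ sqint P h,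
   {ae P, forall x, (exists M, forall n, \sum_(0 <= j < n) `|r j x| <= M) /\
      series (r ^~ x) @ \oo --> h x} &
   (fun n => \int[P]_x ((h x - series (r ^~ x) n) ^+ 2)) @ \oo --> (0 : R)].
Proof.
have IS := L2series_finite.
have S0 x : (0 <= S x)%E by apply: nneseries_ge0 => n _ _; rewrite lee_fin.
have mS : measurable_fun setT S by exact: measurable_int IS.
pose good x := (S x < +oo)%E.
pose sf x := fine (S x).
have sf0 x : 0 <= sf x by rewrite fine_ge0.
have msf : measurable_fun setT sf := measurableT_comp (fine_measurable measurableT) mS.
have Isf : integ P sf.
  apply/integrableP; split.
    exact/measurable_EFinP.
  have /integrableP[_] := IS; apply: le_lt_trans; apply: ge0_le_integral => //.
  - by apply: measurableT_comp => //; exact/measurable_EFinP.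
  - exact: measurableT_comp.
  - move=> x _ /=; rewrite ger0_norm // gee0_abs // /sf.
    by have := S0 x; case: (S x).
have sums_le x n : good x -> \sum_(0 <= j < n) s j x <= sf x.
  move=> gx; rewrite -lee_fin /sf fineK; last by rewrite ge0_fin_numE.
  rewrite -sumEFin; apply: nneseries_lim_ge => j _ _; by rewrite lee_fin.
have goodae : {ae P, forall x, good x}.
  have := integrable_ae measurableT IS; apply: filterS => x /(_ I).
  by rewrite ge0_fin_numE.
(* Cauchy-Schwarz on a block of the series. *)
have tail x m n : good x -> (m <= n)%N ->
    (\sum_(m <= j < n) `|r j x|) ^+ 2 <= (\sum_(m <= j < n) w j) * sf x.
  move=> gx mn; apply: le_trans (cauchy_schwarz_weights _ w0 (s0 ^~ x) (rws ^~ x)) _.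
  apply: ler_wpM2l; first exact: sumr_ge0.
  apply: le_trans (sums_le x n gx).
  by rewrite [leRHS](big_cat_nat (n := m)) //= lerDr sumr_ge0.
have absb x n : good x -> \sum_(0 <= j < n) `|r j x| <= Num.sqrt (Wt * sf x).
  move=> gx; have A0 : 0 <= \sum_(0 <= j < n) `|r j x| by exact: sumr_ge0.
  rewrite -(ger0_norm A0) -sqrtr_sqr.
  rewrite ler_wsqrtr //; apply: le_trans (tail x 0%N n gx (leq0n _)) _.
  by rewrite ler_wpM2r.
have ncv x : good x -> cvgn (series (r ^~ x)).
  move=> gx; apply: normed_cvg; apply: nondecreasing_is_cvgn.
    by apply: nondecreasing_series => n _ _; exact: normr_ge0.
  by exists (Num.sqrt (Wt * sf x)) => _ [n _ <-]; exact: absb.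
(* The limit is set to 0 where the sum of the s_j diverges, a null set. *)
pose g1 x : R := (x \in [set x | good x])%:R.
have mgood : measurable [set x | good x].
  rewrite (_ : [set x | good x] = setT `&` [set x | (S x < +oo)%E]); last by rewrite setTI.
  exact: emeasurable_fun_infty_o.
have mg1 : measurable_fun setT g1.
  by rewrite (_ : g1 = \1_[set x | good x]); [exact: measurable_indic|apply/funext => x; rewrite indicE].
have g1E x : good x -> g1 x = 1 by move=> gx; rewrite /g1 mem_set.
pose h x := limn (fun n => g1 x * series (r ^~ x) n).
have hcv x : (fun n => g1 x * series (r ^~ x) n) @ \oo --> h x.
  have [gx|gx] := boolP (S x < +oo)%E.
    by apply: is_cvgMr; exact: ncv.
  have g0 : g1 x = 0 by rewrite /g1 memNset //; apply/negP.
  apply: (cvgP 0); apply: cvg_near_cst; apply: nearW => n.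
  by rewrite g0 mul0r.
have mser n : measurable_fun setT (fun x => series (r ^~ x) n) by rewrite /series /=; exact: measurable_sum.
have mh : measurable_fun setT h.
  apply: (@measurable_fun_cvg _ _ _ setT (fun n x => g1 x * series (r ^~ x) n)) => [n|x _]; last exact: hcv.
  exact: measurable_funM.
have hcv' x : good x -> series (r ^~ x) @ \oo --> h x.
  by move=> gx; have := hcv x; rewrite g1E //; under eq_fun do rewrite mul1r.
have cw : cvgn (series w).
  apply: nondecreasing_is_cvgn; first by apply: nondecreasing_series => n _ _; exact: w0.
  by exists Wt => _ [n _ <-]; exact: wW.
have hb x n : good x -> (h x - series (r ^~ x) n) ^+ 2 <= (limn (series w) - series w n) * sf x.
  move=> gx.
  have c1 : (fun m => (series (r ^~ x) m - series (r ^~ x) n) ^+ 2) @ \oo -->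
      (h x - series (r ^~ x) n) ^+ 2.
    rewrite expr2; under eq_fun do rewrite expr2.
    by apply: cvgM; apply: cvgB; (exact: hcv' || exact: cvg_cst).
  apply: (cvgr_to_le c1); exists n => // m /= nm.
  rewrite !/series /= sub_series_geq //.
  apply: (@le_trans _ _ ((\sum_(n <= j < m) `|r j x|) ^+ 2)).
    rewrite -[leLHS]real_normK ?num_real //; apply: lerXn2r; rewrite ?nnegrE ?sumr_ge0 //.
    exact: ler_norm_sum.
  apply: (le_trans (tail x n m gx nm)); apply: ler_wpM2r => //.
  rewrite -sub_series_geq // lerD2r.
  by apply: nondecreasing_cvgn_le => //; apply: nondecreasing_series => k _ _; exact: w0.
have hser n : integ P (fun x => (h x - series (r ^~ x) n) ^+ 2) /\
    \int[P]_x ((h x - series (r ^~ x) n) ^+ 2) <= (limn (series w) - series w n) * \int[P]_x sf x.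
  have mm : measurable_fun setT (fun x => (h x - series (r ^~ x) n) ^+ 2).
    by apply: measurable_funX; exact: measurable_funB.
  have le1 : (\int[P]_x ((h x - series (r ^~ x) n) ^+ 2)%:E <=
      \int[P]_x ((limn (series w) - series w n) * sf x)%:E)%E.
    apply: ae_ge0_le_integral => //.
    - by move=> x _; rewrite lee_fin sqr_ge0.
    - exact/measurable_EFinP.
    - move=> x _; rewrite lee_fin mulr_ge0 // subr_ge0.
      by apply: nondecreasing_cvgn_le => //; apply: nondecreasing_series => k _ _; exact: w0.
    - exact: measurable_int (integZ _ Isf).
    - by apply: filterS goodae => x gx _; rewrite lee_fin; exact: hb.
  have I2 := integZ (limn (series w) - series w n) Isf.
  have I1 : integ P (fun x => (h x - series (r ^~ x) n) ^+ 2).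
    apply/integrableP; split; first exact/measurable_EFinP.
    under eq_integral => x _ do rewrite /= ger0_norm ?sqr_ge0 //.
    apply: (le_lt_trans le1); have /fin_numPlt/andP[_] := integrable_fin_num measurableT I2.
    by [].
  split=> //; rewrite -RintegralZl // -lee_fin /Rintegral !fineK //.
  - exact: integrable_fin_num I2.
  - exact: integrable_fin_num I1.
exists h; split.
- have [I0 _] := hser 0%N; split=> //.
  by move: I0; under eq_fun do rewrite /series /= big_geq // subr0.
- apply: filterS goodae => x gx; split; last exact: hcv'.
  by exists (Num.sqrt (Wt * sf x)) => n; exact: absb.
- have c0 : (fun n => (limn (series w) - series w n) * \int[P]_x sf x) @ \oo --> (0 : R).
    rewrite -[0 in X in _ --> X](mul0r (\int[P]_x sf x)).
    apply: cvgMl; rewrite -[0 in X in _ --> X](subrr (limn (series w))).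
    by apply: cvgB; [exact: cvg_cst|].
  apply: (squeeze_cvgr _ (cvg_cst 0) c0); apply: nearW => n; apply/andP; split.
    by apply: Rintegral_ge0 => x _; exact: sqr_ge0.
  by have [_] := hser n.
Qed.
End L2series.

(** * Orthogonal expansions *)

Section hilbert.
Context (R : realType) (dT : measure_display) (T : measurableType dT) (P : probability T R).
Implicit Types f g h : T -> R.

Lemma sqint_sq_sub f g l : sqint P f -> sqint P g ->
  \int[P]_x ((f x - l * g x) ^+ 2) =
  \int[P]_x (f x ^+ 2) - 2 * l * \int[P]_x (f x * g x) + l ^+ 2 * \int[P]_x (g x ^+ 2).
Proof.
move=> hf hg.
have -> : \int[P]_x ((f x - l * g x) ^+ 2) =
   \int[P]_x ((f x ^+ 2 + (- (2 * l)) * (f x * g x)) + l ^+ 2 * (g x ^+ 2)).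
  by apply: eq_Rintegral => x _; ring.
have I1 := hf.2; have I2 := hg.2; have I3 := sqint_mul hf hg.
rewrite RintegralD //; last 2 first.
- by apply: integD => //; exact: integZ.
- exact: integZ.
rewrite RintegralD //; last exact: integZ.
by rewrite !RintegralZl //; ring.
Qed.

(** The discriminant of the nonnegative quadratic form l -> |f - l g|^2. *)
Lemma cauchy_schwarz f g : sqint P f -> sqint P g ->
  (\int[P]_x (f x * g x)) ^+ 2 <= \int[P]_x (f x ^+ 2) * \int[P]_x (g x ^+ 2).
Proof.
move=> hf hg.
have h l : 0 <= \int[P]_x (f x ^+ 2) - 2 * l * \int[P]_x (f x * g x) + l ^+ 2 * \int[P]_x (g x ^+ 2).
  by rewrite -sqint_sq_sub //; apply: Rintegral_ge0 => x _; exact: sqr_ge0.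
have G0 : 0 <= \int[P]_x (g x ^+ 2) by apply: Rintegral_ge0 => x _; exact: sqr_ge0.
move: (\int[P]_x (g x ^+ 2)) (\int[P]_x (f x ^+ 2)) (\int[P]_x (f x * g x)) G0 h.
move=> G F B; rewrite le_eqVlt => /predU1P[<-|G0] h.
  rewrite mulr0; have [->|B0] := eqVneq B 0; first by rewrite expr0n.
  have := h ((F + 1) / (2 * B)).
  have -> : F - 2 * ((F + 1) / (2 * B)) * B + ((F + 1) / (2 * B)) ^+ 2 * 0 = -1 by field.
  by rewrite oppr_ge0 ler10.
have := h (B / G).
have -> : F - 2 * (B / G) * B + (B / G) ^+ 2 * G = (F * G - B ^+ 2) / G by field; rewrite gt_eqF.
by rewrite pmulr_lge0 ?invr_gt0 // subr_ge0.
Qed.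

Lemma sqint_sub f g : sqint P f -> sqint P g -> sqint P (fun x => f x - g x).
Proof.
move=> hf hg; rewrite (_ : (fun x => _) = (fun x => f x + (-1) * g x)).
  by apply: sqintD => //; exact: sqintZ.
by apply/funext => x; rewrite mulN1r.
Qed.

Context (I : eqType) (D : I -> T -> R) (a : I -> R) (a0 : forall i, 0 < a i)
  (sD : forall i, sqint P (D i))
  (orth : forall i j, \int[P]_x (D i x * D j x) = (i == j)%:R * a i)
  (complete : forall h, sqint P h -> (forall i, \int[P]_x (h x * D i x) = 0) ->
     \int[P]_x (h x ^+ 2) = 0).

Definition combo (c : I -> R) (S : seq I) (x : T) : R := \sum_(i <- S) c i * D i x.

Lemma sqint_combo c S : sqint P (combo c S).
Proof. by apply: sqint_sum => i; apply: sqintZ. Qed.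

Lemma combo_mul c S f : sqint P f ->
  \int[P]_x (combo c S x * f x) = \sum_(i <- S) c i * \int[P]_x (D i x * f x).
Proof.
move=> hf; rewrite (@eq_Rintegral _ _ _ P setT (fun x => \sum_(i <- S) c i * (D i x * f x))); last first.
  by move=> x _; rewrite big_distrl; apply: eq_bigr => i _ /=; rewrite mulrA.
rewrite Rint_sum => [|i]; last by apply: integZ; exact: sqint_mul.
by apply: eq_bigr => i _; rewrite RintegralZl //; exact: sqint_mul.
Qed.

Lemma combo_coef c S i : uniq S ->
  \int[P]_x (combo c S x * D i x) = (i \in S)%:R * (c i * a i).
Proof.
move=> uS; rewrite combo_mul //.
under eq_bigr do rewrite orth.
have [iS|iS] := boolP (i \in S).
  rewrite (bigD1_seq i) //= eqxx big1 ?addr0 ?mul1r // => j /negbTE ->.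
  by rewrite mul0r mulr0.
rewrite mul0r big_seq big1 // => j jS; case: eqP => [ji|_]; rewrite ?mul0r ?mulr0 //.
by rewrite -ji jS in iS.
Qed.

Lemma combo_sq c S : uniq S -> \int[P]_x (combo c S x ^+ 2) = \sum_(i <- S) c i ^+ 2 * a i.
Proof.
move=> uS; rewrite (@eq_Rintegral _ _ _ P setT (fun x => combo c S x * combo c S x)); last first.
  by move=> x _; rewrite expr2.
rewrite combo_mul; last exact: sqint_combo.
apply: eq_big_seq => i iS.
rewrite (@eq_Rintegral _ _ _ P setT (fun x => combo c S x * D i x)); last by move=> x _; rewrite mulrC.
by rewrite combo_coef // iS mul1r; ring.
Qed.

Lemma geom_half n : \sum_(0 <= j < n) (2^-1 : R) ^+ j = 2 - 2 * 2^-1 ^+ n.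
Proof.
elim: n => [|n IH]; first by rewrite big_nil expr0; ring.
by rewrite big_nat_recr //= IH exprS; field.
Qed.

(** The index type need not be countable, so the expansion is not written as a
    series. Finite sets whose Bessel sums come within 4^{-n} of the supremum give
    combinations that converge in L2 to some h. An index outside all these sets has
    a coefficient forced to zero by the supremum, so g - h is orthogonal to every
    D_i and vanishes by completeness. *)
Lemma combo_approx g e : sqint P g -> 0 < e -> exists S : seq I, uniq S /\
  \int[P]_x ((g x - combo (fun i => \int[P]_x (g x * D i x) / a i) S x) ^+ 2) <= e.
Proof.
move=> hg e0; pose c i := \int[P]_x (g x * D i x) / a i.
pose q S := combo c S; pose s S := \sum_(i <- S) c i ^+ 2 * a i.
have cA i : c i * a i = \int[P]_x (g x * D i x) by rewrite divfK // gt_eqF.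
have ca0 i : 0 <= c i ^+ 2 * a i by rewrite mulr_ge0 ?sqr_ge0 // ltW.
(* Bessel: s S is the squared norm of the projection of g on the span of the D_i,
   i in S. *)
have bessel S : uniq S -> s S <= \int[P]_x (g x ^+ 2).
  move=> uS; have : 0 <= \int[P]_x ((g x - 1 * q S x) ^+ 2).
    by apply: Rintegral_ge0 => x _; exact: sqr_ge0.
  rewrite sqint_sq_sub //; last exact: sqint_combo.
  have -> : \int[P]_x (g x * q S x) = \int[P]_x (q S x * g x).
    by apply: eq_Rintegral => x _; rewrite mulrC.
  rewrite combo_sq // combo_mul //.
  have -> : \sum_(i <- S) c i * \int[P]_x (D i x * g x) = s S.
    apply: eq_bigr => i _; have -> : \int[P]_x (D i x * g x) = \int[P]_x (g x * D i x).
      by apply: eq_Rintegral => x _; rewrite mulrC.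
    by rewrite -cA; ring.
  by rewrite -/(s S) expr1n !mul1r mulr1; lra.
pose E := [set v | exists2 S, uniq S & v = s S].
have E0 : E !=set0 by exists (s [::]), [::].
have hE : has_sup E.
  by split=> //; exists (\int[P]_x (g x ^+ 2)) => _ [S uS ->]; exact: bessel.
pose M := sup E.
have sM S : uniq S -> s S <= M.
  by move=> uS; apply: sup_upper_bound => //; exists S.
have M0 : 0 <= M by apply: le_trans (sM [::] isT); rewrite /s big_nil.
have /choice[Tj hTj] : forall j, exists S, uniq S /\ M - 4^-1 ^+ j <= s S.
  move=> j; have h4 : 0 < (4^-1 : R) ^+ j by rewrite exprn_gt0 // invr_gt0.
  have [_ [S uS ->] hS] := sup_adherent h4 hE.
  by exists S; split=> //; exact: ltW.
pose fix Sj n := if n is m.+1 then undup (Sj m ++ Tj n) else [::].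
have uSj n : uniq (Sj n) by case: n => //= n; exact: undup_uniq.
have SjS n : {subset Sj n <= Sj n.+1} by move=> i iS; rewrite /= mem_undup mem_cat iS.
have sSj n : (0 < n)%N -> M - 4^-1 ^+ n <= s (Sj n).
  case: n => // n _; have [uT hT] := hTj n.+1; apply: (le_trans hT).
  by apply: ler_sum_subset => // i iT; rewrite /= mem_undup mem_cat iT orbT.
pose Lj n := [seq i <- Sj n.+1 | i \notin Sj n].
have permL n : perm_eq (Sj n.+1) (Sj n ++ Lj n).
  apply: uniq_perm => //.
    rewrite cat_uniq uSj filter_uniq // andbT /=; apply/hasPn => i.
    by rewrite mem_filter => /andP[].
  move=> i; rewrite mem_cat mem_filter; case: (boolP (i \in Sj n)) => //= iS.
  exact: SjS.
pose r n x := combo c (Lj n) x.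
have qS n x : q (Sj n.+1) x = q (Sj n) x + r n x.
  by rewrite /q /combo (perm_big _ (permL n)) big_cat.
(* The increment at step n adds at most what is missing from the supremum. *)
have sL n : \sum_(i <- Lj n) c i ^+ 2 * a i <= (M + 1) * 4^-1 ^+ n.
  have -> : \sum_(i <- Lj n) c i ^+ 2 * a i = s (Sj n.+1) - s (Sj n).
    by rewrite /s (perm_big _ (permL n)) big_cat addrAC subrr add0r.
  have := sM _ (uSj n.+1); case: n => [|n] h.
    by rewrite /s big_nil expr0 subr0 mulr1; apply: (le_trans h); rewrite lerDl.
  have := sSj n.+1 isT; have : 0 <= M * 4^-1 ^+ n.+1.
    by rewrite mulr_ge0 // exprn_ge0 // invr_ge0.
  by lra.
have qE n x : series (r ^~ x) n = q (Sj n) x.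
  elim: n => [|n IH]; first by rewrite /series /= big_geq // /q /combo big_nil.
  by rewrite qS -IH /series /= big_nat_recr.
have rsq n : \int[P]_x (r n x ^+ 2) <= (M + 1) * 4^-1 ^+ n.
  by rewrite combo_sq // filter_uniq.
have srn n : sqint P (r n) by exact: sqint_combo.
have [|||||||h [sh _ hc]] := @L2series_cvg _ _ _ P r (fun j x => 2 ^+ j * r j x ^+ 2) (fun j => 2^-1 ^+ j) 2 (2 * (M + 1)).
- by move=> j; have [] := srn j.
- by move=> j; apply: integZ; have [] := srn j.
- by move=> j x; rewrite mulr_ge0 ?sqr_ge0 // exprn_ge0.
- by move=> j; rewrite exprn_ge0 // invr_ge0.
- by move=> j x; rewrite mulrA -exprMn mulVf // expr1n mul1r.
- move=> n; rewrite geom_half gerBl mulr_ge0 // exprn_ge0 // invr_ge0 //.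
- move=> n; apply: (@le_trans _ _ (\sum_(0 <= j < n) (M + 1) * 2^-1 ^+ j)).
    apply: ler_sum => j _; rewrite RintegralZl //; last by have [] := srn j.
    apply: (@le_trans _ _ (2 ^+ j * ((M + 1) * 4^-1 ^+ j))).
      by apply: ler_wpM2l; rewrite ?exprn_ge0.
    rewrite mulrCA -exprMn (_ : 2 * 4^-1 = 2^-1 :> R) //; by field.
  rewrite -big_distrr /= geom_half mulrC; apply: ler_wpM2r; first by rewrite addr_ge0.
  by rewrite gerBl mulr_ge0 // exprn_ge0 // invr_ge0.
pose err n := \int[P]_x ((h x - q (Sj n) x) ^+ 2).
have errc : err @ \oo --> (0 : R).
  rewrite (_ : err = fun n => \int[P]_x ((h x - series (r ^~ x) n) ^+ 2)) //.
  by apply/funext => n; apply: eq_Rintegral => x _; rewrite qE.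
have sq n : sqint P (q (Sj n)) by exact: sqint_combo.
have sf : sqint P (fun x => g x - h x) by exact: sqint_sub.
have f0 : \int[P]_x ((g x - h x) ^+ 2) = 0.
  apply: (complete sf) => i; apply/eqP; rewrite -sqrf_eq0 eq_le sqr_ge0 andbT.
  have bound n : (0 < n)%N -> (\int[P]_x ((g x - h x) * D i x)) ^+ 2 <=
      2 * (a i * 4^-1 ^+ n) + 2 * (err n * a i).
    move=> n0.
    have -> : \int[P]_x ((g x - h x) * D i x) =
        \int[P]_x ((g x - q (Sj n) x) * D i x) - \int[P]_x ((h x - q (Sj n) x) * D i x).
      rewrite -RintegralB //.
      - by apply: eq_Rintegral => x _; ring.
      - by apply: sqint_mul => //; exact: sqint_sub.
      - by apply: sqint_mul => //; exact: sqint_sub.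
    set u := \int[P]_x ((g x - _) * _); set v := \int[P]_x ((h x - _) * _).
    have hv : v ^+ 2 <= err n * a i.
      have := cauchy_schwarz (sqint_sub sh (sq n)) (sD i).
      rewrite [X in _ <= _ * X -> _](_ : _ = a i) //.
      have := orth i i; rewrite eqxx mul1r => <-.
      by apply: eq_Rintegral => x _; rewrite expr2.
    (* If i is outside S_n, adding it would still not exceed the supremum M. *)
    have hu : u ^+ 2 <= a i * 4^-1 ^+ n.
      have -> : u = (i \notin Sj n)%:R * (c i * a i).
        rewrite /u; under eq_Rintegral do rewrite mulrBl.
        rewrite RintegralB //; try exact: sqint_mul.
        by rewrite combo_coef // -cA; case: (i \in Sj n) => /=; ring.
      case: (boolP (i \in Sj n)) => iS /=.
        by rewrite mul0r expr0n /= mulr_ge0 ?exprn_ge0 ?invr_ge0 // ltW.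
      have : s (i :: Sj n) <= M by apply: sM; rewrite cons_uniq iS uSj.
      rewrite /s big_cons -/(s _) => h1; have h2 := sSj n n0.
      have : c i ^+ 2 * a i <= 4^-1 ^+ n by lra.
      move=> h3; rewrite [X in X <= _](_ : _ = a i * (c i ^+ 2 * a i)); last first.
        by rewrite mul1r; move: (c i) => ci; ring.
      by apply: ler_wpM2l => //; exact: ltW.
    by have := sqr_ge0 (u + v); nra.
  have cb : (fun n => 2 * (a i * 4^-1 ^+ n) + 2 * (err n * a i)) @ \oo --> (0 : R).
    rewrite -[0 in X in _ --> X](addr0 0); apply: cvgD.
      rewrite -[0 in X in _ --> X](mulr0 2); apply: cvgMr.
      rewrite -[0 in X in _ --> X](mulr0 (a i)); apply: cvgMr.
      by apply: cvg_expr; rewrite ger0_norm ?invr_ge0 // invf_lt1 // ltr1n.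
    rewrite -[0 in X in _ --> X](mulr0 2); apply: cvgMr.
    by rewrite -[0 in X in _ --> X](mul0r (a i)); apply: cvgMl.
  by apply: (cvgr_to_ge cb); exists 1%N => // n /= n1; exact: bound.
have e2 : 0 < e / 2 by rewrite divr_gt0.
have [N _ hN] := cvgr_lt _ errc _ e2.
exists (Sj N); split=> //.
have hb : \int[P]_x ((g x - q (Sj N) x) ^+ 2) <=
    \int[P]_x (2 * (g x - h x) ^+ 2 + 2 * (h x - q (Sj N) x) ^+ 2).
  apply: le_Rintegral => //.
  - by have [] := sqint_sub hg (sq N).
  - by apply: integD; apply: integZ; [have [] := sf|have [] := sqint_sub sh (sq N)].
  - move=> x _; have := sqr_ge0 ((g x - h x) - (h x - q (Sj N) x)); rewrite !expr2; nra.
apply: (le_trans hb); rewrite RintegralD //; last 2 first.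
- by apply: integZ; have [] := sf.
- by apply: integZ; have [] := sqint_sub sh (sq N).
rewrite !RintegralZl //; [|by have [] := sqint_sub sh (sq N)|by have [] := sf].
by rewrite f0; have := hN N (leqnn N); rewrite /= -/(err N); lra.
Qed.
End hilbert.

(** * Completeness of the duality polynomials *)

Section config_list.
Context (R : realType) (d : nat) (rho : R).
Implicit Types (xi : fconfig d).

Definition points xi : seq (Zd d) := flatten [seq nseq (xi x) x | x <- enum_fset (finsupp xi)].

Lemma count_points xi x : count_mem x (points xi) = xi x.
Proof.
rewrite /points count_flatten sumnE !big_map.
rewrite (eq_bigr (fun y => if y == x then xi x else 0%N)); last first.
  by move=> y _; rewrite count_nseq /=; case: eqP => [->|_]; rewrite ?mul1n ?mul0n.
have [xS|xS] := boolP (x \in finsupp xi).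
  rewrite (bigD1_seq x) ?fset_uniq //= eqxx big1 ?addn0 // => y /negbTE -> //.
rewrite (fsfun_dflt xS) big_seq big1 // => y yS; case: eqP => [yx|//].
by rewrite -yx yS in xS.
Qed.

Lemma size_points xi : size (points xi) = mass xi.
Proof.
rewrite /points size_flatten /shape sumnE !big_map /mass; apply: eq_bigr => x _.
by rewrite size_nseq.
Qed.

Lemma dualD_points xi e : dualD rho xi e = dualL rho (points xi) e.
Proof.
rewrite (@dualL_sup _ _ _ _ (enum_fset (finsupp xi))) ?fset_uniq //.
  by apply: eq_bigr => x _; rewrite count_points.
move=> x; rewrite -has_pred1 has_count count_points.
by move=> x0; rewrite mem_finsupp -lt0n.
Qed.

Lemma perm_points xi xi' : perm_eq (points xi) (points xi') = (xi == xi').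
Proof.
apply/idP/eqP => [/permP h|-> //].
by apply/fsfunP => x; rewrite -!count_points; exact: h.
Qed.

Definition site_config (A : seq (Zd d)) (k : Zd d -> nat) : fconfig d :=
  [fsfun x in [fset x in A]%fset => k x].

Lemma dualD_site_config A k e : uniq A ->
  dualD rho (site_config A k) e = \prod_(a <- A) charlier rho (k a) (e a).
Proof.
move=> uA; have kE x : site_config A k x = if x \in A then k x else 0%N.
  by rewrite fsfunE inE.
rewrite /dualD (eq_bigr (fun x => charlier rho (site_config A k x) (e x))) //.
rewrite [RHS](bigID (fun x => k x != 0%N)) /= [X in _ = _ * X]big1 ?mulr1; last first.
  by move=> x; rewrite negbK => /eqP ->; rewrite charlier0.
rewrite big_seq [RHS]big_seq_cond -[LHS]big_seq -[RHS]big_filter.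
rewrite big_seq; under eq_bigr => x xS do rewrite kE.
rewrite -big_seq.
transitivity (\prod_(x <- [seq x <- A | (x \in A) && (k x != 0%N)]) charlier rho (if x \in A then k x else 0%N) (e x)).
  apply: perm_big; apply: uniq_perm; rewrite ?fset_uniq ?filter_uniq // => x.
  rewrite mem_filter mem_finsupp kE; case: (x \in A) => //=.
  by rewrite andbT.
rewrite big_seq [RHS]big_seq; apply: eq_bigr => x.
by rewrite mem_filter => /andP[/andP[->]].
Qed.
End config_list.

Section completeness.
Context (R : realType) (d : nat) (rho : R) (rho0 : 0 < rho) (nu : probability (config d) R)
  (hnu : poisson_product rho nu).

Let mc x (F : nat -> R) : measurable_fun setT (fun e : config d => F (e x)).
Proof. exact: (measurableT_comp (measurable_nat F) (measurable_coord x)). Qed.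

(** Sites are treated one at a time. Orthogonality to all Charlier polynomials in
    eta_a gives orthogonality to their generating function at 1-u, which is
    e^{rho (1-u)} u^{eta_a}; read as a power series in u, it generates the indicators
    of the values of eta_a. *)
Lemma orth_sites (A : seq (Zd d)) (h : config d -> R) : uniq A -> sqint nu h ->
  (forall k, \int[nu]_e (h e * \prod_(a <- A) charlier rho (k a) (e a)) = 0) ->
  forall n : Zd d -> nat, \int[nu]_e (h e * \prod_(a <- A) (e a == n a)%:R) = 0.
Proof.
elim: A h => [|a A IH] h /=.
  move=> _ _ H n; have := H (fun=> 0%N).
  under eq_Rintegral do rewrite big_nil.
  by under [in X in _ -> X]eq_Rintegral do rewrite big_nil.
case/andP => aA uA sh H n.
under eq_Rintegral do rewrite big_cons mulrA.
apply: (IH (fun e => h e * (e a == n a)%:R)) => //.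
  apply: (sqint_le (g := fun e : config d => `|h e|)).
  - apply: measurable_funM; first by case: sh.
    exact: (mc a (fun m => (m == n a)%:R)).
  - move=> e; rewrite normrM -[leRHS]mulr1; apply: ler_wpM2l => //.
    by rewrite ger0_norm // lern1 leq_b1.
  - case: sh => mh Ih; split; first exact: measurableT_comp.
    rewrite (_ : (fun x => _) = (fun x => h x ^+ 2)) //.
    by apply/funext => x; rewrite real_normK ?num_real.
move=> k.
(* Y carries the sites already prescribed and those still weighted; only the site
   a is at stake. *)
pose Y e := h e * \prod_(b <- A) charlier rho (k b) (e b).
have mY : measurable_fun setT Y.
  by apply: measurable_funM; [case: sh|apply: measurable_prod => b _; exact: mc].
have IY : integ nu (fun e => `|Y e| * (expR rho * 2 ^+ e a)).
  pose K := \prod_(b <- A) ((k b)`!%:R / rho ^+ k b).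
  have sG := sqint_charlier_majorant rho0 hnu (A := a :: A).
  apply: (integ_le (g := fun e => `|h e| * (K * \prod_(b <- a :: A) (expR rho * 2 ^+ e b)))).
  - apply: measurable_funM; first exact: measurableT_comp.
    exact: (mc a (fun m => expR rho * 2 ^+ m)).
  - move=> e; rewrite ger0_norm ?mulr_ge0 ?expR_ge0 ?exprn_ge0 //.
    rewrite /Y normrM -mulrA; apply: ler_wpM2l => //.
    rewrite big_cons [leRHS]mulrCA [leLHS]mulrC; apply: ler_wpM2l; first by rewrite mulr_ge0 ?expR_ge0 ?exprn_ge0.
    rewrite normr_prod /K -big_split /=; apply: ler_prod => b _.
    by rewrite normr_ge0 charlier_le.
  - apply: sqint_mul; last by apply: sqintZ; apply: sG; rewrite /= aA.
    case: sh => mh Ih; split; first exact: measurableT_comp.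
    rewrite (_ : (fun x => _) = (fun x => h x ^+ 2)) //.
    by apply/funext => x; rewrite real_normK ?num_real.
have Y0 j : \int[nu]_e (Y e * charlier_coef rho j (e a)) = 0.
  rewrite (_ : (fun e => _) = (fun e => rho ^+ j / j`!%:R * (h e * \prod_(b <- a :: A)
     charlier rho (if b == a then j else k b) (e b)))); last first.
    apply/funext => e; rewrite big_cons eqxx /Y /charlier_coef.
    have -> : \prod_(b <- A) charlier rho (if b == a then j else k b) (e b) =
       \prod_(b <- A) charlier rho (k b) (e b).
      rewrite big_seq [RHS]big_seq; apply: eq_bigr => b bA; case: eqP => // ba.
      by rewrite -ba bA in aA.
    by ring.
  rewrite RintegralZl // ?(H (fun b => if b == a then j else k b)) ?mulr0 //.
  apply: sqint_mul => //.
  have uaA : uniq (a :: A) by rewrite /= aA.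
  have := sqint_dualL rho0 hnu (points (site_config (a :: A) (fun b => if b == a then j else k b))).
  rewrite (_ : dualL _ _ = (fun e => \prod_(b <- a :: A) charlier rho (if b == a then j else k b) (e b))) //.
  by apply/funext => e; rewrite -dualD_points dualD_site_config.
have G1 m : 1 <= expR rho * 2 ^+ m.
  rewrite -[leLHS]mulr1; apply: ler_pM => //; first by rewrite -expR0 ler_expR ltW.
  by apply: exprn_ege1; rewrite ler1n.
(* The generating function of the Charlier coefficients at 1 - u. *)
have Yu (u : R) : 0 <= u <= 1 -> \int[nu]_e (Y e * u ^+ e a) = 0.
  case/andP => u0 u1.
  have := expansion_orth (charlier_expansion rho0) (measurable_coord a) mY IY Y0 (u := 1 - u).
  rewrite subr_ge0 u1 gerBl u0 => /(_ isT).
  rewrite (_ : (fun e => _) = (fun e : config d => expR (rho * (1 - u)) * (Y e * u ^+ e a))); last first.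
    by apply/funext => e; rewrite subKr; ring.
  rewrite RintegralZl //; last first.
    apply: integ_le IY.
      by apply: measurable_funM => //; exact: (mc a (fun m => u ^+ m)).
    move=> e; rewrite normrM; apply: ler_wpM2l => //.
    rewrite ger0_norm ?exprn_ge0 //; apply: (@le_trans _ _ 1); first exact: exprn_ile1.
    exact: G1.
  by move/eqP; rewrite mulf_eq0 gt_eqF ?expR_gt0 //= => /eqP.
have IY1 : integ nu (fun e => `|Y e| * 1).
  apply: integ_le IY; first by apply: measurable_funM => //; exact: measurableT_comp.
  move=> e; rewrite mulr1 normr_id -[leLHS]mulr1; apply: ler_wpM2l => //.
have [_ _ hb hs] := expansion_integral (indicator_expansion R) mY (measurable_coord a) IY1.
have Yn : \int[nu]_e (Y e * (n a == e a)%:R) = 0.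
  apply: (powser_coef_eq0 hb) => u u01.
  by have := hs u u01; rewrite Yu.
rewrite -[RHS]Yn; apply: eq_Rintegral => e _.
by rewrite /Y eq_sym; ring.
Qed.

(** The integral of h over every cylinder vanishes, hence over every measurable
    set. *)
Lemma dual_complete (h : config d -> R) : sqint nu h ->
  (forall xi : fconfig d, \int[nu]_e (h e * dualD rho xi e) = 0) ->
  \int[nu]_e (h e ^+ 2) = 0.
Proof.
move=> sh H; have Ih := sqint_integ sh.
have Hcyl (F : {fset Zd d}) n : (\int[nu]_(e in cyl F n) (h e)%:E = 0)%E.
  have H0 k : \int[nu]_e (h e * \prod_(a <- enum_fset F) charlier rho (k a) (e a)) = 0.
    rewrite -[RHS](H (site_config (enum_fset F) k)); apply: eq_Rintegral => e _.
    by rewrite dualD_site_config ?fset_uniq.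
  have E := orth_sites (fset_uniq F) sh H0 n.
  rewrite integral_mkcond (eq_integral (fun e => (h e * \prod_(a <- enum_fset F) (e a == n a)%:R)%:E)); last first.
    move=> e _; rewrite patchE; case: ifPn => [|].
      rewrite inE /= => he; rewrite big_seq big1 ?mulr1 // => a aF.
      by rewrite he // eqxx.
    rewrite notin_setE /= => he; suff -> : \prod_(a <- enum_fset F) ((e a == n a)%:R : R) = 0 by rewrite mulr0.
    apply/eqP; rewrite prodf_seq_eq0; apply: contra_notT he => /hasPn he x xF.
    by have := he x xF; rewrite /= pnatr_eq0 eqb0 negbK => /eqP.
  move: E; rewrite /Rintegral => E.
  rewrite -[LHS]fineK; first by rewrite E.
  have mm : measurable_fun setT (fun e : config d => h e * \prod_(a <- enum_fset F) (e a == n a)%:R).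
    apply: measurable_funM; first by case: sh.
    by apply: measurable_prod => a _; exact: (mc a (fun m => (m == n a)%:R)).
  suff I1 : integ nu (fun e : config d => h e * \prod_(a <- enum_fset F) (e a == n a)%:R).
    exact: integrable_fin_num I1.
  apply: integ_le (integ_norm Ih) => //.
  move=> e; rewrite normrM -[leRHS]mulr1; apply: ler_wpM2l => //.
  rewrite ger0_norm; last by apply: prodr_ge0 => a _.
  by apply: prodr_ile1 => a _; rewrite ler0n lern1 leq_b1.
have mh : measurable_fun setT h by case: sh.
have Hall S : measurable S -> (\int[nu]_(e in S) (h e)%:E = 0)%E.
  have HT : (\int[nu]_e (h e)%:E = 0)%E.
    rewrite -(Hcyl fset0 (fun=> 0%N)); congr (integral _ _ _).
    by apply/seteqP; split=> // e _ x; rewrite inE.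
  have IS U : measurable U -> nu.-integrable U (EFin \o h).
    by move=> mU; apply: integrableS Ih.
  move: S; apply: (@config_dynkin d (fun S => (\int[nu]_(e in S) (h e)%:E = 0)%E)) => //.
  - by rewrite integral_set0.
  - move=> U mU U0; have := HT; rewrite -(setUv U) integral_setU_EFin //; last 3 first.
    + exact: measurableC.
    + by rewrite setUv.
    + by apply/disj_setPS; rewrite setICr.
    by rewrite U0 add0e.
  - move=> F mF tF F0; rewrite integral_bigcup //; last exact/IS/bigcupT_measurable.
    by rewrite eseries0 // => k _ _; exact: F0.
have hae : ae_eq nu setT (EFin \o h) (cst 0%E).
  apply: integral_ae_eq => // E _ mE.
  by rewrite [LHS](Hall _ mE) integral0.
rewrite /Rintegral (ae_eq_integral (cst 0%E)) ?integral0 //.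
- by apply/measurable_EFinP; exact: measurable_funX.
- apply: filterS hae => e /(_ I) /= [-> _]; by rewrite expr0n.
Qed.
End completeness.

(** * Sums of a Schwartz function over a fine grid *)

(** (1 + i/N)^{-2} is at most N^2 (1/(N+i-1) - 1/(N+i)), which telescopes. *)
Lemma sum_inv_square_le (R : realType) (N L : nat) : (0 < N)%N ->
  \sum_(1 <= i < L.+1) (1 + i%:R / N%:R : R) ^- 2 <= N%:R.
Proof.
move=> N0; have N0' : (0 : R) < N%:R by rewrite ltr0n.
apply: (@le_trans _ _ (N%:R ^+ 2 * ((N%:R)^-1 - (N%:R + L%:R)^-1))); last first.
  rewrite mulrBr expr2 mulfK ?gt_eqF // gerBl; apply: mulr_ge0; first by rewrite mulr_ge0.
  by rewrite invr_ge0 addr_ge0.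
elim: L => [|L IH]; first by rewrite big_geq // addr0 subrr mulr0.
rewrite big_nat_recr //=; apply: (le_trans (lerD IH (lexx _))).
rewrite -natr1; move: (N%:R : R) N0' => n n0; have : (0 : R) <= L%:R by [].
move: (L%:R : R) => l l0.
have p1 : 0 < n + l by rewrite ltr_wpDr.
have p2 : 0 < n + (l + 1) by rewrite addrA ltr_wpDr.
rewrite -subr_ge0.
have -> : n ^+ 2 * (n^-1 - (n + (l + 1))^-1) - (n ^+ 2 * (n^-1 - (n + l)^-1) + (1 + (l + 1) / n) ^- 2) =
   n ^+ 2 / ((n + l) * (n + (l + 1)) ^+ 2).
  by field; rewrite !gt_eqF // addrA.
by rewrite divr_ge0 ?sqr_ge0 // mulr_ge0 ?sqr_ge0 // ltW.
Qed.

Lemma sum_sym_le (R : realType) (N L : nat) : (0 < N)%N ->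
  \sum_(j < L.*2.+1) (1 + (absz (j%:Z - L%:Z))%:R / N%:R : R) ^- 2 <= 3 * N%:R.
Proof.
move=> N0; pose g (i : nat) : R := (1 + i%:R / N%:R) ^- 2.
rewrite -(big_mkord xpredT (fun j => g (absz (j%:Z - L%:Z)))) /=.
rewrite (big_cat_nat (n := L)) //=; last by rewrite -addnn; lia.
rewrite (big_cat_nat (n := L.+1) (m := L)) //=; last by rewrite -addnn; lia.
rewrite big_nat1.
have g0 : g (absz (L%:Z - L%:Z)) = 1 by rewrite subrr /g absz0 mul0r addr0 expr1n invr1.
have s1 : \sum_(0 <= j < L) g (absz (j%:Z - L%:Z)) = \sum_(1 <= i < L.+1) g i.
  rewrite big_nat_rev /= add0n big_add1 /= !big_nat; apply: eq_bigr => i /andP[_ iL].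
  by congr g; lia.
have s2 : \sum_(L.+1 <= j < L.*2.+1) g (absz (j%:Z - L%:Z)) = \sum_(1 <= i < L.+1) g i.
  rewrite -[L.+1 in LHS]add1n big_addn (_ : (L.*2.+1 - L)%N = L.+1); last by rewrite -addnn; lia.
  by apply: eq_bigr => i _; congr g; lia.
have := @sum_inv_square_le R N L N0; rewrite -/g => h.
have N1 : (1 : R) <= N%:R by rewrite ler1n.
by rewrite s1 s2 g0; lra.
Qed.

(** |phi(y)| is at most C prod_i (1 + |y_i|)^{-2}, and the sum of this over a box
    factors into d one-dimensional sums, each at most 3 N. *)
Lemma schwartz_sum (R : realType) (d : nat) (phi : 'rV[R]_d -> R) : schwartz phi ->
  exists2 C : R, 0 <= C & (forall x, `|phi x| <= C) /\
   forall N (F : seq (Zd d)), (0 < N)%N -> uniq F ->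
   \sum_(x <- F) `|phi (N%:R^-1 *: embZ R x)| <= C * N%:R ^+ d.
Proof.
move=> [_ /(_ [::] d.*2)[C hC]]; rewrite /= in hC.
have C0 : 0 <= C by apply: le_trans (hC 0); rewrite mulr_ge0 // exprn_ge0 // addr_ge0.
have phiC x : `|phi x| <= C * \prod_(i < d) (1 + `|x 0 i|) ^- 2.
  have p0 : 0 < \prod_(i < d) (1 + `|x 0 i|) ^+ 2.
    by apply: prodr_gt0 => i _; rewrite exprn_gt0 // ltr_wpDr.
  rewrite prodfV -ler_pdivrMr ?invr_gt0 // invrK mulrC.
  apply: le_trans (hC x); apply: ler_wpM2r => //.
  have -> : (1 + `|x|) ^+ d.*2 = \prod_(i < d) (1 + `|x|) ^+ 2.
    by rewrite prodr_const card_ord -exprM mul2n.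
  apply: ler_prod => i _; rewrite exprn_ge0 ?addr_ge0 //=.
  apply: lerXn2r; rewrite ?nnegrE ?addr_ge0 // lerD2l.
  have -> : `|x| = mx_norm x by [].
  rewrite mx_normrE; exact: (le_bigmax _ (fun ij => `|x ij.1 ij.2|) (0, i)).
have CC : C <= C * 3 ^+ d by rewrite -[leLHS]mulr1 ler_wpM2l // exprn_ege1 // ler1n.
exists (C * 3 ^+ d); first by rewrite mulr_ge0 // exprn_ge0.
split=> [x|N F N0 uF].
  apply: le_trans CC; apply: le_trans (hC x); rewrite -[leLHS]mul1r ler_wpM2r //.
  by rewrite exprn_ege1 // lerDl.
pose g (i : nat) : R := (1 + i%:R / N%:R) ^- 2.
have g0 i : 0 <= g i by rewrite invr_ge0 exprn_ge0 // addr_ge0 // divr_ge0.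
have le1 (x : Zd d) : `|phi (N%:R^-1 *: embZ R x)| <= C * \prod_(i < d) g (absz (x 0 i)).
  apply: le_trans (phiC _) _; apply: ler_wpM2l => //.
  rewrite le_eqVlt; apply/orP; left; apply/eqP; apply: eq_bigr => i _.
  rewrite /g; congr ((1 + _) ^- 2); rewrite !mxE normrM normfV normr_nat mulrC; congr (_ / _).
  by rewrite -intr_norm -abszE.
have [L hL] : exists L, {subset F <= box d L}.
  exists (\max_(x <- F) \max_(i < d) absz (x ord0 i)) => x xF; apply: mem_box => i.
  rewrite -abszE lez_nat.
  apply: (@leq_trans (\max_(i < d) absz (x ord0 i))); first exact: (@leq_bigmax_cond _ xpredT (fun i : 'I_d => absz (x ord0 i)) i isT).
  exact: (@leq_bigmax_seq _ F xpredT (fun x : Zd d => \max_(i < d) absz (x ord0 i))%N x xF isT).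
apply: (@le_trans _ _ (\sum_(x <- box d L) C * \prod_(i < d) g (absz (x 0 i)))).
  apply: (@le_trans _ _ (\sum_(x <- F) C * \prod_(i < d) g (absz (x 0 i)))).
    exact: ler_sum.
  apply: ler_sum_subset => // x; rewrite mulr_ge0 //; exact: prodr_ge0.
rewrite -big_distrr /= -mulrA; apply: ler_wpM2l => //.
rewrite big_map big_enum /=.
rewrite (eq_bigr (fun f : {ffun 'I_d -> 'I_(L.*2.+1)} => \prod_(i < d) g (absz ((f i)%:Z - L%:Z)))); last first.
  by move=> f _; apply: eq_bigr => i _; rewrite mxE.
rewrite -(bigA_distr_bigA (fun (i : 'I_d) (j : 'I_(L.*2.+1)) => g (absz (j%:Z - L%:Z)))) /=.
rewrite -exprMn -[X in _ <= _ ^+ X]card_ord -prodr_const; apply: ler_prod => i _.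
by rewrite sumr_ge0 //=; exact: (@sum_sym_le R N L).
Qed.

(** * Law and duality of the walkers *)

Lemma measurable_shift d (x : Zd d) : measurable_fun setT (Defs.shift x : config d -> config d).
Proof.
apply: measurability; first exact: erefl.
move=> _ [_ [y [n ->]] <-]; rewrite setTI.
by rewrite (_ : Defs.shift x @^-1` _ = [set e : config d | e (y + x) = n]) //; exact: measurable_cyl1.
Qed.

Section shifts.
Context (R : realType) (d : nat) (rho : R).
Implicit Types (X : seq (Zd d)) (x : Zd d).

Let undup_shift X x : undup [seq y + x | y <- X] = [seq y + x | y <- undup X].
Proof. by rewrite undup_map_inj // => a b /addIr. Qed.

Let count_shift X x y : count_mem (y + x) [seq y + x | y <- X] = count_mem y X.
Proof. by rewrite count_map; apply: eq_count => z /=; rewrite (inj_eq (addIr x)). Qed.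

Lemma dualL_shift X x e : dualL rho X (Defs.shift x e) = dualL rho [seq y + x | y <- X] e.
Proof.
rewrite /dualL undup_shift big_map; apply: eq_bigr => y _.
by rewrite count_shift.
Qed.

Lemma kappa_shift X x : kappa rho [seq y + x | y <- X] = kappa rho X.
Proof.
by rewrite /kappa undup_shift big_map; apply: eq_bigr => y _; rewrite count_shift.
Qed.
End shifts.

Section walkers_duality.
Context (R : realType) (d : nat) (p : Zd d -> Zd d -> R) (hp : jump_kernel p)
  (rho : R) (rho0 : 0 < rho) (nu : probability (config d) R) (hnu : poisson_product rho nu)
  (dW : measure_display) (W : measurableType dW) (P : probability W R)
  (eta : R -> W -> config d) (heta : independent_walkers p nu P eta).

Lemma walkers_measurable t : 0 <= t -> measurable_fun setT (eta t).
Proof. by case: heta => h _; exact: h. Qed.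

Lemma walkers_joint_pgf (s t : R) (A B : seq (Zd d)) (U V : Zd d -> R) :
  0 <= s -> s <= t -> uniq A -> uniq B ->
  (forall a, 0 <= U a <= 1) -> (forall b, 0 <= V b <= 1) ->
  \int[P]_w (\prod_(a <- A) (1 - U a) ^+ eta s w a * \prod_(b <- B) (1 - V b) ^+ eta t w b) =
  expR (- (rho * (\sum_(a <- A) U a + \sum_(b <- B) V b -
    \sum_(a <- A) \sum_(b <- B) U a * V b * ptrans p (t - s) a b))).
Proof.
case: heta => meta [law0 [X [hX indep hc]]] s0 st uA uB U01 V01.
exact: (walkers_pgf hp rho0 hnu meta law0 hX indep s0 st uA uB U01 V01 hc).
Qed.

(** Stationarity: with B empty the two-time generating function is the Poisson one,
    and extracting the indicator coefficients gives the cylinder probabilities. *)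
Lemma walkers_law t : 0 <= t -> forall A, measurable A -> P (eta t @^-1` A) = nu A.
Proof.
move=> t0; have mt := walkers_measurable t0.
apply: (law_unique hnu mt) => F n.
have mc b : measurable_fun setT (fun w => eta t w b).
  exact: (measurableT_comp (measurable_coord b) mt).
have := @extract_coefs R _ W P _ _ _ (indicator_expansion R) _ (fun a w => eta t w a) (enum_fset F) (fun=> 1)
  unit [:: tt] (fun=> 1) (fun _ a k => poisson_pmf rho k) (fun _ a u => expR (- (rho * (1 - u)))).
move=> /(_ mc (measurable_cst _) (fset_uniq F) _ _ _ _ n).
rewrite big_seq1 mul1r => ext.
have E : \int[P]_w (1 * \prod_(b <- enum_fset F) (eta t w b == n b)%:R) =
    \prod_(b <- enum_fset F) poisson_pmf rho (n b).
  rewrite -ext; first by apply: eq_Rintegral => w _; congr (_ * _); apply: eq_bigr => b _; rewrite eq_sym.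
  - under eq_fun do rewrite big1 // mulr1; exact: integ_cst.
  - move=> _ _; exists (expR (- rho) * expR rho) => K.
    apply: (@le_trans _ _ (expR (- rho) * \sum_(0 <= k < K) (rho ^+ k / k`!%:R))).
      rewrite big_distrr /=; apply: ler_sum => k _.
      by rewrite ger0_norm ?poisson_pmf_ge0 // (poisson_pmfE rho0).
    by apply: ler_wpM2l; rewrite ?expR_ge0 //; exact: sum_exp_coeff_le (ltW rho0).
  - move=> _ _ u _.
    have -> : expR (- (rho * (1 - u))) = expR (- rho) * expR (rho * u).
      by rewrite -expRD; congr expR; ring.
    rewrite (_ : series _ = fun K => expR (- rho) * series (exp_coeff (rho * u)) K).
      by apply: cvgMr; exact: is_cvg_series_exp_coeff.
    apply/funext => K; rewrite /series /= big_distrr /=; apply: eq_bigr => k _.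
    by rewrite (poisson_pmfE rho0) /exp_coeff /= exprMn; ring.
  - move=> V V01.
    have V01' b : 0 <= 1 - V b <= 1 by have := V01 b; lra.
    have Z01 (b : Zd d) : (0 <= (0 : R)) && ((0 : R) <= 1) by rewrite lexx ler01.
    have := @walkers_joint_pgf t t (enum_fset F) [::] (fun a => 1 - V a) (fun=> 0) t0 (lexx t) (fset_uniq F) isT V01' Z01.
    have Z : \sum_(a <- enum_fset F) \sum_(b <- [::]) (1 - V a) * 0 * ptrans p (t - t) a b = 0.
      by rewrite big1 // => a _; rewrite big_nil.
    have Z0 : \sum_(b <- [::] : seq (Zd d)) (0 : R) = 0 by rewrite big_nil.
    rewrite Z Z0 subr0 addr0 => E; rewrite big_seq1 mul1r -expR_sum.
    transitivity (\int[P]_w (\prod_(a <- enum_fset F) (1 - (1 - V a)) ^+ eta t w a *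
        \prod_(b <- [::] : seq (Zd d)) 1 ^+ eta t w b)).
      apply: eq_Rintegral => w _; rewrite mul1r big_nil mulr1.
      by apply: eq_bigr => a _; rewrite subKr.
    by rewrite E; congr expR; rewrite subr0 mulr_sumr sumrN.
have mcylF := measurable_cyl F n.
have mpre : measurable (eta t @^-1` cyl F n) by rewrite -[X in measurable X]setTI; exact: mt.
rewrite -[LHS]fineK ?fin_num_measure // -[fine _](Rint_indic P mpre) -E; congr (_%:E).
apply: eq_Rintegral => w _; rewrite mul1r indicE.
have [h|h] := boolP (w \in _).
  rewrite big_seq big1 // => b bF; move: h; rewrite inE /= => ->//.
  by rewrite eqxx.
apply/esym/eqP; rewrite prodf_seq_eq0; move: h; rewrite notin_setE /=.
apply: contra_notT => /hasPn h b bF; have := h b bF.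
by rewrite /= pnatr_eq0 eqb0 negbK => /eqP.
Qed.

Lemma walkers_dualL (s t : R) X X' : 0 <= s -> s <= t ->
  \int[P]_w (dualL rho X (eta s w) * dualL rho X' (eta t w)) =
  kappa rho X' * if size X == size X' then
    \sum_(Y <- permutations X') \prod_(e <- zip X Y) ptrans p (t - s) e.1 e.2 else 0.
Proof.
move=> s0 st; have t0 := le_trans s0 st.
apply: (duality rho0 hnu (walkers_measurable s0) (walkers_measurable t0)
   (walkers_law s0) (walkers_law t0)) => A B U V uA uB U01 V01.
exact: walkers_joint_pgf.
Qed.

(** Orthogonality is duality at time difference zero, where the transition function
    is the identity. *)
Lemma dualL_orth X X' : \int[nu]_e (dualL rho X e * dualL rho X' e) =
  (perm_eq X X')%:R * kappa rho X'.
Proof.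
have z0 := lexx (0 : R).
have mm : measurable_fun setT (fun e : config d => dualL rho X e * dualL rho X' e).
  by apply: measurable_funM; exact: measurable_dualL.
rewrite -(Rint_law (walkers_measurable z0) (walkers_law z0) mm).
rewrite (walkers_dualL _ _ z0 z0) subrr mulrC; congr (_ * _).
have pz (Y : seq (Zd d)) : size X = size Y -> \prod_(e <- zip X Y) ptrans p 0 e.1 e.2 = (X == Y)%:R.
  move: Y; elim: X {mm} => [|a X1 IH] [|b Y] /=; rewrite ?big_nil //.
  move=> [/IH h]; rewrite big_cons h /= (ptrans0 hp) eqseq_cons.
  by case: (a == b); case: (X1 == Y); rewrite /= ?mulr1 ?mulr0.
case: eqP => [sX|sX]; last first.
  by rewrite (_ : perm_eq _ _ = false) //; apply/negP => /perm_size.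
have pz' : {in permutations X', forall Y, \prod_(e <- zip X Y) ptrans p 0 e.1 e.2 = (X == Y)%:R :> R}.
  by move=> Y; rewrite mem_permutations => pY; rewrite pz // sX (perm_size pY).
rewrite (eq_big_seq _ pz').
rewrite -mem_permutations.
have : uniq (permutations X') by exact: permutations_uniq.
elim: (permutations X') => [|Y s IH] /=; first by rewrite big_nil.
move=> /andP[Ys us]; rewrite big_cons IH // in_cons.
have [e|ne] := eqVneq X Y; last by rewrite add0r.
by rewrite e (negbTE Ys) addr0.
Qed.

Lemma sqnormD_kappa (xi : fconfig d) : sqnormD rho nu xi = kappa rho (points xi).
Proof.
rewrite /sqnormD /inner.
transitivity (\int[nu]_e (dualL rho (points xi) e * dualL rho (points xi) e)).
  by apply: eq_Rintegral => e _; rewrite -dualD_points.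
by rewrite dualL_orth perm_refl mul1r.
Qed.
End walkers_duality.

(** * Covariance of finite fields *)

Lemma Rint_bilinear (R : realType) dT (T : measurableType dT) (P : probability T R)
    (I : Type) (L : seq I) (a : I -> R) (D E : I -> T -> R) :
  (forall i, sqint P (D i)) -> (forall i, sqint P (E i)) ->
  \int[P]_x ((\sum_(i <- L) a i * D i x) * (\sum_(j <- L) a j * E j x)) =
  \sum_(i <- L) \sum_(j <- L) a i * a j * \int[P]_x (D i x * E j x).
Proof.
move=> sD sE.
have h i j : integ P (fun x => a i * a j * (D i x * E j x)) by apply: integZ; exact: sqint_mul.
transitivity (\int[P]_x (\sum_(i <- L) \sum_(j <- L) a i * a j * (D i x * E j x))).
  apply: eq_Rintegral => x _; rewrite big_distrlr /=.
  by apply: eq_bigr => i _; apply: eq_bigr => j _; rewrite mulrACA.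
rewrite Rint_sum; last by move=> i; apply: integ_sum.
apply: eq_bigr => i _; rewrite Rint_sum //.
by apply: eq_bigr => j _; rewrite RintegralZl //; exact: sqint_mul.
Qed.

Section covariance_bound.
Context (R : realType) (d : nat) (p : Zd d -> Zd d -> R) (hp : jump_kernel p)
  (rho : R) (rho0 : 0 < rho) (nu : probability (config d) R) (hnu : poisson_product rho nu)
  (dW : measure_display) (W : measurableType dW) (P : probability W R)
  (eta : R -> W -> config d) (heta : independent_walkers p nu P eta).

(** One sum over translates is controlled by [orbit_sum_le] after bounding psi by M,
    the other one by the total mass A of psi. *)
Lemma smeared_covariance_le (s t H M A : R) (psi : Zd d -> R) (F : seq (Zd d))
    (c : fconfig d -> R) (S : seq (fconfig d)) (k : nat) :
  0 <= s -> s <= t -> uniq F -> (forall i j, ptrans p (t - s) i j <= H) ->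
  (forall x, `|psi x| <= M) -> \sum_(x <- F) `|psi x| <= A ->
  (forall xi, c xi != 0 -> (k < mass xi)%N) ->
  \int[P]_w ((\sum_(x <- F) psi x * combo (dualD rho) c S (Defs.shift x (eta s w))) *
             (\sum_(x <- F) psi x * combo (dualD rho) c S (Defs.shift x (eta t w)))) <=
  A * M * ((k.+1 * k ^ k)%:R * H ^+ k) *
  \sum_(xi <- S) \sum_(xi' <- S) (mass xi == mass xi')%:R *
     (`|c xi * c xi'| * sqnormD rho nu xi').
Proof.
move=> s0 st uF pH psiM psiA cmass.
have t0 := le_trans s0 st.
pose X (i : fconfig d * Zd d) := [seq y + i.2 | y <- points i.1].
pose a (i : fconfig d * Zd d) := c i.1 * psi i.2.
pose L := [seq (xi, x) | xi <- S, x <- F].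
have E e : \sum_(x <- F) psi x * combo (dualD rho) c S (Defs.shift x e) =
    \sum_(i <- L) a i * dualL rho (X i) e.
  rewrite big_allpairs exchange_big /=; apply: eq_bigr => x _.
  rewrite /combo mulr_sumr; apply: eq_bigr => xi _.
  by rewrite dualD_points dualL_shift /a /= mulrCA mulrA.
have sq u : 0 <= u -> forall i, sqint P (fun w => dualL rho (X i) (eta u w)).
  move=> u0 i; apply: (sqint_law (walkers_measurable heta u0) (walkers_law hp rho0 hnu heta u0)).
  exact: sqint_dualL.
rewrite (_ : Rintegral _ _ _ = \int[P]_w ((\sum_(i <- L) a i * dualL rho (X i) (eta s w)) *
    (\sum_(i <- L) a i * dualL rho (X i) (eta t w)))); last first.
  by apply: eq_Rintegral => w _; rewrite !E.
rewrite (Rint_bilinear L a (sq _ s0) (sq _ t0)).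
rewrite big_allpairs mulr_sumr; apply: ler_sum => xi _.
have -> : \sum_(x <- F) \sum_(j <- L) a (xi, x) * a j *
     \int[P]_w (dualL rho (X (xi, x)) (eta s w) * dualL rho (X j) (eta t w)) =
   \sum_(xi' <- S) \sum_(x <- F) \sum_(x' <- F) a (xi, x) * a (xi', x') *
     \int[P]_w (dualL rho (X (xi, x)) (eta s w) * dualL rho (X (xi', x')) (eta t w)).
  by rewrite [RHS]exchange_big /=; apply: eq_bigr => x _; rewrite big_allpairs.
rewrite mulr_sumr; apply: ler_sum => xi' _.
have A0 : 0 <= A by apply: le_trans psiA; apply: sumr_ge0.
have M0 : 0 <= M := le_trans (normr_ge0 _) (psiM 0).
have q0 x y : 0 <= ptrans p (t - s) x y by apply: ptrans_ge0; rewrite ?subr_ge0.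
have H0 : 0 <= H := le_trans (q0 0 0) (pH 0 0).
have kap := sqnormD_kappa hp rho0 hnu heta xi'.
have kap0 : 0 < kappa rho (points xi') by exact: kappa_gt0.
have rhs0 : 0 <= A * M * ((k.+1 * k ^ k)%:R * H ^+ k) * ((mass xi == mass xi')%:R *
    (`|c xi * c xi'| * sqnormD rho nu xi')).
  rewrite kap; apply: mulr_ge0; first by rewrite !mulr_ge0 // exprn_ge0.
  by rewrite !mulr_ge0 // ltW.
have [z|nz] := eqVneq (c xi) 0.
  apply: le_trans rhs0; rewrite big1 // => x _; rewrite big1 // => x' _.
  by rewrite /a /= z !mul0r.
have cov x x' : \int[P]_w (dualL rho (X (xi, x)) (eta s w) * dualL rho (X (xi', x')) (eta t w)) =
   (mass xi == mass xi')%:R * (kappa rho (points xi') *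
   \sum_(Y <- permutations [seq y + x' | y <- points xi'])
     \prod_(e <- zip (X (xi, x)) Y) ptrans p (t - s) e.1 e.2).
  rewrite (walkers_dualL hp rho0 hnu heta _ _ s0 st) kappa_shift !size_map !size_points.
  by case: ifP => _; rewrite ?mul1r ?mul0r ?mulr0.
have [em|nem] := eqVneq (mass xi) (mass xi'); last first.
  rewrite mul0r mulr0 big1 // => x _; rewrite big1 // => x' _.
  by rewrite cov (negbTE nem) mul0r mulr0.
rewrite mul1r kap.
set B := (k.+1 * k ^ k)%:R * H ^+ k.
have orb x : \sum_(x' <- F) \sum_(Y <- permutations [seq y + x' | y <- points xi'])
     \prod_(e <- zip (X (xi, x)) Y) ptrans p (t - s) e.1 e.2 <= B.
  apply: orbit_sum_le => //.
  - by move=> z G uG; apply: ptrans_sum_le; rewrite ?subr_ge0.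
  - by rewrite size_map !size_points.
  - by rewrite size_map size_points; exact: cmass.
apply: (@le_trans _ _ (\sum_(x <- F) `|psi x| * (M * B * (`|c xi * c xi'| * kappa rho (points xi'))))); last first.
  rewrite -mulr_suml.
  have -> : A * M * B * (`|c xi * c xi'| * kappa rho (points xi')) =
    A * (M * B * (`|c xi * c xi'| * kappa rho (points xi'))) by ring.
  apply: ler_wpM2r psiA; rewrite !mulr_ge0 ?exprn_ge0 //; exact: ltW.
apply: ler_sum => x _.
pose Pm x' := \sum_(Y <- permutations [seq y + x' | y <- points xi'])
     \prod_(e <- zip (X (xi, x)) Y) ptrans p (t - s) e.1 e.2.
have Pm0 x' : 0 <= Pm x' by apply: sumr_ge0 => Y _; apply: prodr_ge0 => e _; exact: q0.
apply: (@le_trans _ _ (\sum_(x' <- F) `|psi x| * (M * (`|c xi * c xi'| * kappa rho (points xi'))) * Pm x')).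
  apply: ler_sum => x' _; rewrite cov em eqxx mul1r -/(Pm x') /a /=.
  apply: (le_trans (ler_norm _)); rewrite !normrM (gtr0_norm kap0) (ger0_norm (Pm0 x')).
  have -> : `|c xi| * `|psi x| * (`|c xi'| * `|psi x'|) * (kappa rho (points xi') * Pm x') =
    `|psi x'| * (`|c xi| * `|psi x| * `|c xi'| * (kappa rho (points xi') * Pm x')) by ring.
  have -> : `|psi x| * (M * (`|c xi| * `|c xi'| * kappa rho (points xi'))) * Pm x' =
    M * (`|c xi| * `|psi x| * `|c xi'| * (kappa rho (points xi') * Pm x')) by ring.
  apply: ler_wpM2r (psiM x'); rewrite !mulr_ge0 //; exact: ltW.
rewrite -mulr_sumr.
have -> : `|psi x| * (M * B * (`|c xi * c xi'| * kappa rho (points xi'))) =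
  `|psi x| * (M * (`|c xi * c xi'| * kappa rho (points xi'))) * B by ring.
apply: ler_wpM2l (orb x); rewrite !mulr_ge0 //; exact: ltW.
Qed.
End covariance_bound.

(** * Limits of covariances and sums over a countable set *)

Section limits.
Context (R : realType) (dT : measure_display) (T : measurableType dT) (P : probability T R).
Implicit Types U V f g h : T -> R.

(** Cauchy-Schwarz applied to the three terms of
    UV - U'V' = U (V - V') + (U - U') V - (U - U') (V - V'). *)
Lemma Rint_mul_limit U V (K : R) : sqint P U -> sqint P V ->
  (forall e : R, 0 < e -> exists U' V', [/\ sqint P U', sqint P V',
     \int[P]_x ((U x - U' x) ^+ 2) <= e, \int[P]_x ((V x - V' x) ^+ 2) <= e &
     \int[P]_x (U' x * V' x) <= K]) ->
  \int[P]_x (U x * V x) <= K.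
Proof.
move=> sU sV approx.
set u := \int[P]_x (U x ^+ 2); set v := \int[P]_x (V x ^+ 2).
have u0 : 0 <= u by apply: Rintegral_ge0 => x _; exact: sqr_ge0.
have v0 : 0 <= v by apply: Rintegral_ge0 => x _; exact: sqr_ge0.
have cs f g (a b z : R) : sqint P f -> sqint P g -> \int[P]_x (f x ^+ 2) <= a ->
    \int[P]_x (g x ^+ 2) <= b -> 0 <= z -> a * b <= z ^+ 2 -> `|\int[P]_x (f x * g x)| <= z.
  move=> sf sg fa gb z0 abz; rewrite -ler_sqr ?nnegrE // real_normK ?num_real //.
  apply: le_trans abz; apply: (le_trans (cauchy_schwarz sf sg)).
  by apply: ler_pM => //; apply: Rintegral_ge0 => x _; exact: sqr_ge0.
apply/ler_addgt0Pr => e e0.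
(* With distances at most D, the error is at most (u+1) D + (v+1) D + D. *)
pose D := Num.min 1 (e / (u + v + 3)).
have D0 : 0 < D by rewrite lt_min ltr01 divr_gt0 //; lra.
have D1 : D <= 1 by rewrite ge_min lexx.
have De : (u + v + 3) * D <= e.
  by rewrite mulrC -ler_pdivlMr ?ge_min ?lexx ?orbT //; lra.
have [U' [V' [sU' sV' hU hV hK]]] := approx (D ^+ 2) (exprn_gt0 2 D0).
have sdU := sqint_sub sU sU'; have sdV := sqint_sub sV sV'.
have h1 : `|\int[P]_x (U x * (V x - V' x))| <= (u + 1) * D.
  apply: (cs _ _ u (D ^+ 2)) => //; first by rewrite mulr_ge0 ?ltW //; lra.
  by rewrite exprMn ler_wpM2r ?sqr_ge0 //; nra.
have h2 : `|\int[P]_x ((U x - U' x) * V x)| <= (v + 1) * D.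
  apply: (cs _ _ (D ^+ 2) v) => //; first by rewrite mulr_ge0 ?ltW //; lra.
  by rewrite exprMn mulrC ler_wpM2r ?sqr_ge0 //; nra.
have h3 : `|\int[P]_x ((U x - U' x) * (V x - V' x))| <= D.
  apply: (cs _ _ (D ^+ 2) (D ^+ 2)) => //; first exact: ltW.
  by rewrite -[leRHS]mulr1 ler_wpM2l ?sqr_ge0 // expr_le1 // ltW.
have I1 := sqint_mul sU sdV; have I2 := sqint_mul sdU sV; have I3 := sqint_mul sdU sdV.
have I4 := sqint_mul sU' sV'.
have E : \int[P]_x (U x * V x) = \int[P]_x (U' x * V' x) + \int[P]_x (U x * (V x - V' x)) +
   \int[P]_x ((U x - U' x) * V x) - \int[P]_x ((U x - U' x) * (V x - V' x)).
  rewrite -RintegralD // -RintegralD //; last exact: integD.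
  rewrite -RintegralB //; last by apply: integD => //; exact: integD.
  by apply: eq_Rintegral => x _; ring.
move: h1 h2 h3; rewrite E !ler_norml => /andP[_ h1] /andP[_ h2] /andP[h3 _].
lra.
Qed.

(** Transfers L2 statements from the limit of a series to a measurable function
    that equals it almost everywhere. *)
Lemma sqint_ae f h : measurable_fun setT f -> sqint P h ->
  {ae P, forall x, f x = h x} ->
  sqint P f /\ forall g, measurable_fun setT g ->
    \int[P]_x ((f x - g x) ^+ 2) = \int[P]_x ((h x - g x) ^+ 2).
Proof.
move=> mf [mh Ih] fh.
split; first split=> //.
  move/integrableP : Ih => [_ hfin]; apply/integrableP; split.
    by apply/measurable_EFinP; exact: measurable_funX.
  rewrite (@ae_eq_integral _ _ _ P setT (fun x => `|(h x ^+ 2)%:E|%E)) //.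
  - by apply: measurableT_comp => //; apply/measurable_EFinP; exact: measurable_funX.
  - by apply: measurableT_comp => //; apply/measurable_EFinP; exact: measurable_funX.
  - by apply: filterS fh => x /= -> _.
move=> g mg; congr fine; apply: ae_eq_integral => //.
- by apply/measurable_EFinP; apply: measurable_funX; exact: measurable_funB.
- by apply/measurable_EFinP; apply: measurable_funX; exact: measurable_funB.
- by apply: filterS fh => x /= -> _.
Qed.
End limits.

Section enumerated_sums.
Context (R : realType) (T : countType).
Implicit Types u : T -> R.

Lemma sum_enum_upto u n : \sum_(x <- enum_upto T n) u x =
  \sum_(0 <= j < n) oapp u 0 (@choice.pickle_inv T j).
Proof. by rewrite /enum_upto big_pmap /index_iota subn0. Qed.

Lemma sum_enum_upto_nd u : (forall x, 0 <= u x) ->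
  {homo (fun n => \sum_(x <- enum_upto T n) u x) : m n / (m <= n)%N >-> m <= n}.
Proof.
move=> u0 m n mn; rewrite !sum_enum_upto (big_cat_nat (leq0n m) mn) /= lerDl sumr_ge0 // => j _.
by case: (choice.pickle_inv _) => /=.
Qed.

Lemma esum_enum_upto u : (forall x, 0 <= u x) ->
  \esum_(x in [set: T]) (u x)%:E =
  ereal_sup (range (fun n => (\sum_(x <- enum_upto T n) u x)%:E)).
Proof.
move=> u0; apply/eqP; rewrite eq_le; apply/andP; split.
  apply: ge_ereal_sup => _ [A [fA _] <-].
  rewrite fsbig_finite // sumEFin.
  have [N hN] := enum_upto_sub (enum_fset (fset_set A)).
  apply: (@le_trans _ _ (\sum_(x <- enum_upto T N) u x)%:E).
    by rewrite lee_fin; apply: ler_sum_subset => //; exact: hN.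
  by apply: ereal_sup_ubound; exists N.
apply: ge_ereal_sup => _ [n _ <-]; apply: ereal_sup_ubound.
exists [set` enum_upto T n]; first by split => //; exact: finite_seq.
by rewrite -fsbig_seq ?enum_upto_uniq // sumEFin.
Qed.

Lemma esum_enum_upto_cvg u (M : R) : (forall x, 0 <= u x) ->
  (forall n, \sum_(x <- enum_upto T n) u x <= M) ->
  \sum_(x <- enum_upto T n) u x @[n --> \oo] --> fine (\esum_(x in [set: T]) (u x)%:E).
Proof.
move=> u0 uM; have nd := sum_enum_upto_nd u0.
have ecv : (\sum_(x <- enum_upto T n) u x)%:E @[n --> \oo] --> \esum_(x in [set: T]) (u x)%:E.
  rewrite esum_enum_upto //; apply: ereal_nondecreasing_cvgn => m n mn.
  by rewrite lee_fin; exact: nd.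
have fin : \esum_(x in [set: T]) (u x)%:E \is a fin_num.
  rewrite ge0_fin_numE; last by apply: esum_ge0 => x _; rewrite lee_fin.
  apply: (@le_lt_trans _ _ M%:E); last exact: ltry.
  rewrite esum_enum_upto //; apply: ge_ereal_sup => _ [n _ <-].
  by rewrite lee_fin.
by move: ecv; rewrite -{1}(fineK fin) => /fine_cvg.
Qed.

(** Connects the sum of a family, defined by positive and negative parts, with
    limits along the enumeration. *)
Lemma rsum_cvg u (M h : R) : (forall n, \sum_(x <- enum_upto T n) `|u x| <= M) ->
  \sum_(x <- enum_upto T n) u x @[n --> \oo] --> h -> rsum u = h.
Proof.
move=> uM cv.
have p0 (v : T -> R) x : 0 <= Num.max (v x) 0 by rewrite le_max lexx orbT.
have pM (v : T -> R) : (forall x, v x <= `|u x|) -> forall n, \sum_(x <- enum_upto T n) Num.max (v x) 0 <= M.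
  by move=> vu n; apply: le_trans (uM n); apply: ler_sum => x _; rewrite ge_max vu normr_ge0.
have c1 := esum_enum_upto_cvg (p0 u) (pM u (fun x => ler_norm _)).
have Nu x : - u x <= `|u x| by rewrite -normrN ler_norm.
have c2 := esum_enum_upto_cvg (p0 (fun x => - u x)) (pM (fun x => - u x) Nu).
apply: (@cvg_unique _ _ _ _ _ _ _ cv) => //.
have -> : (fun n => \sum_(x <- enum_upto T n) u x) = (fun n =>
   \sum_(x <- enum_upto T n) Num.max (u x) 0 - \sum_(x <- enum_upto T n) Num.max (- u x) 0).
  apply/funext => n; rewrite -sumrB; apply: eq_bigr => x _.
  by case: (leP (u x) 0) => h1; case: (leP (- u x) 0) => h2; lra.
exact: cvgB.
Qed.

Lemma measurable_rsum dW (W : measurableType dW) (u : W -> T -> R) :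
  (forall x, measurable_fun setT (u ^~ x)) -> measurable_fun setT (fun w => rsum (u w)).
Proof.
move=> mu.
have h (v : W -> T -> R) : (forall x, measurable_fun setT (v ^~ x)) ->
    measurable_fun setT (fun w => fine (\esum_(i in [set: T]) (Num.max (v w i) 0)%:E)).
  move=> mv.
  rewrite (_ : (fun w => _) = fine \o (fun w => esups (fun n => (\sum_(x <- enum_upto T n) Num.max (v w x) 0)%:E) 0)).
    apply: (measurableT_comp (fine_measurable measurableT)).
    apply: measurable_fun_esups => n; apply/measurable_EFinP.
    apply: measurable_sum => x; apply: measurable_maxr => //; exact: mv.
  apply/funext => w /=; congr fine; rewrite esum_enum_upto; last by move=> x; rewrite le_max lexx orbT.
  congr ereal_sup; apply/seteqP; split => [_ [n _ <-]|_ [n _ <-]]; by exists n.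
apply: measurable_funB; first exact: h.
by apply: (h (fun w x => - u w x)) => x; exact: measurable_funN.
Qed.
End enumerated_sums.

(** * Fields as limits of finite fields *)

Section smeared_fields.
Context (R : realType) (d : nat) (rho : R) (nu : probability (config d) R)
  (hnu : poisson_product rho nu).
Implicit Types g h q : config d -> R.

Lemma shift_law (x : Zd d) A : measurable A -> nu (Defs.shift x @^-1` A) = nu A.
Proof.
move=> mA; apply: (law_unique hnu (measurable_shift x)) mA => F n.
have -> : Defs.shift x @^-1` cyl F n =
    [set e : config d | forall z, z \in [fset (y + x)%R | y in F]%fset -> e z = n (z - x)].
  apply/seteqP; split => e /= H.
    by move=> _ /imfsetP[y /= yF ->]; rewrite addrK -H.
  by move=> y yF; rewrite /Defs.shift H ?addrK //; apply/imfsetP; exists y.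
rewrite hnu big_imfset /=; last by move=> a b _ _ /addIr.
by congr (_%:E); apply: eq_bigr => y _; rewrite addrK.
Qed.

Lemma sqint_shift g x : sqint nu g -> sqint nu (fun e => g (Defs.shift x e)).
Proof. exact: (sqint_law (measurable_shift x) (shift_law x)). Qed.

Lemma Rint_shift (g : config d -> R) x : measurable_fun setT g ->
  \int[nu]_e g (Defs.shift x e) = \int[nu]_e g e.
Proof. exact: (Rint_law (measurable_shift x) (shift_law x)). Qed.

Context (psi : Zd d -> R) (A : R) (psiA : forall F, uniq F -> \sum_(x <- F) `|psi x| <= A).

Let A0 : 0 <= A.
Proof. by have := psiA (isT : uniq [::]); rewrite big_nil. Qed.

Lemma sqint_smear g F : sqint nu g -> sqint nu (fun e => \sum_(x <- F) psi x * g (Defs.shift x e)).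
Proof. by move=> sg; apply: sqint_sum => x; apply: sqintZ; exact: sqint_shift. Qed.

Lemma smear_sq_le h F : sqint nu h -> uniq F ->
  \int[nu]_e ((\sum_(x <- F) psi x * h (Defs.shift x e)) ^+ 2) <= A ^+ 2 * \int[nu]_e (h e ^+ 2).
Proof.
move=> sh uF; have [mh Ih] := sh.
have Is x : integ nu (fun e => `|psi x| * h (Defs.shift x e) ^+ 2).
  by apply: integZ; have [] := sqint_shift x sh.
have i0 : 0 <= \int[nu]_e (h e ^+ 2) by apply: Rintegral_ge0 => x _; exact: sqr_ge0.
apply: (@le_trans _ _ (\int[nu]_e (A * \sum_(x <- F) `|psi x| * h (Defs.shift x e) ^+ 2))).
  apply: le_Rintegral => //.
  - by have [] := sqint_smear F sh.
  - by apply: integZ; exact: integ_sum.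
  move=> e _.
  have s0 x : 0 <= `|psi x| * h (Defs.shift x e) ^+ 2 by rewrite mulr_ge0 // sqr_ge0.
  have rws x : (psi x * h (Defs.shift x e)) ^+ 2 <= `|psi x| * (`|psi x| * h (Defs.shift x e) ^+ 2).
    by rewrite mulrA -expr2 real_normK ?num_real // exprMn.
  apply: (@le_trans _ _ ((\sum_(x <- F) `|psi x * h (Defs.shift x e)|) ^+ 2)).
    rewrite -real_normK ?num_real //; apply: lerXn2r; rewrite ?nnegrE ?sumr_ge0 //.
    exact: ler_norm_sum.
  apply: (le_trans (cauchy_schwarz_weights F (fun x => normr_ge0 (psi x)) s0 rws)).
  by apply: ler_wpM2r; [apply: sumr_ge0|exact: psiA].
rewrite RintegralZl //; last exact: integ_sum.
rewrite Rint_sum // expr2 -mulrA; apply: ler_wpM2l => //.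
rewrite (eq_bigr (fun x => `|psi x| * \int[nu]_e (h e ^+ 2))).
  by rewrite -mulr_suml ler_wpM2r // psiA.
move=> x _; rewrite RintegralZl //; last by have [] := sqint_shift x sh.
by rewrite (Rint_shift x (measurable_funX 2 mh)).
Qed.

(** The series of the field converges in L2 because psi is summable and the
    translates of g have the same norm: take w = |psi| and s = |psi| g^2 in
    [L2series_cvg]. *)
Lemma smeared_field g : sqint nu g ->
  sqint nu (fun e => rsum (fun x => g (Defs.shift x e) * psi x)) /\
  forall ep : R, 0 < ep -> exists F, uniq F /\
    \int[nu]_e ((rsum (fun x => g (Defs.shift x e) * psi x)
       - \sum_(x <- F) psi x * g (Defs.shift x e)) ^+ 2) <= ep.
Proof.
move=> sg; have [mg Ig] := sg.
pose pk := @choice.pickle_inv (Zd d).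
pose r j e : R := oapp (fun x => psi x * g (Defs.shift x e)) 0 (pk j).
pose w j : R := oapp (fun x => `|psi x|) 0 (pk j).
pose s j e : R := oapp (fun x => `|psi x| * g (Defs.shift x e) ^+ 2) 0 (pk j).
have E n e : \sum_(x <- enum_upto (Zd d) n) psi x * g (Defs.shift x e) = series (r ^~ e) n.
  by rewrite sum_enum_upto.
have mr j : measurable_fun setT (r j).
  rewrite /r; case: (pk j) => [x|] /=; last exact: measurable_cst.
  by apply: measurable_funM => //; have [] := sqint_shift x sg.
have Is j : integ nu (s j).
  rewrite /s; case: (pk j) => [x|] /=; last exact: integ_cst.
  by apply: integZ; have [] := sqint_shift x sg.
have s0 j e : 0 <= s j e.
  by rewrite /s; case: (pk j) => [x|] //=; rewrite mulr_ge0 // sqr_ge0.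
have w0 j : 0 <= w j by rewrite /w; case: (pk j) => [x|] //=.
have rws j e : r j e ^+ 2 <= w j * s j e.
  rewrite /r /w /s; case: (pk j) => [x|] /=; last by rewrite expr0n mul0r.
  by rewrite mulrA -expr2 real_normK ?num_real // exprMn.
have wA n : \sum_(0 <= j < n) w j <= A.
  by rewrite -sum_enum_upto; apply: psiA; exact: enum_upto_uniq.
have sK n : \sum_(0 <= j < n) \int[nu]_e s j e <= A * \int[nu]_e (g e ^+ 2).
  have -> : \sum_(0 <= j < n) \int[nu]_e s j e = (\sum_(0 <= j < n) w j) * \int[nu]_e (g e ^+ 2).
    rewrite mulr_suml; apply: eq_bigr => j _; rewrite /s /w; case: (pk j) => [x|] /=.
      rewrite RintegralZl //; last by have [] := sqint_shift x sg.
      by rewrite (Rint_shift x (measurable_funX 2 mg)).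
    by rewrite mul0r Rint_cst.
  by apply: ler_wpM2r => //; apply: Rintegral_ge0 => x _; exact: sqr_ge0.
have [h [sh hae hcv]] := L2series_cvg mr Is s0 w0 rws wA sK.
pose fld e := rsum (fun x => g (Defs.shift x e) * psi x).
have mfld : measurable_fun setT fld.
  apply: measurable_rsum => x; apply: measurable_funM => //.
  by have [] := sqint_shift x sg.
have fh : {ae nu, forall e, fld e = h e}.
  apply: filterS hae => e [[M hM] cv].
  apply: (@rsum_cvg _ _ _ M) => [n|].
    rewrite sum_enum_upto; apply: le_trans (hM n); apply: ler_sum => j _.
    by rewrite /r /pk; case: (choice.pickle_inv _) => [x|] /=; rewrite ?normr0 // mulrC.
  rewrite (_ : (fun n => _) = series (r ^~ e)) //.
  by apply/funext => n; rewrite -E; apply: eq_bigr => x _; rewrite mulrC.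
have [sfld hfld] := sqint_ae mfld sh fh.
split=> // ep ep0.
have /cvgrPdist_le/(_ ep ep0)[N _ hN] := hcv.
exists (enum_upto (Zd d) N); split; first exact: enum_upto_uniq.
rewrite hfld; last by have [] := sqint_smear (enum_upto (Zd d) N) sg.
have := hN N (leqnn N); rewrite sub0r normrN ger0_norm; last first.
  by apply: Rintegral_ge0 => x _; exact: sqr_ge0.
by apply: le_trans; rewrite le_eqVlt; apply/orP; left; apply/eqP; apply: eq_Rintegral => e _; rewrite E.
Qed.

Lemma smeared_field_approx g q (ep : R) : sqint nu g -> sqint nu q -> 0 < ep ->
  A ^+ 2 * \int[nu]_e ((g e - q e) ^+ 2) <= ep ->
  exists F, uniq F /\
    \int[nu]_e ((rsum (fun x => g (Defs.shift x e) * psi x)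
       - \sum_(x <- F) psi x * q (Defs.shift x e)) ^+ 2) <= 4 * ep.
Proof.
move=> sg sq ep0 gq; have [sX hX] := smeared_field sg.
have [F [uF hF]] := hX _ ep0; exists F; split => //.
have sgq := sqint_sub sg sq.
have s1 := sqint_sub sX (sqint_smear F sg).
have s2 := sqint_smear F sgq.
have [_ I1] := s1; have [_ I2] := s2.
have [_ I3] := sqint_sub sX (sqint_smear F sq).
apply: (@le_trans _ _ (\int[nu]_e (2 * (rsum (fun x => g (Defs.shift x e) * psi x)
       - \sum_(x <- F) psi x * g (Defs.shift x e)) ^+ 2 +
     2 * (\sum_(x <- F) psi x * (g (Defs.shift x e) - q (Defs.shift x e))) ^+ 2))).
  apply: le_Rintegral => //.
    by apply: integD; exact: integZ.
  move=> e _.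
  have -> : \sum_(x <- F) psi x * (g (Defs.shift x e) - q (Defs.shift x e)) =
    \sum_(x <- F) psi x * g (Defs.shift x e) - \sum_(x <- F) psi x * q (Defs.shift x e).
    by rewrite -sumrB; apply: eq_bigr => x _; rewrite mulrBr.
  move: (rsum _) (\sum_(x <- F) psi x * g _) (\sum_(x <- F) psi x * q _) => a b c.
  have := sqr_ge0 (a - b - (b - c)); nra.
rewrite RintegralD ?RintegralZl //; [|exact: integZ|exact: integZ].
have := smear_sq_le sgq uF; lra.
Qed.
End smeared_fields.

(** * Covariance of the field of a residual *)

Lemma Lnorm2_lt_sq (R : realType) dT (T : measurableType dT) (P : probability T R)
    (h : T -> R) (e : R) :
  ('N[P]_(2%:E)[EFin \o h] < e%:E)%E -> \int[P]_x (h x ^+ 2) <= e ^+ 2.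
Proof.
move=> he; have N0 := Lnorm_ge0 P 2%:E (EFin \o h).
have E := poweR_Lnorm P (EFin \o h) (ltac:(by rewrite pnatr_eq0) : (2 : R) != 0).
have fin : ('N[P]_(2%:E)[EFin \o h])%E \is a fin_num.
  by rewrite ge0_fin_numE // (lt_trans he) ?ltry.
move: E he N0; rewrite -(fineK fin); move: (fine _) => n E; rewrite lte_fin lee_fin => ne n0.
have -> : \int[P]_x (h x ^+ 2) = n ^+ 2.
  rewrite /Rintegral; transitivity (fine (n%:E `^ 2)%E).
    rewrite E; congr fine; apply: eq_integral => x _ /=.
    by rewrite powR_mulrn // real_normK ?num_real.
  by rewrite poweR_EFin /= powR_mulrn.
by rewrite ler_sqr ?nnegrE // ltW // (le_lt_trans n0).
Qed.

Section field_covariance.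
Context (R : realType) (d : nat) (p : Zd d -> Zd d -> R) (hp : jump_kernel p)
  (rho : R) (rho0 : 0 < rho) (nu : probability (config d) R) (hnu : poisson_product rho nu)
  (dW : measure_display) (W : measurableType dW) (P : probability W R)
  (eta : R -> W -> config d) (heta : independent_walkers p nu P eta).
Implicit Types f g h : config d -> R.

Lemma sqint_dualD (xi : fconfig d) : sqint nu (dualD rho xi).
Proof.
have -> : dualD rho xi = dualL rho (points xi) by apply/funext => e; rewrite dualD_points.
exact: sqint_dualL.
Qed.

Lemma dualD_orth (xi xi' : fconfig d) :
  \int[nu]_e (dualD rho xi e * dualD rho xi' e) = (xi == xi')%:R * sqnormD rho nu xi.
Proof.
transitivity (\int[nu]_e (dualL rho (points xi) e * dualL rho (points xi') e)).
  by apply: eq_Rintegral => e _; rewrite !dualD_points.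
rewrite (dualL_orth hp rho0 hnu heta) perm_points.
by case: eqP => [->|]; rewrite ?mul0r // (sqnormD_kappa hp rho0 hnu heta).
Qed.

Lemma sqnormD_gt0 (xi : fconfig d) : 0 < sqnormD rho nu xi.
Proof. by rewrite (sqnormD_kappa hp rho0 hnu heta); exact: kappa_gt0. Qed.

Lemma inH_dualD n (xi : fconfig d) : (mass xi <= n)%N -> inH rho nu n (dualD rho xi).
Proof.
move=> xin; split; first by apply/sqint_Lfun; exact: sqint_dualD.
move=> e e0; exists [:: xi], (fun=> 1); split; first by move=> z; rewrite inE => /eqP ->.
rewrite (_ : EFin \o _ = cst 0%E) ?Lnorm0 ?lte_fin //.
by apply/funext => x /=; rewrite big_seq1 mul1r subrr.
Qed.

(** h is approximated by combinations of polynomials of lower degree, which are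
    orthogonal to D(xi, .). *)
Lemma inH_orth n h (xi : fconfig d) : inH rho nu n h -> (n < mass xi)%N ->
  \int[nu]_e (h e * dualD rho xi e) = 0.
Proof.
move=> [/sqint_Lfun sh happ] nxi.
set I := \int[nu]_e _; set a := sqnormD rho nu xi.
have a0 : 0 < a := sqnormD_gt0 xi.
have bnd e : 0 < e -> I ^+ 2 <= a * e ^+ 2.
  move=> e0; have [S [c [Sn hS]]] := happ e e0.
  have ss : sqint nu (fun x => \sum_(z <- S) c z * dualD rho z x).
    by apply: sqint_sum => z; apply: sqintZ; exact: sqint_dualD.
  have -> : I = \int[nu]_x ((h x - \sum_(z <- S) c z * dualD rho z x) * dualD rho xi x).
    transitivity (I - \int[nu]_x ((\sum_(z <- S) c z * dualD rho z x) * dualD rho xi x)).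
      rewrite (_ : \int[nu]_x ((\sum_(z <- S) _) * _) = 0) ?subr0 //.
      transitivity (\int[nu]_x (\sum_(z <- S) c z * (dualD rho z x * dualD rho xi x))).
        by apply: eq_Rintegral => x _; rewrite mulr_suml; apply: eq_bigr => z _; rewrite mulrA.
      have iz z : integ nu (fun x => dualD rho z x * dualD rho xi x).
        by apply: sqint_mul; exact: sqint_dualD.
      rewrite Rint_sum; last by move=> z; exact: integZ.
      rewrite big_seq big1 // => z zS; rewrite RintegralZl // dualD_orth.
      rewrite (_ : z == xi = false) ?mul0r ?mulr0 //.
      by apply/negP => /eqP zx; move: (Sn z zS); rewrite zx leqNgt nxi.
    rewrite /I -RintegralB //; [|exact: sqint_mul sh (sqint_dualD xi)|exact: sqint_mul ss (sqint_dualD xi)].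
    by apply: eq_Rintegral => x _; rewrite mulrBl.
  apply: (le_trans (cauchy_schwarz (sqint_sub sh ss) (sqint_dualD xi))).
  rewrite mulrC (_ : \int[nu]_x (dualD rho xi x ^+ 2) = a); last first.
    by apply: eq_Rintegral => x _; rewrite expr2.
  by apply: ler_wpM2l; [exact: ltW|exact: Lnorm2_lt_sq].
apply/eqP; rewrite -sqrf_eq0 eq_le sqr_ge0 andbT; apply/ler_addgt0Pr => e e0.
rewrite add0r; pose z := Num.min 1 (e / a).
have z0 : 0 < z by rewrite lt_min ltr01 divr_gt0.
have z1 : z <= 1 by rewrite ge_min lexx.
have za : a * z <= e by rewrite mulrC -ler_pdivlMr // ge_min lexx orbT.
apply: (le_trans (bnd z z0)); apply: le_trans za; rewrite ler_pM2l //.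
by rewrite expr2 -[leRHS]mulr1 ler_pM2l.
Qed.

Context f fk (hf : inL2 nu f) (k : nat) (hfk : is_projH rho nu k f fk).

Lemma sqint_residual : sqint nu (f \- fk).
Proof.
by apply: sqint_sub; apply/sqint_Lfun => //; case: hfk => [[]].
Qed.

(** Subtracting the projection removes the coefficients of degree at most k and
    keeps the others. *)
Lemma residual_coef (xi : fconfig d) : \int[nu]_e ((f \- fk) e * dualD rho xi e) / sqnormD rho nu xi =
  (k < mass xi)%:R * Defs.coefD rho nu f xi.
Proof.
have [kx|xk] := ltnP k (mass xi); last first.
  have [_ /(_ _ (inH_dualD xk))] := hfk; rewrite /inner => ->.
  by rewrite !mul0r.
rewrite mul1r /Defs.coefD /inner; congr (_ / _).
have [h1 _] := hfk; have [/sqint_Lfun sfk _] := h1.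
rewrite -[RHS]subr0 -(inH_orth h1 kx) -RintegralB //.
- by apply: eq_Rintegral => e _; rewrite mulrBl.
- by apply: sqint_mul; [exact/sqint_Lfun|exact: sqint_dualD].
- by apply: sqint_mul => //; exact: sqint_dualD.
Qed.

Lemma coef_pair_sum_le (S : seq (fconfig d)) : coef_summable rho nu f -> uniq S ->
  \sum_(xi <- S) \sum_(xi' <- S) (mass xi == mass xi')%:R *
     (`|Defs.coefD rho nu f xi * Defs.coefD rho nu f xi'| * sqnormD rho nu xi') <=
  fine (\esum_(q in [set q : fconfig d * fconfig d | mass q.1 = mass q.2])
     (`|Defs.coefD rho nu f q.1 * Defs.coefD rho nu f q.2| * sqnormD rho nu q.2)%:E).
Proof.
move=> fin uS.
pose F (q : fconfig d * fconfig d) := `|Defs.coefD rho nu f q.1 * Defs.coefD rho nu f q.2| * sqnormD rho nu q.2.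
have F0 q : 0 <= F q by rewrite mulr_ge0 // ltW // sqnormD_gt0.
pose L := [seq q <- [seq (xi, xi') | xi <- S, xi' <- S] | mass q.1 == mass q.2].
have uL : uniq L by apply: filter_uniq; apply: allpairs_uniq => // -[a b] [a' b'] _ _ /=.
have -> : \sum_(xi <- S) \sum_(xi' <- S) (mass xi == mass xi')%:R *
     (`|Defs.coefD rho nu f xi * Defs.coefD rho nu f xi'| * sqnormD rho nu xi') = \sum_(q <- L) F q.
  rewrite big_filter [RHS]big_mkcond big_allpairs /=.
  apply: eq_bigr => xi _; apply: eq_bigr => xi' _.
  by case: ifP => _; rewrite ?mul1r ?mul0r.
rewrite -lee_fin fineK; last first.
  by rewrite ge0_fin_numE //; apply: esum_ge0 => q _; rewrite lee_fin; exact: F0.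
apply: esum_ge; exists [set` L].
  by split; [exact: finite_seq|move=> q /=; rewrite mem_filter => /andP[/eqP]].
by rewrite -fsbig_seq // sumEFin.
Qed.

Context (hsum : coef_summable rho nu f) (phi : 'rV[R]_d -> R) (hphi : schwartz phi).

Lemma sqint_field N t : (0 < N)%N -> 0 <= t ->
  sqint P (fun w => field_X N (f \- fk) (eta t w) phi).
Proof.
move=> N0 t0; have [C C0 [_ hC]] := schwartz_sum hphi.
have [sX _] := smeared_field hnu (fun F uF => hC N F N0 uF) sqint_residual.
exact: (sqint_law (walkers_measurable heta t0) (walkers_law hp rho0 hnu heta t0) sX).
Qed.

(** The field is replaced by finite sums of finite combinations of D(xi, .) with
    more than k points, to which [smeared_covariance_le] applies with M = C and
    A = C N^d. *)
Lemma field_covariance_le : exists2 K : R, 0 <= K &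
  forall N (s t H : R), (0 < N)%N -> 0 <= s -> s <= t -> (forall i j, ptrans p (t - s) i j <= H) ->
  \int[P]_w (field_X N (f \- fk) (eta s w) phi * field_X N (f \- fk) (eta t w) phi) <=
  K * N%:R ^+ d * H ^+ k.
Proof.
have [C C0 [phiC hC]] := schwartz_sum hphi.
set Kf := fine (\esum_(q in [set q : fconfig d * fconfig d | mass q.1 = mass q.2])
     (`|Defs.coefD rho nu f q.1 * Defs.coefD rho nu f q.2| * sqnormD rho nu q.2)%:E).
have Kf0 : 0 <= Kf.
  apply: fine_ge0; apply: esum_ge0 => q _; rewrite lee_fin mulr_ge0 // ltW //; exact: sqnormD_gt0.
exists (C * C * (k.+1 * k ^ k)%:R * Kf); first by rewrite !mulr_ge0.
move=> N s t H N0 s0 st pH; have t0 := le_trans s0 st.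
pose psi (x : Zd d) := phi (N%:R^-1 *: embZ R x).
have psiA F : uniq F -> \sum_(x <- F) `|psi x| <= C * N%:R ^+ d by exact: hC.
have A0 : 0 <= C * N%:R ^+ d by rewrite mulr_ge0 // exprn_ge0.
have H0 : 0 <= H by apply: le_trans (pH 0 0); apply: ptrans_ge0; rewrite ?subr_ge0.
have ms u := walkers_measurable heta (t := u); have ls u := walkers_law hp rho0 hnu heta (t := u).
have sg := sqint_residual.
apply: (Rint_mul_limit (sqint_field N0 s0) (sqint_field N0 t0)) => e e0.
pose c xi := \int[nu]_x ((f \- fk) x * dualD rho xi x) / sqnormD rho nu xi.
(* The field multiplies distances by at most C N^d. *)
have D0 : 0 < e / 4 / ((C * N%:R ^+ d) ^+ 2 + 1).
  by rewrite !divr_gt0 // ltr_wpDl // sqr_ge0.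
have [S [uS hS]] := combo_approx sqnormD_gt0 sqint_dualD
   (fun i j => dualD_orth i j) (fun h => dual_complete rho0 hnu (h := h)) sg D0.
have sq : sqint nu (combo (dualD rho) c S) := sqint_combo sqint_dualD c S.
have e4 : 0 < e / 4 by rewrite divr_gt0.
have [|F [uF hF]] := smeared_field_approx hnu psiA sg sq e4.
  apply: (@le_trans _ _ ((C * N%:R ^+ d) ^+ 2 * (e / 4 / ((C * N%:R ^+ d) ^+ 2 + 1)))).
    by apply: ler_wpM2l; rewrite ?sqr_ge0.
  have B0 : 0 < (C * N%:R ^+ d) ^+ 2 + 1 by rewrite ltr_wpDl ?sqr_ge0.
  rewrite mulrA ler_pdivrMr // mulrC; apply: ler_wpM2l; first exact: ltW.
  by rewrite lerDl.
pose Q x := \sum_(z <- F) psi z * combo (dualD rho) c S (Defs.shift z x).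
have sQ : sqint nu Q by exact: (sqint_smear hnu).
have fQ u : 0 <= u -> \int[P]_w ((field_X N (f \- fk) (eta u w) phi - Q (eta u w)) ^+ 2) <= e.
  move=> u0.
  have [mX _] := smeared_field hnu psiA sg.
  have [mm _] := sqint_sub mX sQ.
  rewrite (Rint_law (ms u u0) (ls u u0) (measurable_funX 2 mm)).
  by apply: (le_trans hF); rewrite mulrC divfK.
exists (fun w => Q (eta s w)), (fun w => Q (eta t w)); split.
- exact: (sqint_law (ms s s0) (ls s s0) sQ).
- exact: (sqint_law (ms t t0) (ls t t0) sQ).
- exact: fQ.
- exact: fQ.
have cz xi : c xi = (k < mass xi)%:R * Defs.coefD rho nu f xi by exact: residual_coef.
have cm xi : c xi != 0 -> (k < mass xi)%N.
  by rewrite cz; case: (k < mass xi)%N; rewrite // mul0r eqxx.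
apply: (le_trans (smeared_covariance_le hp rho0 hnu heta S s0 st uF pH (fun x => phiC _) (psiA F uF) cm)).
have -> : C * C * (k.+1 * k ^ k)%:R * Kf * N%:R ^+ d * H ^+ k =
   C * N%:R ^+ d * C * ((k.+1 * k ^ k)%:R * H ^+ k) * Kf by ring.
apply: ler_wpM2l; first by rewrite !mulr_ge0 // exprn_ge0.
apply: le_trans (coef_pair_sum_le hsum uS).
apply: ler_sum => xi _; apply: ler_sum => xi' _; apply: ler_wpM2l => //.
apply: ler_wpM2r; first by rewrite ltW // sqnormD_gt0.
rewrite !cz !normrM; apply: ler_pM => //.
  by case: (k < mass xi)%N; rewrite ?normr1 ?mul1r // normr0 mul0r.
by case: (k < mass xi')%N; rewrite ?normr1 ?mul1r // normr0 mul0r.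
Qed.

End field_covariance.

(** * Integration over the two times *)

(** The integral is a difference of suprema over simple functions, so the
    comparison holds for arbitrary f. Pointwise bounds on covariances can thus be
    integrated in time without studying their dependence on the times. *)
Lemma le_integral_nonneg dT (T : measurableType dT) (R : realType)
    (mu : measure T R) (D : set T) (f g : T -> \bar R) :
  (forall x, D x -> 0 <= g x)%E -> (forall x, D x -> f x <= g x)%E ->
  (\int[mu]_(x in D) f x <= \int[mu]_(x in D) g x)%E.
Proof.
move=> g0 fg; rewrite integralE.
apply: (@le_trans _ _ (\int[mu]_(x in D) f^\+ x)%E).
  rewrite -[leRHS]sube0; apply: leeB => //; exact: integral_ge0.
rewrite ge0_integralE // ge0_integralE //.
apply: ge_ereal_sup => _ [h hf <-]; apply: ereal_sup_ubound; exists h => // x.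
apply: (le_trans (hf x)); rewrite /patch; case: ifPn => // xD.
have Dx : D x by rewrite inE in xD.
by rewrite funeposE ge_max fg // g0.
Qed.

Lemma double_integral_band_le (R : realType) (T e B h : R) (F : R -> R -> \bar R) :
  0 < T -> 0 <= e -> 0 <= B -> 0 <= h ->
  (forall t s, 0 <= t <= T -> 0 <= s <= T ->
     (F t s <= (B * (\1_(`[t - e, t + e]%classic) s + h))%:E)%E) ->
  (\int[lebesgue_measure]_(t in `[0%R, T]) \int[lebesgue_measure]_(s in `[0%R, T]) F t s
   <= (B * T * (2 * e + T * h))%:E)%E.
Proof.
move=> T0 e0 B0 h0 Fle.
have lT : lebesgue_measure (`[0, T]%classic : set R) = T%:E.
  by rewrite lebesgue_measure_itv /= lte_fin T0 sube0.
have inner t : 0 <= t <= T -> (\int[lebesgue_measure]_(s in `[0%R, T]) F t s <=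
    (B * (2 * e + T * h))%:E)%E.
  move=> tT; set A := `[t - e, t + e]%classic.
  have mA : measurable (A : set (measurableTypeR R)) by exact: measurable_itv.
  have mI : measurable (`[0, T]%classic : set (measurableTypeR R)) by exact: measurable_itv.
  apply: (@le_trans _ _ (\int[lebesgue_measure]_(s in `[0%R, T]) (B%:E * ((\1_A s)%:E + h%:E)))%E).
    apply: le_integral_nonneg => s sT.
      by rewrite -EFinD -EFinM lee_fin mulr_ge0 // addr_ge0.
    by rewrite -EFinD -EFinM; apply: Fle => //; move: sT; rewrite /= in_itv.
  have mind : measurable_fun (`[0, T]%classic : set (measurableTypeR R)) (fun s => (\1_A s)%:E : \bar R).
    by apply/measurable_EFinP; exact: measurable_indic.
  rewrite ge0_integralZl_EFin //; first last.
  - by apply: emeasurable_funD => //; exact: measurable_cst.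
  - by move=> s _; rewrite -EFinD lee_fin addr_ge0.
  rewrite ge0_integralD //.
  rewrite integral_indic // integral_cst //= lT EFinM; apply: lee_wpmul2l; first by rewrite lee_fin.
  rewrite EFinD [(T * h)%R]mulrC EFinM; apply: leeD => //.
  apply: (@le_trans _ _ (lebesgue_measure (A : set (measurableTypeR R)))).
    by apply: le_measure; rewrite ?inE //; exact: measurableI.
  rewrite lebesgue_measure_itv /= lte_fin; case: ifP => _; rewrite ?lee_fin ?mulr_ge0 //.
  lra.
apply: (@le_trans _ _ (\int[lebesgue_measure]_(t in `[0%R, T]) cst (B * (2 * e + T * h))%:E t)%E).
  apply: le_integral_nonneg => t tT; last by apply: inner; move: tT; rewrite /= in_itv.
  by rewrite lee_fin mulr_ge0 // addr_ge0 // ?mulr_ge0 // ltW.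
rewrite integral_cst; last exact: measurable_itv.
by rewrite [X in (_ * X)%E]lT -EFinM lee_fin le_eqVlt; apply/orP; left; apply/eqP; ring.
Qed.

Section time_scale.
Context (R : realType) (d k N : nat) (N0 : (0 < N)%N).

(** The width of the band around the diagonal s = t, in macroscopic time. *)
Definition window : R := N%:R `^ (- ((2 * k * d)%:R / (2 + k * d)%:R)).

Lemma window_gt0 : 0 < window.
Proof. by rewrite powR_gt0 // ltr0n. Qed.

(** The width at which (N^2 w)^{-kd/2} = w. *)
Lemma window_balance : ((Num.sqrt (N%:R ^+ 2 * window))^-1 ^+ d) ^+ k = window.
Proof.
set x := (N%:R : R); have x0 : 0 < x by rewrite ltr0n.
have nz : ((2 + k * d)%:R : R) != 0 by rewrite pnatr_eq0.
rewrite /window -/x; set b := - _.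
have -> : x ^+ 2 * x `^ b = x `^ (2 + b).
  by rewrite powRD ?(gt_eqF x0) ?implybT // -powR_mulrn ?ltW.
rewrite -powR12_sqrt ?powR_ge0 // -[(_ `^ 2^-1)^-1]powR_inv1 ?powR_ge0 //.
rewrite -exprM -powR_mulrn ?powR_ge0 // -!powRrM; congr powR.
by rewrite /b; move: nz; rewrite !natrD !natrM => nz; field; exact: nz.
Qed.
End time_scale.

Lemma ptrans_le1 (R : realType) (d : nat) (p : Zd d -> Zd d -> R) (hp : jump_kernel p) t i j :
  0 <= t -> ptrans p t i j <= 1.
Proof.
move=> t0; have := ptrans_sum_le hp i t0 (isT : uniq [:: j]).
by rewrite big_seq1.
Qed.

(** Inside the window the transition probabilities are bounded by 1, outside by the
    heat kernel bound at the time N^2 w. *)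
Lemma diffusive_covariance_le (R : realType) (d : nat) (p : Zd d -> Zd d -> R) (hp : jump_kernel p)
  (rho : R) (rho0 : 0 < rho) (nu : probability (config d) R) (hnu : poisson_product rho nu)
  (dW : measure_display) (W : measurableType dW) (P : probability W R)
  (eta : R -> W -> config d) (heta : independent_walkers p nu P eta)
  (f fk : config d -> R) (hf : inL2 nu f) (k : nat) (hfk : is_projH rho nu k f fk)
  (hsum : coef_summable rho nu f) (phi : 'rV[R]_d -> R) (hphi : schwartz phi) :
  exists K C : R, [/\ 0 <= K, 0 <= C & forall (N : nat) (s t : R), (0 < N)%N -> 0 <= s -> s <= t ->
    \int[P]_w (field_X N (f \- fk) (eta (N%:R ^+ 2 * s) w) phi *
               field_X N (f \- fk) (eta (N%:R ^+ 2 * t) w) phi) <=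
    K * N%:R ^+ d * ((t - s <= window R d k N)%R%:R + C * window R d k N)].
Proof.
have [K K0 cov] := field_covariance_le hp rho0 hnu heta hf hfk hsum hphi.
have [C C0 heat] := ptrans_heat hp.
exists K, (C ^+ k); split => //; first exact: exprn_ge0.
move=> N s t N0 s0 st.
have N0' : (0 : R) < N%:R by rewrite ltr0n.
have e0 := window_gt0 R d k N0.
have sN : 0 <= N%:R ^+ 2 * s by rewrite mulr_ge0 // exprn_ge0.
have stN : N%:R ^+ 2 * s <= N%:R ^+ 2 * t by rewrite ler_wpM2l // exprn_ge0.
have Kd0 : 0 <= K * N%:R ^+ d by rewrite mulr_ge0 // exprn_ge0 // ltW.
have [nearby|far] := lerP (t - s) (window R d k N).
  have ub i j : ptrans p (N%:R ^+ 2 * t - N%:R ^+ 2 * s) i j <= 1.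
    by apply: ptrans_le1; rewrite // subr_ge0.
  apply: (le_trans (cov N _ _ 1 N0 sN stN ub)); rewrite expr1n; apply: ler_wpM2l => //.
  by rewrite lerDl mulr_ge0 ?exprn_ge0 // ltW.
have ub i j : ptrans p (N%:R ^+ 2 * t - N%:R ^+ 2 * s) i j <=
    C * (Num.sqrt (N%:R ^+ 2 * window R d k N))^-1 ^+ d.
  rewrite -mulrBr.
  have a0 : 0 < N%:R ^+ 2 * window R d k N by rewrite mulr_gt0 ?exprn_gt0.
  have ab : N%:R ^+ 2 * window R d k N <= N%:R ^+ 2 * (t - s).
    by rewrite ler_wpM2l ?exprn_ge0 // ltW.
  apply: (le_trans (heat _ i j (lt_le_trans a0 ab))); apply: ler_wpM2l => //.
  apply: lerXn2r; rewrite ?nnegrE ?invr_ge0 ?sqrtr_ge0 //.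
  by rewrite lef_pV2 ?posrE ?sqrtr_gt0 ?(lt_le_trans a0 ab) //; exact: ler_wsqrtr.
apply: (le_trans (cov N _ _ _ N0 sN stN ub)); apply: ler_wpM2l => //.
by rewrite add0r exprMn (window_balance R d k N0).
Qed.

Theorem theorem3p4 (R : realType) (d : nat) (hd : (0 < d)%N)
  (p : Zd d -> Zd d -> R) (hp : jump_kernel p)
  (rho : R) (hrho : 0 < rho)
  (nu : probability (config d) R) (hnu : poisson_product rho nu)
  (dW : measure_display) (W : measurableType dW) (P : probability W R)
  (eta : R -> W -> config d) (heta : independent_walkers p nu P eta)
  (f : config d -> R) (hf : inL2 nu f) (hsum : coef_summable rho nu f)
  (k : nat) (hk : (1 <= k)%N)
  (fk1 : config d -> R) (hfk1 : is_projH rho nu k.-1 f fk1)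
  (phi : 'rV[R]_d -> R) (hphi : schwartz phi) :
  forall T : R, 0 < T -> exists C : R, \forall N \near \oo,
    (((N%:R ^+ d)^-1)%:E *
      \int[lebesgue_measure]_(t in `[0%R, T])
        \int[lebesgue_measure]_(s in `[0%R, T])
          'E_P[(fun w => field_X N (f \- fk1) (eta (N%:R ^+ 2 * t) w) phi
                       * field_X N (f \- fk1) (eta (N%:R ^+ 2 * s) w) phi)%R]
     <= (C * N%:R `^ (- ((2 * k.-1 * d)%:R / (2 + k.-1 * d)%:R)))%:E)%E.
Proof.
move=> T T0.
have [K [C [K0 C0 cov]]] := diffusive_covariance_le hp hrho hnu heta hf hfk1 hsum hphi.
exists (K * T * (2 + T * C)); exists 1%N => // N /= N0.
rewrite -/(window R d k.-1 N); set e := window R d k.-1 N.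
have e0 : 0 < e by exact: window_gt0.
have Nd0 : (0 : R) < N%:R ^+ d by rewrite exprn_gt0 // ltr0n.
pose X u w := field_X N (f \- fk1) (eta (N%:R ^+ 2 * u) w) phi.
have sX u : 0 <= u -> sqint P (X u).
  move=> u0; apply: (sqint_field hp hrho hnu heta hf hfk1 hphi N0).
  by rewrite mulr_ge0 // exprn_ge0.
have band t s : 0 <= t <= T -> 0 <= s <= T ->
    ('E_P[(fun w => X t w * X s w)%R] <=
      (K * N%:R ^+ d * (\1_(`[(t - e)%R, (t + e)%R]%classic) s + C * e))%:E)%E.
  move=> /andP[t0 _] /andP[s0 _].
  rewrite expectation.unlock -[leLHS]fineK; last first.
    by apply: integrable_fin_num => //; exact: sqint_mul (sX t t0) (sX s s0).
  rewrite lee_fin -[leLHS]/(\int[P]_w (X t w * X s w)).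
  have ind (b : bool) : (b -> t - e <= s <= t + e) -> K * N%:R ^+ d * (b%:R + C * e) <=
      K * N%:R ^+ d * (\1_(`[t - e, t + e]%classic) s + C * e).
    move=> hb; apply: ler_wpM2l; first by rewrite mulr_ge0 // ltW.
    rewrite lerD2r; case: b hb => // /(_ isT) h.
    by rewrite indicE mem_set //= in_itv.
  have [st|ts] := lerP s t.
    rewrite (_ : \int[P]_w _ = \int[P]_w (X s w * X t w)); last first.
      by apply: eq_Rintegral => w _; rewrite mulrC.
    by apply: (le_trans (cov N s t N0 s0 st)); apply: ind; rewrite -/e; lra.
  by apply: (le_trans (cov N t s N0 t0 (ltW ts))); apply: ind; rewrite -/e; lra.
have KN0 : 0 <= K * N%:R ^+ d by rewrite mulr_ge0 // ltW.
have Ce0 : 0 <= C * e by rewrite mulr_ge0 // ltW.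
have := double_integral_band_le T0 (ltW e0) KN0 Ce0 band.
have V0 : (0 <= ((N%:R ^+ d)^-1 : R)%:E)%E by rewrite lee_fin invr_ge0 ltW.
move=> /(lee_wpmul2l V0)/le_trans; apply.
rewrite -EFinM lee_fin le_eqVlt; apply/orP; left; apply/eqP; field.
by rewrite gt_eqF // ltr0n.
Qed.
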